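(* Let $Q$ be symmetric (not necessarily semidefinite), $\hat Q=(I-\Gamma)^TQ(I-\Gamma)$, and $$M_1=\begin{bmatrix}A-\frac\rho2I&BR^{-1}B^T\\Q&-A^T+\frac\rho2I\end{bmatrix},\qquad M_2=\begin{bmatrix}A+G-\frac\rho2I&BR^{-1}B^T\\\hat Q&-(A+G)^T+\frac\rho2I\end{bmatrix}.$$ Assume that both $M_1$ and $M_2$ have no eigenvalues on the imaginary axis. Let $(\mathrm{R}_P)$ and $(\mathrm R_\Pi)$ denote the algebraic Riccati equations $$(\mathrm R_P)\ \ \rho P=A^TP+PA-PBR^{-1}B^TP+Q,\qquad (\mathrm R_\Pi)\ \ \rho\Pi=(A+G)^T\Pi+\Pi(A+G)-\Pi BR^{-1}B^T\Pi+\hat Q.$$ Then the following statements are equivalent: (i) The decentralized control laws $\hat u_i$ described in the context are well defined (i.e. there are symmetric $P,\Pi$ solving $(\mathrm R_P)$, $(\mathrm R_\Pi)$ and associated $s,\bar x\in C_{\rho/2}([0,\infty),\mathbb R^n)$), and with them, for any initial condition $(\hat x_1(0),\dots,\hat x_N(0))$ such that the $\hat x_i(0)$ are mutually independent with common mean $\bar x_0$, $\max_i\mathbb E\|\hat x_i(0)\|^2<C_0$ ($C_0$ independent of $N$), and $\{\hat x_i(0)\}$ independent of $\{W_i\}$, $$\sum_{i=1}^N\mathbb E\int_0^\infty e^{-\rho t}\big(\|\hat x_i(t)\|^2+\|\hat u_i(t)\|^2\big)dt<\infty.$$ (ii) $(\mathrm R_P)$ and $(\mathrm R_\Pi)$ admit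 $\rho$-stabilizing solutions $P$ and $\Pi$, respectively, and $\bar A+G-\frac\rho2I$ is Hurwitz, where $\bar A=A-BR^{-1}B^TP$. (iii) $(A-\frac\rho2I,B)$ is stabilizable, $(A+G-\frac\rho2I,B)$ is stabilizable, and $\bar A+G-\frac\rho2I$ is Hurwitz, where $\bar A=A-BR^{-1}B^TP$ with $P$ the $\rho$-stabilizing solution of $(\mathrm R_P)$.
   Context: $N$ is the number of agents, $\rho>0$ a discount constant. $A,G,\Gamma,Q\in\mathbb R^{n\times n}$, $B\in\mathbb R^{n\times r}$, $R\in\mathbb R^{r\times r}$, $\eta\in\mathbb R^n$ are constant, $Q,R$ symmetric, $R>0$. $C_{\rho/2}([0,\infty),\mathbb R^n)$ is the set of continuous $g:[0,\infty)\to\mathbb R^n$ with $\int_0^\infty e^{-\rho t}\|g(t)\|^2dt<\infty$; $f,\sigma\in C_{\rho/2}([0,\infty),\mathbb R^n)$. $W_1,\dots,W_N$ are independent one-dimensional Brownian motions. A matrix is Hurwitz if all its eigenvalues have negative real part. A $\rho$-stabilizing solution of $(\mathrm R_P)$ is a symmetric solution $P$ such that $A-BR^{-1}B^TP-\frac\rho2I$ is Hurwitz; a $\rho$-stabilizing solution of $(\mathrm R_\Pi)$ is a symmetric solution $\Pi$ such that $A+G-BR^{-1}B^T\Pi-\frac\rho2I$ is Hurwitz. Control laws: given symmetric solutions $P,\Pi$ of the two Riccati equations in the claim, $s,\bar x\in C_{\rho/2}([0,\infty),\mathbb R^n)$ are determined by $$\rho s=\dot s+[A+G-BR^{-1}B^T\Pi]^Ts+\Pi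 f-\bar\eta,\qquad \frac{d\bar x}{dt}=(A+G)\bar x-BR^{-1}B^T(\Pi\bar x+s)+f,\quad \bar x(0)=\bar x_0,$$ with $\bar\eta=Q\eta-\Gamma^TQ\eta$, and for $t\ge0$, $i=1,\dots,N$, $$\hat u_i(t)=-R^{-1}B^T[P\hat x_i(t)+(\Pi-P)\bar x(t)+s(t)],$$ where $\hat x_i$ are the closed-loop states: $d\hat x_i=[A\hat x_i+B\hat u_i+G\hat x^{(N)}+f]dt+\sigma dW_i$, $\hat x^{(N)}=\frac1N\sum_{j=1}^N\hat x_j$.
   Formalization: The number of agents is taken N ≥ 2, as (i)⇒(ii) fails for N = 1 (n = r = 1, B = Q = 0, A − ρ/2 = 1, G = −5); in (i) the initial states may be defined on any extension of the probability space carrying the W_i. *)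

(* Defs.v *)
From HB Require Import structures.
From mathcomp Require Import all_boot all_order all_algebra.
From mathcomp Require Import complex.
From mathcomp Require Import all_classical all_reals all_analysis.
Import Order.TTheory GRing.Theory Num.Theory.
Import numFieldNormedType.Exports.

Set Implicit Arguments.
Unset Strict Implicit.
Unset Printing Implicit Defensive.

Local Open Scope classical_set_scope.
Local Open Scope ring_scope.

(* Eigenvalues of a real matrix are taken in R[i], the complex numbers over R. *)
Definition complex_eigenvalue (R : realType) (n : nat) (M : 'M[R]_n)
    (z : R[i]) : bool :=
  eigenvalue (map_mx (real_complex R) M) z.

Definition hurwitz (R : realType) (n : nat) (M : 'M[R]_n) : Prop :=
  forall z : R[i], complex_eigenvalue M z -> complex.Re z < 0.

Definition no_imaginary_eigenvalue (R : realType) (n : nat) (M : 'M[R]_n) :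
    Prop :=
  forall z : R[i], complex_eigenvalue M z -> complex.Re z != 0.

Definition stabilizable (R : realType) (n r : nat) (A : 'M[R]_n)
    (B : 'M[R]_(n, r)) : Prop :=
  exists K : 'M[R]_(r, n), hurwitz (A + B *m K).

Definition positive_definite (R : realType) (r : nat) (M : 'M[R]_r) : Prop :=
  forall v : 'cV[R]_r, v != 0 -> 0 < (v^T *m M *m v) 0 0.

Definition hamiltonian (R : realType) (n r : nat) (rho : R) (A : 'M[R]_n)
    (B : 'M[R]_(n, r)) (Q : 'M[R]_n) (Rc : 'M[R]_r) : 'M[R]_(n + n) :=
  block_mx (A - (rho / 2)%:M) (B *m invmx Rc *m B^T)
           Q (- A^T + (rho / 2)%:M).

Definition riccati (R : realType) (n r : nat) (rho : R) (A : 'M[R]_n)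
    (B : 'M[R]_(n, r)) (Q : 'M[R]_n) (Rc : 'M[R]_r) (X : 'M[R]_n) : Prop :=
  rho *: X = A^T *m X + X *m A - X *m B *m invmx Rc *m B^T *m X + Q.

Definition stabilizing_solution (R : realType) (n r : nat) (rho : R)
    (A : 'M[R]_n) (B : 'M[R]_(n, r)) (Q : 'M[R]_n) (Rc : 'M[R]_r)
    (X : 'M[R]_n) : Prop :=
  [/\ X^T = X, riccati rho A B Q Rc X &
      hurwitz (A - B *m invmx Rc *m B^T *m X - (rho / 2)%:M)].

(* Squared Euclidean norm; the library norm on matrices is the sup norm. *)
Definition sqnorm (R : realType) (m : nat) (v : 'cV[R]_m) : R :=
  \sum_k v k 0 ^+ 2.

(* The class C_{rho/2}([0, oo), R^m). A function on [0, oo) is represented by a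
   total function on R whose values at negative times are irrelevant. *)
Definition C_half (R : realType) (m : nat) (rho : R) (g : R -> 'cV[R]_m) :
    Prop :=
  {within `[0, +oo[, continuous g} /\
  (\int[lebesgue_measure]_(t in `[0%R, +oo[)
     (expR (- (rho * t)) * sqnorm (g t))%:E < +oo)%E.

(* The sigma-algebra generated by the variables Y k, k in D. *)
Definition sigma_of (K T : Type) (R : realType) (D : set K) (Y : K -> T -> R) :
    set (set T) :=
  <<s \bigcup_(k in D) preimage_set_system setT (Y k) measurable >>.

Definition indep2 (d : measure_display) (T : measurableType d) (R : realType)
    (P : probability T R) (F1 F2 : set (set T)) : Prop :=
  forall E1 E2, F1 E1 -> F2 E2 -> P (E1 `&` E2) = (P E1 * P E2)%E.

Definition mutually_indep (d : measure_display) (T : measurableType d)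
    (R : realType) (P : probability T R) (I : finType)
    (F : I -> set (set T)) : Prop :=
  forall (J : {set I}) (E : I -> set T), (forall i, i \in J -> F i (E i)) ->
    P (\bigcap_(i in [set` J]) E i) = (\prod_(i in J) P (E i))%E.

(* The second argument of normal_prob is the standard deviation. *)
Definition brownian_motion (d : measure_display) (T : measurableType d)
    (R : realType) (P : probability T R) (W : R -> T -> R) : Prop :=
  [/\ forall t, 0 <= t -> measurable_fun setT (W t),
      {ae P, forall w, W 0 w = 0},
      forall s t, 0 <= s -> s < t ->
        indep2 P (sigma_of `[0, s] W)
                 (sigma_of [set: unit] (fun _ w => W t w - W s w)),
      forall s t, 0 <= s -> s < t -> forall E, measurable E ->
        pushforward P (fun w => W t w - W s w) E =
        normal_prob 0 (Num.sqrt (t - s)) E &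
      {ae P, forall w, {within `[0, +oo[, continuous (fun t => W t w)}}].

Definition indep_brownian_motions (d : measure_display) (T : measurableType d)
    (R : realType) (P : probability T R) (N : nat)
    (W : 'I_N -> R -> T -> R) : Prop :=
  (forall i, brownian_motion P (W i)) /\
  mutually_indep P (fun i => sigma_of `[0, +oo[ (W i)).

(* J is (a version of) \int_0^t sigma dW: for a continuous deterministic
   integrand the Ito integral is the L^2 limit of the left-endpoint sums over
   the partitions of [0, t] into m equal parts. *)
Definition is_wiener_integral (d : measure_display) (T : measurableType d)
    (R : realType) (P : probability T R) (n : nat) (W : R -> T -> R)
    (sigma : R -> 'cV[R]_n) (t : R) (J : T -> 'cV[R]_n) : Prop :=
  let tk (m k : nat) : R := t * k%:R / m%:R in
  (fun m : nat => (\int[P]_w (sqnorm (J w -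
      \sum_(k < m) (W (tk m k.+1) w - W (tk m k) w) *: sigma (tk m k)))%:E)%E)
    @ \oo --> (0 : \bar R)%E.

(* T', P' with the projection proj is an extension of the probability space
   T, P; random variables on T are pulled back to T' by composition with proj. *)
Definition extension (d d' : measure_display) (T : measurableType d)
    (T' : measurableType d') (R : realType) (P : probability T R)
    (P' : probability T' R) (proj : T' -> T) : Prop :=
  measurable_fun setT proj /\
  forall E, measurable E -> P' (proj @^-1` E) = P E.

Definition empirical_mean (R : realType) (n N : nat) (x : 'I_N -> 'cV[R]_n) :
    'cV[R]_n :=
  N%:R^-1 *: \sum_j x j.

(* rho s = ds/dt + [A + G - B Rc^-1 B^T Pi]^T s + Pi f - etabar. Together with
   continuity at 0, the equation on (0, oo) gives the one-sided one at 0. *)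
Definition s_equation (R : realType) (n r : nat) (rho : R)
    (A G Gamma Q : 'M[R]_n) (B : 'M[R]_(n, r)) (Rc : 'M[R]_r)
    (eta : 'cV[R]_n) (f : R -> 'cV[R]_n) (Pi : 'M[R]_n)
    (s : R -> 'cV[R]_n) : Prop :=
  forall t, 0 < t -> derivable s t 1 /\
    rho *: s t = derive1 s t + (A + G - B *m invmx Rc *m B^T *m Pi)^T *m s t
                 + Pi *m f t - (Q *m eta - Gamma^T *m Q *m eta).

Definition xbar_equation (R : realType) (n r : nat) (A G : 'M[R]_n)
    (B : 'M[R]_(n, r)) (Rc : 'M[R]_r) (f : R -> 'cV[R]_n) (Pi : 'M[R]_n)
    (s xbar : R -> 'cV[R]_n) (xbar0 : 'cV[R]_n) : Prop :=
  xbar 0 = xbar0 /\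
  forall t, 0 < t -> derivable xbar t 1 /\
    derive1 xbar t = (A + G) *m xbar t
                 - B *m invmx Rc *m B^T *m (Pi *m xbar t + s t) + f t.

Definition control_law (R : realType) (n r : nat) (B : 'M[R]_(n, r))
    (Rc : 'M[R]_r) (X Pi : 'M[R]_n) (s xbar : R -> 'cV[R]_n)
    (t : R) (x : 'cV[R]_n) : 'cV[R]_r :=
  - (invmx Rc *m B^T *m (X *m x + (Pi - X) *m xbar t + s t)).

(* x solves dx_i = [A x_i + B u t x_i + G x^(N) + f] dt + sigma dW_i,
   x_i(0) = x0_i, in integrated form and with continuous paths. Since the noise
   is additive, the solution is unique up to null sets without an adaptedness
   requirement. At t = 0 the last clause says x_i(0) = x0_i almost surely. *)
Definition closed_loop (d : measure_display) (T : measurableType d)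
    (R : realType) (P : probability T R) (n r N : nat) (A G : 'M[R]_n)
    (B : 'M[R]_(n, r)) (f sigma : R -> 'cV[R]_n) (W : 'I_N -> R -> T -> R)
    (u : R -> 'cV[R]_n -> 'cV[R]_r) (x0 : 'I_N -> T -> 'cV[R]_n)
    (x : 'I_N -> R -> T -> 'cV[R]_n) : Prop :=
  [/\ forall i t k, 0 <= t -> measurable_fun setT (fun w => x i t w k 0),
      forall i w, {within `[0, +oo[, continuous (fun t => x i t w)} &
      forall i t, 0 <= t ->
        is_wiener_integral P (W i) sigma t (fun w =>
          x i t w - x0 i w -
          \col_k (\int[lebesgue_measure]_(tau in `[0, t])
            (A *m x i tau w + B *m u tau (x i tau w)
             + G *m empirical_mean (fun j => x j tau w) + f tau) k 0)%R)].

Definition admissible_initial (d : measure_display) (T : measurableType d)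
    (R : realType) (P : probability T R) (n N : nat) (W : 'I_N -> R -> T -> R)
    (xbar0 : 'cV[R]_n) (C0 : R) (x0 : 'I_N -> T -> 'cV[R]_n) : Prop :=
  [/\ forall i k, measurable_fun setT (fun w => x0 i w k 0),
      mutually_indep P (fun i =>
        sigma_of [set: 'I_n] (fun k w => x0 i w k 0)),
      forall i k, ('E_P[(fun w => x0 i w k 0)%R] = ((xbar0 k 0)%R)%:E)%E,
      forall i, (\int[P]_w (sqnorm (x0 i w))%:E < C0%:E)%E &
      indep2 P
        (sigma_of [set: 'I_N * 'I_n] (fun p w => x0 p.1 w p.2 0))
        (sigma_of [set p : 'I_N * R | 0 <= p.2] (fun p => W p.1 p.2))].

Definition total_cost (d : measure_display) (T : measurableType d)
    (R : realType) (P : probability T R) (n r N : nat) (rho : R)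
    (u : R -> 'cV[R]_n -> 'cV[R]_r) (x : 'I_N -> R -> T -> 'cV[R]_n) :
    \bar R :=
  (\sum_(i < N) \int[P]_w \int[lebesgue_measure]_(t in `[0%R, +oo[)
     (expR (- (rho * t)) *
      (sqnorm (x i t w) + sqnorm (u t (x i t w))))%:E)%E.

(* Main.v *)
Require Import Defs.
From HB Require Import structures.
From mathcomp Require Import all_boot all_order all_algebra.
From mathcomp Require Import complex.
From mathcomp Require Import all_classical all_reals all_analysis.
From mathcomp Require Import measurable_realfun.
From mathcomp Require Import ring lra zify.
Import Order.TTheory GRing.Theory Num.Theory.
Import numFieldNormedType.Exports.

Set Implicit Arguments.
Unset Strict Implicit.
Unset Printing Implicit Defensive.

Local Open Scope classical_set_scope.
Local Open Scope ring_scope.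

Local Notation cRe := complex.Re.
Local Notation cIm := complex.Im.

(* The stable generalized eigenspace of a Hamiltonian matrix without imaginary
   eigenvalues is Lagrangian, and stabilizability makes it the graph of the
   stabilizing Riccati solution; with uniqueness of that solution this gives
   (ii) <-> (iii).

   (ii) -> (i): subtracting the Wiener integral J_i from the state of agent i
   leaves a linear differential equation for each path, first for the
   empirical mean (matrix Abar + G), then for each agent (matrix Abar). A
   Lyapunov form bounds the weighted L2 norms of the solutions by those of the
   data, and E|J_i(t)|^2 is at most a constant times int_0^t |sigma|^2, which
   is integrable against exp(-rho t) because rho > 0.

   (i) -> (ii): add a fair coin to the probability space and start agent 0 at
   xbar0 + v/2 or xbar0 - v/2 according to its outcome. The two outcomes share
   the noise, so the differences D_i of the two trajectories are deterministic
   systems of finite cost: D_0 - D_1 = exp(t Abar) v and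
   sum_i D_i = exp(t (Abar + G)) v. Finiteness for every v gives both Hurwitz
   conditions. The Pi in (i) need not be stabilizing, but Abar + G - rho/2
   being Hurwitz shows that (A + G - rho/2, B) is stabilizable, so a
   stabilizing one exists. *)

(** * Algebraic Riccati equations and Lyapunov forms *)

(** The discount enters the algebra only through the shift by [rho / 2], which absorbs the weight
    exp(-rho t) into the matrices. Statement (i) speaks of every closed-loop process, so it would
    say nothing if there were none. The direction (i) -> (ii) must therefore construct one, and
    [closed_loop] asks for continuous paths at every outcome. This is why the Wiener integral is
    built as a pathwise limit, redefined on a null set, and not merely as an L2 limit. In (ii) ->
    (i) the process is given instead, and its noise is read off as the state minus the initial value
    and the integrated drift. The equation for [s] is antistable: a solution of finite weighted norm
    has to be selected by its behaviour at infinity, hence the separate backward estimates. Only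
    finiteness of costs matters, so second moments are bounded up to constants and the variance of
    the normal law is never evaluated. *)

Definition cnormsq (R : realType) (z : R[i]) : R := cRe z ^+ 2 + cIm z ^+ 2.

Lemma cRe_sum (R : realType) (I : Type) (s : seq I) (P : pred I) (F : I -> R[i]) :
  cRe (\sum_(i <- s | P i) F i) = \sum_(i <- s | P i) cRe (F i).
Proof. by elim/big_rec2: _ => // i x y _ <-; case: (F i) y => [a b] [c e]. Qed.

Lemma conjE (R : realType) (z : R[i]) : Num.conj z = z^*%C.
Proof. by []. Qed.

Lemma trmxC_colE (R : realType) (n : nat) (w : 'cV[R[i]]_n) (i : 'I_n) :
  (w ^t*)%sesqui 0 i = (w i 0)^*%C.
Proof. by rewrite !mxE. Qed.

Lemma Re_trmxC_mul (R : realType) (n : nat) (w : 'cV[R[i]]_n) :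
  cRe (((w ^t*)%sesqui *m w) 0 0) = \sum_i cnormsq (w i 0).
Proof.
rewrite [X in cRe X]mxE cRe_sum; apply: eq_bigr => k _; rewrite trmxC_colE.
by case: (w k 0) => a b; rewrite /cnormsq/=; ring.
Qed.

(* The weights, chosen one coordinate at a time, absorb the off-diagonal entries by AM-GM. *)
Lemma trig_lyapunov (R : realType) (n : nat) (M : 'M[R[i]]_n) :
  is_trig_mx M -> (forall i, cRe (M i i) < 0) ->
  exists d : 'I_n -> R, (forall i, 0 < d i) /\
  exists2 c : R, 0 < c & forall y : 'cV[R[i]]_n,
    cRe (\sum_i (d i)%:C%C * ((y i 0)^*%C * (M *m y) i 0))
      <= - c * \sum_i cnormsq (y i 0).
Proof.
elim: n M => [|n IH] M /is_trig_mxP Mtrig Mneg.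
  exists (fun=> 1); split => //; exists 1 => // y.
  by rewrite !big_ord0 mulr0.
pose M' := \matrix_(i, j) M (lift ord0 i) (lift ord0 j).
have [||d [d0 [c c0 H]]] := IH M'.
- apply/is_trig_mxP => i j ij; rewrite mxE; apply: Mtrig.
  by rewrite !lift0 ltnS.
- by move=> i; rewrite mxE.
(* Young's inequality bounds the cross term of coordinate 0 and the [i]-th remaining one by [c / 2]
   times the square of the latter plus [m i] times the square of the former. The weight [k] of
   coordinate 0 is chosen so that [k * t] pays for all the [m i] and still leaves [- c / 2]. *)
pose m i : R := d i ^+ 2 * cnormsq (M (lift ord0 i) ord0) / (2 * c).
pose t := cRe (M ord0 ord0).
have t0 : t < 0 by exact: Mneg.
pose k := (c / 2 + \sum_i m i) / - t.
have m0 i : 0 <= m i.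
  by rewrite /m divr_ge0 ?mulr_ge0 ?sqr_ge0 ?addr_ge0 ?sqr_ge0// ltW// mulr_gt0.
have k0 : 0 < k.
  rewrite /k divr_gt0 ?oppr_gt0//; apply: ltr_pwDl; first by rewrite divr_gt0.
  exact: sumr_ge0.
exists (fun i => if unlift ord0 i is Some j then d j else k).
split; first by move=> i; case: unliftP => [j|] _.
exists (c / 2); first by rewrite divr_gt0.
move=> y; rewrite !big_ord_recl /= unlift_none.
under eq_bigr do rewrite liftK.
pose y' := \col_i y (lift ord0 i) 0.
have E0 : (M *m y) ord0 0 = M ord0 ord0 * y ord0 0.
  rewrite mxE big_ord_recl big1 ?addr0// => i _.
  by rewrite Mtrig ?mul0r.
have E1 i : (M *m y) (lift ord0 i) 0 = M (lift ord0 i) ord0 * y ord0 0 + (M' *m y') i 0.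
  by rewrite !mxE big_ord_recl; congr (_ + _); apply: eq_bigr => j _; rewrite !mxE.
rewrite E0; under eq_bigr do rewrite E1 mulrDr mulrDr.
rewrite big_split/=.
have -> : \sum_(i < n) (d i)%:C%C * ((y (lift ord0 i) 0)^*%C * (M' *m y') i 0) =
  \sum_i (d i)%:C%C * ((y' i 0)^*%C * (M' *m y') i 0).
  by apply: eq_bigr => i _; rewrite [y' _ _]mxE.
have := H y'.
have -> : \sum_i cnormsq (y' i 0) = \sum_(i < n) cnormsq (y (lift ord0 i) 0).
  by apply: eq_bigr => i _; rewrite mxE.
set Z := cRe (\sum_i _ * (_ * (M' *m _) _ _)) => HZ.
have HX : cRe (\sum_(i < n) (d i)%:C%C * ((y (lift ord0 i) 0)^*%C *
      (M (lift ord0 i) ord0 * y ord0 0))) <=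
   \sum_(i < n) (c / 2 * cnormsq (y (lift ord0 i) 0) + m i * cnormsq (y ord0 0)).
  rewrite cRe_sum; apply: ler_sum => i _; rewrite /m /cnormsq.
  move: (y _ _) (M _ _) (y _ _) (d i) => [a1 a2] [m1 m2] [b1 b2] e /=.
  rewrite -subr_ge0.
  rewrite [leRHS](_ : _ = ((c * b1 - e * (m1 * a1 - m2 * a2)) ^+ 2 +
      (c * b2 - e * (m1 * a2 + m2 * a1)) ^+ 2) / (2 * c)); last first.
    by field; rewrite gt_eqF.
  by rewrite divr_ge0 ?addr_ge0 ?sqr_ge0 ?mulr_ge0 ?ltW.
rewrite big_split/= -mulr_sumr -mulr_suml in HX.
have -> : forall a b c : R[i], cRe (a + (b + c)) = cRe a + (cRe b + cRe c).
  by case=> ? ? [? ?] [? ?].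
rewrite -/Z.
have -> : cRe (k%:C%C * ((y ord0 0)^*%C * (M ord0 ord0 * y ord0 0))) =
  k * t * cnormsq (y ord0 0).
  rewrite /t /cnormsq; case: (M _ _) (y _ _) => [? ?] [? ?] /=; ring.
have -> : k * t = - (c / 2 + \sum_i m i).
  by rewrite /k; field; rewrite lt_eqF ?oppr_lt0.
move: HX HZ; set a := cRe _; set q := cnormsq (y _ _); set p := \sum_(i < n) _ (y _ _).
move: Z a (\sum_i m i) => Z a mm HX HZ; lra.
Qed.

(** * Eigenvalues under transposition, conjugation and similarity; real parts *)

Lemma eigenvalue_unitmx (F : fieldType) (n : nat) (M : 'M[F]_n) (a : F) :
  eigenvalue M a = (M - a%:M \notin unitmx).
Proof. by rewrite /eigenvalue /eigenspace kermx_eq0 row_free_unit. Qed.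

Lemma eigenvalue_trmx (F : fieldType) (n : nat) (M : 'M[F]_n) (a : F) :
  eigenvalue M^T a = eigenvalue M a.
Proof. by rewrite !eigenvalue_unitmx -unitmx_tr linearB/= trmxK tr_scalar_mx. Qed.

Lemma eigenvalue_conj (C : numClosedFieldType) (n : nat) (M : 'M[C]_n) (a : C) :
  eigenvalue (map_mx Num.conj M) a = eigenvalue M (a^*)%R.
Proof.
rewrite !eigenvalue_unitmx -(map_unitmx Num.conj) map_mxB -map_mx_comp.
have -> : map_mx (Num.conj \o Num.conj) M = M.
  by apply/matrixP => i j; rewrite mxE/= conjCK.
by rewrite map_scalar_mx.
Qed.

Lemma eigenvalue_similar (F : fieldType) (n : nat) (P M : 'M[F]_n) (a : F) :
  P \in unitmx -> eigenvalue (P *m M *m invmx P) a = eigenvalue M a.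
Proof.
move=> Pu; rewrite !eigenvalue_unitmx.
have -> : P *m M *m invmx P - a%:M = P *m (M - a%:M) *m invmx P.
  rewrite mulmxBr mulmxBl; congr (_ - _).
  by rewrite mul_mx_scalar -scalemxAl mulmxV// scalemx1.
by rewrite !unitmx_mul unitmx_inv Pu andbT.
Qed.

Lemma eigenvalue_trig (F : fieldType) (n : nat) (M : 'M[F]_n) (i : 'I_n) :
  is_trig_mx M -> eigenvalue M (M i i).
Proof.
move=> Mt; rewrite eigenvalue_unitmx unitmxE det_trig; last first.
  apply/is_trig_mxP => j k jk; rewrite !mxE (is_trig_mxP Mt)//.
  by rewrite -val_eqE ltn_eqF// mulr0n subr0.
by rewrite (bigD1 i)//= !mxE eqxx mulr1n subrr mul0r unitr0.
Qed.

Lemma map_Re_mulmxl (R : realType) (m n p : nat) (A : 'M[R]_(m, n)) (B : 'M[R[i]]_(n, p)) :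
  map_mx (@complex.Re R) (map_mx (real_complex R) A *m B) = A *m map_mx (@complex.Re R) B.
Proof.
apply/matrixP => i j; rewrite !mxE cRe_sum; apply: eq_bigr => k _.
by rewrite !mxE; case: (B k j) => a b /=; rewrite mul0r subr0.
Qed.

Lemma map_Re_mulmxr (R : realType) (m n p : nat) (A : 'M[R[i]]_(m, n)) (B : 'M[R]_(n, p)) :
  map_mx (@complex.Re R) (A *m map_mx (real_complex R) B) = map_mx (@complex.Re R) A *m B.
Proof.
apply/matrixP => i j; rewrite !mxE cRe_sum; apply: eq_bigr => k _.
by rewrite !mxE; case: (A i k) => a b /=; rewrite mulr0 subr0.
Qed.

Lemma trmx_map_Re (R : realType) (n : nat) (M : 'M[R[i]]_n) :
  (M ^t*)%sesqui = M -> (map_mx (@complex.Re R) M)^T = map_mx (@complex.Re R) M.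
Proof.
move=> H; apply/matrixP => i j; have := congr1 (fun M : 'M[R[i]]_n => cRe (M i j)) H.
by rewrite !mxE; case: (M j i).
Qed.

(** Unitary triangularization over the complex numbers reduces the claim to [trig_lyapunov], whose
    diagonal weight [D] is pulled back to [Ps *m D *m P]. This Hermitian matrix need not be real,
    but its real part serves as [L], because only the real parts of the forms at real vectors are
    needed. *)
Lemma hurwitz_lyapunov (R : realType) (n : nat) (M : 'M[R]_n) : hurwitz M ->
  exists2 L : 'M[R]_n, L^T = L & exists2 c : R, 0 < c &
  forall v : 'cV[R]_n, (v^T *m L *m M *m v) 0 0 <= - c * sqnorm v /\
    c * sqnorm v <= (v^T *m L *m v) 0 0.
Proof.
case: n M => [|n] M hM.
  exists 0; first by rewrite trmx0.
  exists 1 => // v; rewrite /sqnorm big_ord0 !mulr0.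
  by rewrite !mxE !big_ord0.
pose MC := map_mx (real_complex R) M.
have [P Pu] := @Schur _ _ MC isT.
rewrite /similar_to /conjmx pinvmx_unitary//=.
have PP : (P ^t* *m P)%sesqui = 1%:M.
  by rewrite -invmx_unitary// mulVmx// unitarymx_unit.
have PP2 : (P *m P ^t*)%sesqui = 1%:M by exact/unitarymxP.
have PsI : (P ^t*)%sesqui = invmx P by rewrite invmx_unitary.
have [Ps PsE] : exists Ps, Ps = (P ^t*)%sesqui by exists (P ^t*)%sesqui.
rewrite -PsE in PP PP2 PsI *.
have PPK m (A : 'M[R[i]]_(m, n.+1)) : A *m Ps *m P = A by rewrite -mulmxA PP mulmx1.
pose rC m k (A : 'M[R]_(m, k)) : 'M[R[i]]_(m, k) := map_mx (real_complex R) A.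
have Pst (v : 'cV_n.+1) : ((P *m rC _ _ v) ^t*)%sesqui = rC _ _ v^T *m Ps.
  rewrite PsE trmx_mul map_mxM; congr (_ *m _).
  by rewrite /rC; apply/matrixP => i j; rewrite !mxE; exact: conjc_real.
set T := _ *m _ *m _ => Ttrig.
have [|d [d0 [c c0 H]]] := trig_lyapunov Ttrig.
  move=> i; apply: hM; rewrite /complex_eigenvalue -/MC -(@eigenvalue_similar _ _ P).
    by rewrite -PsI; exact: eigenvalue_trig.
  exact: unitarymx_unit.
pose D : 'M[R[i]]_n.+1 := diag_mx (\row_i (d i)%:C%C).
pose La := (Ps *m D *m P).
pose L := map_mx (@complex.Re R) La.
have key (v : 'cV[R]_n.+1) (N : 'M[R[i]]_n.+1) : let y := P *m rC _ _ v in
   rC _ _ v^T *m La *m N *m rC _ _ v =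
   (\sum_i (d i)%:C%C * ((y i 0)^*%C * (P *m N *m Ps *m y) i 0))%:M.
  move=> y; rewrite [LHS]mx11_scalar; congr (_%:M).
  have -> : rC _ _ v^T *m La *m N *m rC _ _ v =
      (y ^t*)%sesqui *m (D *m (P *m N *m Ps *m y)).
    by rewrite Pst /y /La !mulmxA PPK.
  rewrite mxE; apply: eq_bigr => i _.
  rewrite trmxC_colE.
  have -> (w : 'cV[R[i]]_n.+1) : (D *m w) i 0 = (d i)%:C%C * w i 0.
    by rewrite mul_diag_mx !mxE.
  by rewrite mulrCA.
have Ntrans (v : 'cV[R]_n.+1) : \sum_i cnormsq ((P *m rC _ _ v) i 0) = sqnorm v.
  rewrite -Re_trmxC_mul Pst !mulmxA PPK.
  rewrite [X in cRe X]mxE cRe_sum /sqnorm; apply: eq_bigr => k _.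
  by rewrite /rC !mxE /=; ring.
have Lquad (v : 'cV[R]_n.+1) (N : 'M[R]_n.+1) : (v^T *m L *m N *m v) 0 0 =
   cRe ((rC _ _ v^T *m La *m rC _ _ N *m rC _ _ v) 0 0).
  rewrite /L -map_Re_mulmxl -!map_Re_mulmxr mxE; congr (cRe (_ _ _)).
exists L.
  have Lah : (La ^t*)%sesqui = La.
    rewrite /La PsE !trmx_mul !map_mxM mulmxA map_trmx trmxK -map_mx_comp.
    congr (_ *m _ *m _).
      rewrite /D tr_diag_mx; apply/matrixP => i j; rewrite !mxE.
      by rewrite rmorphMn/= conjE conjc_real.
    by apply/matrixP => i j; rewrite mxE/= conjCK.
  exact: trmx_map_Re.
pose dm := \big[Num.min/1]_i d i.
have dm0 : 0 < dm by apply/lt_bigmin => //; rewrite ltr01.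
(* One constant serves both estimates: [c] controls the dissipation and the least weight [dm] the
   positivity. *)
exists (Num.min c dm); first by rewrite lt_min c0.
move=> v; split.
  rewrite Lquad key mxE eqxx mulr1n.
  have := H (P *m rC _ _ v).
  rewrite Ntrans /T => /le_trans; apply.
  rewrite ler_wpM2r//; first by apply: sumr_ge0 => i _; exact: sqr_ge0.
  by rewrite lerN2 ge_min lexx.
have := Lquad v 1%:M; rewrite mulmx1 => ->.
rewrite /rC map_mx1 key mxE eqxx mulr1n cRe_sum -Ntrans mulr_sumr.
apply: ler_sum => i _.
rewrite mulmx1 PP2 mul1mx; move: (_ i 0) => [a b].
rewrite /cnormsq /=.
have h : Num.min c dm <= d i by rewrite ge_min; apply/orP; right; exact: bigmin_le.
have -> : (d i * (a * a - - b * b) - 0 * (a * b + - b * a)) = d i * (a ^+ 2 + b ^+ 2) by ring.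
by rewrite ler_wpM2r// addr_ge0 ?sqr_ge0.
Qed.

(** The relation moves a linear factor [F - z] across [D], where it becomes [- E - z]. Applied to
    the characteristic polynomial of [F] this gives 0 = [U *m D] with [U] a product of factors
    [- E - z]. Each factor is invertible, since [- z] has positive real part and is no eigenvalue of
    [E]. *)
Lemma sylvester_unique (R : realType) (m n : nat) (E : 'M[R[i]]_m) (F : 'M[R[i]]_n)
    (D : 'M[R[i]]_(m, n)) :
  (forall z, eigenvalue E z -> cRe z < 0) -> (forall z, eigenvalue F z -> cRe z < 0) ->
  E *m D = - (D *m F) -> D = 0.
Proof.
case: n F D => [|n] F D; first by move=> *; exact: thinmx0.
case: m E D => [|m] E D; first by move=> *; exact: flatmx0.
move=> hE hF ED.
have [s cs] := closed_field_poly_normal (char_poly F).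
rewrite (monicP (char_poly_monic F)) scale1r in cs.
have hs z : z \in s -> cRe z < 0.
  move=> zs; apply: hF; rewrite eigenvalue_root_char cs root_prod_XsubC//.
have : exists2 U : 'M[R[i]]_m.+1, U \in unitmx & D *m horner_mx F (\prod_(z <- s) ('X - z%:P)) = U *m D.
  elim: s hs {cs} => [|z s IH] hs.
    by exists 1%:M; rewrite ?unitmx1// big_nil rmorph1 mulmx1 mul1mx.
  have [t ts|U Uu HU] := IH; first by apply: hs; rewrite inE ts orbT.
  exists (U *m (- E - z%:M)).
    have -> : - E - z%:M = -1 *: (E - (- z)%:M).
      by rewrite scaleN1r raddfN/= opprK opprD.
    rewrite unitmx_mul Uu unitmxZ ?unitrN1// andTb.
    have : ~~ eigenvalue E (- z).
      apply/negP => /hE; have := hs z (mem_head _ _); case: (z) => a b /=.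
      by rewrite oppr_lt0 => h1 h2; have := lt_trans h1 h2; rewrite ltxx.
    by rewrite eigenvalue_unitmx negbK.
  rewrite big_cons mulrC rmorphM/= -[_ * _]/(_ *m _) mulmxA HU rmorphB/= horner_mx_X horner_mx_C.
  rewrite -!mulmxA; congr (_ *m _).
  by rewrite mulmxBr mulmxBl mulNmx ED opprK scalar_mxC.
case=> U Uu; rewrite -cs Cayley_Hamilton mulmx0 => /esym UD.
by rewrite -[D]mul1mx -(mulVmx Uu) -mulmxA UD mulmx0.
Qed.

(* A row [v] with [v p(G) = 0] has [v J w^* = 0] for every such [w]: since
   [G J = - J G^*], moving [p(G)] across [J] turns it into [q(G)^*] where the roots
   of [q] are those of [p] reflected in the imaginary axis, and [q] is coprime to [p]. *)
Lemma kermxpoly_isotropic (C : numClosedFieldType) (n : nat) (G J : 'M[C]_n.+1) (s : seq C) :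
  G *m J = - (J *m (G ^t*)%sesqui) ->
  (forall x y, x \in s -> y \in s -> x + (y^*)%R != 0) ->
  let U := kermxpoly G (\prod_(z <- s) ('X - z%:P)) in
  U *m J *m (U ^t*)%sesqui = 0.
Proof.
move=> GJ hs U.
pose q : {poly C} := \prod_(z <- s) ('X - (- (z^*)%R)%:P).
have cop : coprimep (\prod_(z <- s) ('X - z%:P)) q.
  rewrite /q (big_morph _ (id1 := true) (op1 := andb) (coprimepMr _) (coprimep1 _)).
  rewrite big_all; apply/allP => z zs.
  rewrite coprimep_XsubC root_prod_XsubC.
  apply/negP => zs'; have := hs _ _ zs' zs.
  by rewrite addNr eqxx.
have UqE : exists V : 'M[C]_n.+1, U = V *m horner_mx G q.
  have /Bezout_eq1_coprimepP [[/= u v]] := cop.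
  rewrite mulrC => /(congr1 (horner_mx G)).
  rewrite rmorph1 rmorphD !rmorphM/= => h.
  exists (U *m horner_mx G v).
  rewrite -mulmxA -[RHS]add0r -[U in LHS]mulmx1 -[1%:M]/1 -h mulmxDr.
  by congr (_ + _); rewrite -[_ * _]/(_ *m _) mulmxA mulmx_ker mul0mx.
have [V VE] := UqE.
rewrite [X in (X ^t*)%sesqui]VE trmx_mul map_mxM mulmxA.
suff -> : U *m J *m (horner_mx G q ^t*)%sesqui = 0 by rewrite mul0mx.
have : exists2 e : C, e != 0 & horner_mx G (\prod_(z <- s) ('X - z%:P)) *m J =
      e *: (J *m (horner_mx G q ^t*)%sesqui).
  rewrite /q; elim: (s) => [|z t [e e0 IH]].
    by exists 1; rewrite ?oner_eq0// !big_nil !rmorph1 trmx1 map_mx1 mulmx1 mul1mx scale1r.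
  exists (- e); first by rewrite oppr_eq0.
  rewrite !big_cons !rmorphM/= -[_ * _]/(_ *m _) -mulmxA IH.
  rewrite -scalemxAr mulmxA rmorphB/= horner_mx_X horner_mx_C.
  have -> : horner_mx G ('X - (- (z^*)%R)%:P) * horner_mx G (\prod_(j <- t) ('X - (- (j^*)%R)%:P))
     = horner_mx G (\prod_(j <- t) ('X - (- (j^*)%R)%:P)) *m (G + ((z^*)%R)%:M).
    rewrite -rmorphM mulrC rmorphM/=; congr (_ *m _).
    by rewrite rmorphB/= horner_mx_X horner_mx_C raddfN/= opprK.
  rewrite trmx_mul map_mxM mulmxA scaleNr -scalerN -mulNmx; congr (_ *: (_ *m _)).
  rewrite mulmxBl GJ linearD/= map_mxD mulmxDr opprD; congr (_ - _).
  by rewrite tr_scalar_mx map_scalar_mx/= conjCK scalar_mxC.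
case=> e e0 E; apply: (scalerI e0); rewrite scaler0 -mulmxA scalemxAr -E mulmxA.
by rewrite /U mulmx_ker mul0mx.
Qed.

(** As [J] is invertible, [U *m J] keeps the rank of [U], and it is annihilated by a matrix of that
    same rank. *)
Lemma rank_isotropic (C : numClosedFieldType) (m k : nat) (U : 'M[C]_(k, m)) (J : 'M[C]_m) :
  J \in unitmx -> U *m J *m (U ^t*)%sesqui = 0 -> (2 * \rank U <= m)%N.
Proof.
move=> Ju /mulmx0_rank_max.
by rewrite mxrankMfree ?row_free_unit// mxrank_map mxrank_tr mul2n addnn.
Qed.

Lemma prod_XsubC_eigenvector (C : fieldType) (n : nat) (G : 'M[C]_n.+1) (s : seq C) (v : 'rV[C]_n.+1) (a : C) :
  v *m G = a *: v ->
  v *m horner_mx G (\prod_(z <- s) ('X - z%:P)) = (\prod_(z <- s) (a - z)) *: v.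
Proof.
move=> vG; elim: s => [|z s IH].
  by rewrite !big_nil rmorph1 mulmx1 scale1r.
rewrite !big_cons [in LHS]mulrC rmorphM/= -[_ * _]/(_ *m _) mulmxA IH -scalemxAl.
by rewrite rmorphB/= horner_mx_X horner_mx_C mulmxBr vG mul_mx_scalar -scalerBl scalerA mulrC.
Qed.

(** The roots of the characteristic polynomial are split by the sign of their real part. Both
    generalized eigenspaces are isotropic, so each has at most half the dimension; by
    Cayley-Hamilton they fill the whole space, so each has exactly half. Subspaces are row spaces,
    which is why [G] acts on the right of [V]. *)
Lemma stable_lagrangian (R : realType) (n : nat) (G J : 'M[R[i]]_(n.+1 + n.+1)) :
  G *m J = - (J *m (G ^t*)%sesqui) -> J \in unitmx ->
  (forall z, eigenvalue G z -> cRe z != 0) ->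
  exists V : 'M[R[i]]_(n.+1, n.+1 + n.+1), exists La : 'M[R[i]]_n.+1,
  [/\ row_free V, V *m G = La *m V, V *m J *m (V ^t*)%sesqui = 0 &
     forall z, eigenvalue La z -> cRe z < 0].
Proof.
move=> GJ Ju hG.
have [s cs] := closed_field_poly_normal (char_poly G).
rewrite (monicP (char_poly_monic G)) scale1r in cs.
pose sm := [seq z <- s | cRe z < 0]; pose sp := [seq z <- s | ~~ (cRe z < 0)].
have sp0 z : z \in sp -> 0 < cRe z.
  rewrite mem_filter => /andP[h zs]; rewrite lt_def leNgt h andbT.
  by apply: hG; rewrite eigenvalue_root_char cs root_prod_XsubC.
have sm0 z : z \in sm -> cRe z < 0 by rewrite mem_filter => /andP[].
have ReD (x y : R[i]) : cRe (x + (y^*)%R) = cRe x + cRe y by case: x y => [? ?] [? ?].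
have hm : forall x y, x \in sm -> y \in sm -> x + (y^*)%R != 0.
  move=> x y /sm0 x0 /sm0 y0; apply/eqP => /(congr1 (@complex.Re R)); rewrite ReD /= => h.
  by have := ltrD x0 y0; rewrite h addr0 ltxx.
have hp : forall x y, x \in sp -> y \in sp -> x + (y^*)%R != 0.
  move=> x y /sp0 x0 /sp0 y0; apply/eqP => /(congr1 (@complex.Re R)); rewrite ReD /= => h.
  by have := addr_gt0 x0 y0; rewrite h ltxx.
have Im := kermxpoly_isotropic GJ hm.
have Ip := kermxpoly_isotropic GJ hp.
set Um := kermxpoly G _ in Im; set Up := kermxpoly G _ in Ip.
have cop : coprimep (\prod_(z <- sm) ('X - z%:P)) (\prod_(z <- sp) ('X - z%:P)).
  rewrite (big_morph _ (id1 := true) (op1 := andb) (coprimepMr _) (coprimep1 _)).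
  rewrite big_all; apply/allP => z zs.
  rewrite coprimep_XsubC root_prod_XsubC.
  by apply/negP => /sm0 h; have := lt_trans h (sp0 _ zs); rewrite ltxx.
have rk : (\rank Um + \rank Up = n.+1 + n.+1)%N.
  rewrite -(mxrank_disjoint_sum (mxdirect_kermxpoly G cop)) -(kermxpolyM G cop).
  rewrite (_ : _ * _ = char_poly G); last by rewrite cs [RHS](bigID (fun z => cRe z < 0))/= /sm /sp !big_filter.
  have /(mxrank_leqif_eq) : (1%:M <= kermxpoly G (char_poly G))%MS.
    by apply/sub_kermxP; rewrite Cayley_Hamilton mulmx0.
  move=> [h _]; apply/eqP; rewrite eqn_leq rank_leq_row/=.
  by rewrite mxrank1 in h.
have rkm : \rank Um = n.+1.
  have half a b m : (a + b = m + m -> 2 * b <= m + m -> 2 * a <= m + m -> a = m)%N by lia.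
  exact: half rk (rank_isotropic Ju Ip) (rank_isotropic Ju Im).
have [V [Vf VU]] : exists V : 'M[R[i]]_(n.+1, n.+1 + n.+1), row_free V /\ (V :=: Um)%MS.
  have := row_base_free Um; have := eq_row_base Um.
  by move: (row_base Um); rewrite rkm => V ? ?; exists V.
have [La VG] : exists La : 'M[R[i]]_n.+1, V *m G = La *m V.
  apply/submxP; rewrite VU (eqmxMr _ VU).
  exact: comm_mx_stable_kermxpoly.
exists V, La; split => //.
  have /submxP[X ->] : (V <= Um)%MS by rewrite VU.
  by rewrite trmx_mul map_mxM mulmxA -[X *m Um *m J]mulmxA -[X *m _ *m _]mulmxA Im mulmx0 mul0mx.
(* An eigenvector [v] of [La] yields the eigenvector [v *m V] of [G] in the stable space. The
   product over [sm] kills it and also multiplies it by the product of all [z - y], so [z] is one of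
   the stable roots. *)
move=> z /eigenvalueP[v vz v0].
have : v *m V *m G = z *: (v *m V) by rewrite -mulmxA VG mulmxA vz scalemxAl.
move/(prod_XsubC_eigenvector sm).
have /sub_kermxP -> : (v *m V <= Um)%MS by rewrite (submx_trans (submxMl _ _))// VU.
move/esym/eqP; rewrite scaler_eq0 mulmx_free_eq0// (negbTE v0) orbF.
rewrite prodf_seq_eq0 => /hasP[y ys /andP[_]]; rewrite subr_eq0 => /eqP ->.
exact: sm0.
Qed.

(** The row space of [K] is invariant under [La], so [La] restricts to a matrix [Th] in the basis
    [row_base K], and an eigenvector of [Th] is transported back. *)
Lemma stable_eigenvector (C : numClosedFieldType) (m n : nat) (K : 'M[C]_(m, n)) (La : 'M[C]_n) :
  K != 0 -> (K *m La <= K)%MS ->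
  exists a, exists2 v : 'rV[C]_n, v != 0 & (v <= K)%MS /\ v *m La = a *: v.
Proof.
move=> K0 KL.
have [Th UT] : exists Th, row_base K *m La = Th *m row_base K.
  by apply/submxP; rewrite eq_row_base (eqmxMr _ (eq_row_base K)).
have [|a /eigenvalueP[u uT u0]] := @eigenvalue_closed _ _ Th; first by rewrite lt0n mxrank_eq0.
exists a, (u *m row_base K); first by rewrite mulmx_free_eq0 ?row_base_free.
split; first by rewrite (submx_trans (submxMl _ _))// eq_row_base.
by rewrite -mulmxA UT mulmxA uT scalemxAl.
Qed.

Lemma eigenvalue_trmxC (C : numClosedFieldType) (n : nat) (M : 'M[C]_n) (a : C) :
  eigenvalue (M ^t*)%sesqui a = eigenvalue M (a^*)%R.
Proof. by rewrite eigenvalue_conj eigenvalue_trmx. Qed.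

Lemma mulmx_invmx_exchange (F : fieldType) (n : nat) (X1 X2 Y1 Y2 : 'M[F]_n) :
  X1 \in unitmx -> Y1 \in unitmx -> X1 *m Y2 = X2 *m Y1 ->
  Y2 *m invmx Y1 = invmx X1 *m X2.
Proof. by move=> Xu Yu E; rewrite -[Y2](mulKmx Xu) E !mulmxA mulmxK. Qed.

(** With [row_mx X1 X2] a basis of the stable Lagrangian space, the solution is minus
    [invmx X1 *m X2]: isotropy makes it Hermitian, and the two block rows of the invariance relation
    combine to the Riccati equation. The fourth hypothesis is the Popov-Belevitch-Hautus form of
    stabilizability: a left eigenvector of [A] that the control does not see has a stable
    eigenvalue. *)
Lemma riccati_complex_exists (R : realType) (n : nat) (A S Q : 'M[R[i]]_n.+1) :
  (S ^t*)%sesqui = S -> (Q ^t*)%sesqui = Q ->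
  (forall w : 'rV_n.+1, w *m S *m (w ^t*)%sesqui = 0 -> w *m S = 0) ->
  (forall z (w : 'rV_n.+1), w != 0 -> w *m A = z *: w -> w *m S = 0 -> cRe z < 0) ->
  (forall z, eigenvalue (block_mx (A ^t*)%sesqui Q S (- A)) z -> cRe z != 0) ->
  exists X : 'M[R[i]]_n.+1, [/\ (X ^t*)%sesqui = X,
    (A ^t*)%sesqui *m X + X *m A - X *m S *m X + Q = 0 &
    forall z, eigenvalue (A - S *m X) z -> cRe z < 0].
Proof.
move=> hS hQ hSp hst hG.
pose G := block_mx (A ^t*)%sesqui Q S (- A).
pose J : 'M[R[i]]_(n.+1 + n.+1) := block_mx 0 1%:M (- 1%:M) 0.
have JJ : J *m (- J) = 1%:M.
  rewrite /J opp_block_mx mulmx_block.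
  by rewrite !(oppr0, opprK, mul0mx, mulmx0, mul1mx, mulmx1, mulNmx, mulmxN, add0r, addr0) -scalar_mx_block.
have Ju : J \in unitmx by case: (mulmx1_unit JJ).
have GJ : G *m J = - (J *m (G ^t*)%sesqui).
  rewrite /G /J tr_block_mx map_block_mx !mulmx_block opp_block_mx.
  rewrite !(mul0mx, mulmx0, mul1mx, mulmx1, mulNmx, mulmxN, add0r, addr0).
  rewrite hQ hS; congr block_mx; last by rewrite opprK.
    by rewrite linearN/= map_mxN opprK.
  by rewrite !opprK; apply/matrixP => i j; rewrite !mxE conjCK.
have [V [La [Vf VG VJ hLa]]] := stable_lagrangian GJ Ju hG.
pose X1 := lsubmx V; pose X2 := rsubmx V.
have VE : V = row_mx X1 X2 by rewrite hsubmxK.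
have [e1 e2] : X1 *m (A ^t*)%sesqui + X2 *m S = La *m X1 /\ X1 *m Q - X2 *m A = La *m X2.
  move: VG; rewrite VE /G mul_row_block mul_mx_row => /eq_row_mx[-> <-]; split => //.
  by rewrite mulmxN.
have herm : X1 *m (X2 ^t*)%sesqui = X2 *m (X1 ^t*)%sesqui.
  move: VJ; rewrite VE /J mul_row_block tr_row_mx map_col_mx mul_row_col.
  rewrite !mulmx0 !mulmx1 add0r addr0 mulmxN mulmx1 mulNmx addrC => /eqP.
  by rewrite subr_eq0 => /eqP.
(* For [v] in the kernel of [X1], isotropy makes the form of [S] vanish at [v *m X2], so
   [v *m X2 *m S = 0] and the kernel is invariant under [La]. An eigenvector of [La] in it, with
   eigenvalue [a], gives a left eigenvector [v *m X2] of [A] with eigenvalue [- a] that is killed by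
   [S]. Then both [a] and [- a] would have negative real part. *)
have X1u : X1 \in unitmx.
  rewrite -row_free_unit -kermx_eq0; apply/negPn/negP => K0.
  have KS (v : 'rV[R[i]]_n.+1) : v *m X1 = 0 -> v *m X2 *m S = v *m La *m X1.
    by move=> v0; rewrite -[v *m La *m _]mulmxA -e1 mulmxDr !mulmxA v0 mul0mx add0r.
  have KS0 (v : 'rV[R[i]]_n.+1) : v *m X1 = 0 -> v *m X2 *m S = 0.
    move=> v0; apply: hSp; rewrite KS// trmx_mul map_mxM mulmxA.
    rewrite -[_ *m X1 *m _]mulmxA herm -mulmxA -[_ *m _ *m (v ^t*)%sesqui]mulmxA -map_mxM -trmx_mul v0.
    by rewrite trmx0 map_mx0 !mulmx0.
  have [|a [v v0 [/sub_kermxP vX vL]]] := stable_eigenvector (La := La) K0.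
    apply/row_subP => i; rewrite row_mul; apply/sub_kermxP.
    have rX : row i (kermx X1) *m X1 = 0 by rewrite -row_mul mulmx_ker row0.
    by rewrite -KS// KS0.
  have vX20 : v *m X2 != 0.
    apply: contraNneq v0 => h; rewrite -(mulmx_free_eq0 _ Vf) VE mul_mx_row vX h.
    by rewrite row_mx0.
  have : cRe (- a) < 0.
    apply: (hst _ (v *m X2)) => //; last exact: KS0.
    have : v *m (X1 *m Q - X2 *m A) = v *m (La *m X2) by rewrite e2.
    rewrite mulmxBr !mulmxA vX mul0mx vL sub0r -scalemxAl scaleNr => <-.
    by rewrite opprK.
  have : cRe a < 0 by apply: hLa; apply/eigenvalueP; exists v.
  case: a {vL} => a b /=; lra.
pose Y := invmx X1 *m X2.
have Yh : (Y ^t*)%sesqui = Y.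
  rewrite /Y trmx_mul map_mxM trmx_inv map_invmx.
  have X1su : (X1 ^t*)%sesqui \in unitmx by rewrite map_unitmx unitmx_tr.
  exact: mulmx_invmx_exchange.
have E1 : (A ^t*)%sesqui + Y *m S = invmx X1 *m La *m X1.
  by rewrite -!mulmxA -e1 mulmxDr !mulmxA mulVmx// mul1mx.
have E2 : Q - Y *m A = (invmx X1 *m La *m X1) *m Y.
  have X1Y : X1 *m Y = X2 by rewrite /Y mulKVmx.
  by rewrite -[_ *m X1 *m Y]mulmxA X1Y -[RHS]mulmxA -e2 mulmxBr !mulmxA mulVmx// mul1mx.
exists (- Y); split.
- by rewrite linearN/= map_mxN Yh.
- rewrite -E1 mulmxDl in E2.
  rewrite !mulmxN !mulNmx opprK -[Q](subrK (Y *m A)) E2.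
  move: (_ *m Y) (Y *m A) (Y *m S *m Y) => a b c.
  by rewrite -!opprD [a + c + b]addrAC addNr.
(* The adjoint of the closed-loop matrix is [invmx X1 *m La *m X1], so its spectrum is the conjugate
   of that of [La], which leaves real parts unchanged. *)
move=> z; rewrite mulmxN opprK => hz.
have : eigenvalue (invmx X1 *m La *m invmx (invmx X1)) (z^*)%R.
  have : eigenvalue ((A + S *m Y) ^t*)%sesqui (z^*)%R by rewrite eigenvalue_trmxC conjCK.
  by rewrite invmxK -E1 linearD/= map_mxD trmx_mul map_mxM hS Yh.
rewrite eigenvalue_similar ?unitmx_inv// => /hLa.
by case: z {hz}.
Qed.

(** * Stabilizing solutions of the real Riccati equation *)

Lemma posdef_unitmx (R : realType) (r : nat) (M : 'M[R]_r) :
  positive_definite M -> M \in unitmx.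
Proof.
move=> pM; rewrite -row_free_unit -kermx_eq0; apply/negPn/negP => /rowV0Pn[v /sub_kermxP vM v0].
have := pM v^T; rewrite trmx_eq0 v0 trmxK vM mul0mx mxE ltxx.
by move=> /(_ isT).
Qed.

Lemma control_weight_sym (R : realType) (n r : nat) (B : 'M[R]_(n, r)) (Rc : 'M[R]_r) :
  Rc^T = Rc -> (B *m invmx Rc *m B^T)^T = B *m invmx Rc *m B^T.
Proof. by move=> h; rewrite !trmx_mul trmxK trmx_inv h mulmxA. Qed.

(** With c = [invmx Rc *m (a *m B)^T] the form equals [c^T *m Rc *m c], so positivity of [Rc] is
    used directly and positivity of its inverse is never discussed. *)
Lemma control_weight_ge0 (R : realType) (n r : nat) (B : 'M[R]_(n, r)) (Rc : 'M[R]_r) (a : 'rV[R]_n) :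
  Rc^T = Rc -> positive_definite Rc ->
  0 <= (a *m (B *m invmx Rc *m B^T) *m a^T) 0 0 /\
  ((a *m (B *m invmx Rc *m B^T) *m a^T) 0 0 = 0 -> a *m B = 0).
Proof.
move=> hs hp; have Ru := posdef_unitmx hp.
pose c := invmx Rc *m (a *m B)^T.
have E : a *m (B *m invmx Rc *m B^T) *m a^T = c^T *m Rc *m c.
  by rewrite /c trmx_mul trmxK trmx_inv hs !trmx_mul !mulmxA mulmxKV.
rewrite E; have [c0|c0] := eqVneq c 0; last first.
  by split; [exact/ltW/hp|move=> h; have := hp c c0; rewrite h ltxx].
split; first by rewrite c0 mulmx0 mxE.
move=> _; apply: trmx_inj; rewrite trmx0 -(mulKVmx Ru (a *m B)^T) -/c c0 mulmx0//.
Qed.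

Lemma Re_hermitian_form (R : realType) (n : nat) (S : 'M[R]_n) (w : 'rV[R[i]]_n) :
  let a := map_mx (@complex.Re R) w in let b := map_mx (@complex.Im R) w in
  cRe ((w *m map_mx (real_complex R) S *m (w ^t*)%sesqui) 0 0) =
  (a *m S *m a^T) 0 0 + (b *m S *m b^T) 0 0.
Proof.
move=> a b; rewrite [X in cRe X]mxE cRe_sum !mxE -big_split/=; apply: eq_bigr => j _.
have -> : cRe ((w *m map_mx (real_complex R) S) 0 j * (w ^t*)%sesqui j 0) =
  \sum_k (a 0 k * S k j * a 0 j + b 0 k * S k j * b 0 j).
  rewrite !mxE mulr_suml cRe_sum; apply: eq_bigr => k _.
  by rewrite !mxE; case: (w 0 k) (w 0 j) => [x y] [z t] /=; ring.
by rewrite big_split/= -!mulr_suml !mxE.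
Qed.

Lemma hermitian_form_kernel (R : realType) (n r : nat) (B : 'M[R]_(n, r)) (Rc : 'M[R]_r) (w : 'rV[R[i]]_n) :
  Rc^T = Rc -> positive_definite Rc ->
  w *m map_mx (real_complex R) (B *m invmx Rc *m B^T) *m (w ^t*)%sesqui = 0 ->
  w *m map_mx (real_complex R) B = 0.
Proof.
move=> hs hp /(congr1 (fun M : 'M[R[i]]_1 => cRe (M 0 0))).
rewrite Re_hermitian_form [X in _ = cRe X]mxE [X in _ = X -> _]/=.
set a := map_mx _ w; set b := map_mx _ w.
have [a0 aB] := control_weight_ge0 B a hs hp; have [b0 bB] := control_weight_ge0 B b hs hp.
move/eqP; rewrite paddr_eq0// => /andP[/eqP/aB {}aB /eqP/bB {}bB].
apply/rowP => j; have := congr1 (fun M : 'rV[R]_r => M 0 j) aB; have := congr1 (fun M : 'rV[R]_r => M 0 j) bB.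
rewrite !mxE => hb ha; apply/eqP; rewrite eq_complex.
have -> : complex.Re (\sum_i w 0 i * map_mx (real_complex R) B i j) = 0.
  rewrite -[RHS]ha cRe_sum; apply: eq_bigr => k _; rewrite !mxE.
  by case: (w 0 k) => x y /=; ring.
rewrite eqxx/= -hb.
have Im_sum (I : Type) (s : seq I) (F : I -> R[i]) : cIm (\sum_(i <- s) F i) = \sum_(i <- s) cIm (F i).
  by elim/big_rec2: _ => // i x y _ <-; case: (F i) y => [? ?] [? ?].
rewrite Im_sum; apply/eqP; apply: eq_bigr => k _; rewrite !mxE.
by case: (w 0 k) => x y /=; ring.
Qed.

(** The term [rho *: X] splits into two halves, one for each of the products with [A^T] and [A]; the
    equation becomes an undiscounted one for the shifted matrix. *)
Lemma riccati_shift (R : realType) (n r : nat) (rho : R) (A : 'M[R]_n)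
    (B : 'M[R]_(n, r)) (Q : 'M[R]_n) (Rc : 'M[R]_r) (X : 'M[R]_n) :
  let A' := A - (rho / 2)%:M in
  riccati rho A B Q Rc X <->
  A'^T *m X + X *m A' - X *m (B *m invmx Rc *m B^T) *m X + Q = 0.
Proof.
move=> A'; rewrite /riccati.
have -> : A'^T *m X + X *m A' = A^T *m X + X *m A - rho *: X.
  rewrite /A' linearB/= tr_scalar_mx mulmxBl mulmxBr mul_scalar_mx mul_mx_scalar addrACA.
  by rewrite -opprD -scalerDl -splitr.
rewrite !mulmxA; move: (_ + _) (X *m _ *m _ *m _ *m _) (rho *: X) => a b x.
rewrite [a - x - b]addrAC [a - b - x + Q]addrAC.
by split=> [->|/eqP]; [rewrite subrr|rewrite subr_eq0 => /eqP ->].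
Qed.

(** Subtracting the equations shows that the difference D = X - Y solves the Sylvester equation (A -
    S X)* D + D (A - S Y) = 0, in which both coefficient matrices are stable. *)
Lemma stabilizing_unique_complex (R : realType) (n : nat) (A S Q X Y : 'M[R[i]]_n) :
  (A ^t*)%sesqui *m X + X *m A - X *m S *m X + Q = 0 ->
  (A ^t*)%sesqui *m Y + Y *m A - Y *m S *m Y + Q = 0 ->
  (S ^t*)%sesqui = S -> (X ^t*)%sesqui = X ->
  (forall z, eigenvalue (A - S *m X) z -> cRe z < 0) ->
  (forall z, eigenvalue (A - S *m Y) z -> cRe z < 0) -> X = Y.
Proof.
move=> eX eY hS hX sX sY; apply/eqP; rewrite -subr_eq0; apply/eqP.
have hE z : eigenvalue ((A - S *m X) ^t*)%sesqui z -> cRe z < 0.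
  by rewrite eigenvalue_trmxC => /sX; case: z.
have EE : ((A - S *m X) ^t*)%sesqui = (A ^t*)%sesqui - X *m S.
  by rewrite linearB/= map_mxB trmx_mul map_mxM hS hX.
rewrite {}EE in hE; apply: (sylvester_unique hE sY).
move: (A ^t*)%sesqui eX eY {hE} => Ah eX eY.
have := congr2 (fun a b => a - b) eX eY; rewrite subrr /=.
rewrite !(mulmxBl, mulmxBr) !mulmxA.
move: (X *m S *m Y) => t.
move: (_ *m X) (X *m A) (X *m S *m X) (Ah *m Y) (Y *m A) (Y *m S *m Y) => a b c d e f.
move=> /matrixP h; apply/matrixP => i j; have := h i j; rewrite !mxE => {}h.
by apply/eqP; rewrite -subr_eq0 -h; apply/eqP; ring.
Qed.

Lemma trmxC_real (R : realType) (m n : nat) (M : 'M[R]_(m, n)) :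
  ((map_mx (real_complex R) M) ^t*)%sesqui = map_mx (real_complex R) M^T.
Proof. by apply/matrixP => i j; rewrite !mxE; exact: conjc_real. Qed.

Lemma hurwitz_nil (R : realType) (M : 'M[R]_0) : hurwitz M.
Proof. by move=> z; rewrite /complex_eigenvalue eigenvalue_unitmx unitmxE det_mx00 unitr1. Qed.

(** The existence proof works with row spaces and hence with the transpose of the Hamiltonian;
    transposition does not change eigenvalues. *)
Lemma hamiltonian_trmx (R : realType) (n r : nat) (rho : R) (A : 'M[R]_n)
    (B : 'M[R]_(n, r)) (Q : 'M[R]_n) (Rc : 'M[R]_r) :
  Q^T = Q -> Rc^T = Rc ->
  (hamiltonian rho A B Q Rc)^T =
    block_mx (A - (rho / 2)%:M)^T Q (B *m invmx Rc *m B^T) (- (A - (rho / 2)%:M)).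
Proof.
move=> hQ hs; rewrite /hamiltonian tr_block_mx hQ control_weight_sym//.
by rewrite [(- A^T + _)^T]linearD/= linearN/= trmxK tr_scalar_mx opprB [_ - A]addrC.
Qed.

Lemma map_riccati (R : realType) (n : nat) (A S Q X : 'M[R]_n) :
  let toC := map_mx (real_complex R) in
  (toC A ^t*)%sesqui *m toC X + toC X *m toC A - toC X *m toC S *m toC X + toC Q =
  toC (A^T *m X + X *m A - X *m S *m X + Q).
Proof. by move=> toC; rewrite trmxC_real -!map_mxM -map_mxN -!map_mxD. Qed.

Lemma complex_eigenvalue_hamiltonian (R : realType) (n r : nat) (rho : R) (A : 'M[R]_n)
    (B : 'M[R]_(n, r)) (Q : 'M[R]_n) (Rc : 'M[R]_r) (z : R[i]) :
  Q^T = Q -> Rc^T = Rc ->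
  complex_eigenvalue (hamiltonian rho A B Q Rc) z =
  eigenvalue (block_mx (map_mx (real_complex R) (A - (rho / 2)%:M)^T)
    (map_mx (real_complex R) Q) (map_mx (real_complex R) (B *m invmx Rc *m B^T))
    (- map_mx (real_complex R) (A - (rho / 2)%:M))) z.
Proof.
move=> hQ hs; rewrite /complex_eigenvalue -eigenvalue_trmx [in LHS]map_trmx.
rewrite (hamiltonian_trmx _ _ _ hQ hs) [in LHS]map_block_mx.
by rewrite [map_mx _ (- _)]map_mxN.
Qed.

(** The complex construction gives a Hermitian matrix [X]. Because the data are real, the entrywise
    conjugate of [X] is a stabilizing solution as well, and uniqueness forces [X] to be real. *)
Lemma stabilizing_solution_exists (R : realType) (n r : nat) (rho : R) (A : 'M[R]_n)
    (B : 'M[R]_(n, r)) (Q : 'M[R]_n) (Rc : 'M[R]_r) :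
  Q^T = Q -> Rc^T = Rc -> positive_definite Rc ->
  stabilizable (A - (rho / 2)%:M) B ->
  no_imaginary_eigenvalue (hamiltonian rho A B Q Rc) ->
  exists X, stabilizing_solution rho A B Q Rc X.
Proof.
case: n A B Q => [|n] A B Q hQ hs hp stab hH.
  exists 0; split; last exact: hurwitz_nil.
    by rewrite trmx0.
  by apply/matrixP => -[].
pose S := B *m invmx Rc *m B^T; pose A' := A - (rho / 2)%:M.
pose rC m k (M : 'M[R]_(m, k)) : 'M[R[i]]_(m, k) := map_mx (real_complex R) M.
have ST : S^T = S by exact: control_weight_sym.
have hSC : (rC _ _ S ^t*)%sesqui = rC _ _ S by rewrite trmxC_real ST.
have hQC : (rC _ _ Q ^t*)%sesqui = rC _ _ Q by rewrite trmxC_real hQ.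
have kerS (w : 'rV_n.+1) : w *m rC _ _ S *m (w ^t*)%sesqui = 0 -> w *m rC _ _ B = 0.
  by move/(hermitian_form_kernel hs hp).
have SB : rC _ _ S = rC _ _ B *m rC _ _ (invmx Rc *m B^T).
  by rewrite -map_mxM mulmxA.
have [||z|X [hX eX sX]] := @riccati_complex_exists R n (rC _ _ A') (rC _ _ S) (rC _ _ Q) hSC hQC.
- by move=> w /kerS; rewrite SB mulmxA => ->; rewrite mul0mx.
(* A left eigenvector of the shifted matrix that is killed by [B] stays an eigenvector under every
   feedback [K], in particular under a stabilizing one. *)
- move=> z w w0 wA wS; have wB : w *m rC _ _ B = 0 by apply: kerS; rewrite wS mul0mx.
  have [K hK] := stab; apply: hK; apply/eigenvalueP; exists w => //.
  by rewrite map_mxD map_mxM mulmxDr mulmxA wB mul0mx addr0.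
- rewrite trmxC_real => hz; apply: hH.
  by rewrite (complex_eigenvalue_hamiltonian _ _ _ _ hQ hs).
have rCconj m k (M : 'M[R]_(m, k)) : map_mx Num.conj (rC _ _ M) = rC _ _ M.
  by apply/matrixP => i j; rewrite !mxE; exact: conjc_real.
have XX : X = map_mx Num.conj X.
  apply: (stabilizing_unique_complex eX _ hSC hX sX).
    move/(congr1 (map_mx Num.conj)): eX.
    rewrite trmxC_real map_mx0; rewrite [X in X = 0]map_mxD [X in X + _]map_mxB [X in X - _]map_mxD !map_mxM/= !rCconj.
    by [].
  move=> z; have -> : rC _ _ A' - rC _ _ S *m map_mx Num.conj X = map_mx Num.conj (rC _ _ A' - rC _ _ S *m X).
    by rewrite map_mxB map_mxM !rCconj.
  by rewrite eigenvalue_conj => /sX; case: z.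
pose Y := map_mx (@complex.Re R) X.
have XY : X = rC _ _ Y.
  apply/matrixP => i j; have /(congr1 (fun M : 'M[R[i]]_n.+1 => M i j)) := XX.
  rewrite !mxE; case: (X i j) => a b [] /eqP; rewrite -subr_eq0 opprK -mulr2n mulrn_eq0/= => /eqP ->.
  by [].
exists Y; split.
- exact: trmx_map_Re.
- apply/riccati_shift; apply: (map_mx_inj (f := real_complex R)).
  by rewrite map_mx0 -[RHS]eX XY -map_riccati.
- move=> z hz; apply: sX; move: hz; rewrite /complex_eigenvalue XY -map_mxM -map_mxB.
  congr (is_true (eigenvalue (map_mx _ _) z)).
  by rewrite /A' addrAC.
Qed.

Lemma stabilizing_solution_unique (R : realType) (n r : nat) (rho : R) (A : 'M[R]_n)
    (B : 'M[R]_(n, r)) (Q : 'M[R]_n) (Rc : 'M[R]_r) (X Y : 'M[R]_n) :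
  Rc^T = Rc -> stabilizing_solution rho A B Q Rc X -> stabilizing_solution rho A B Q Rc Y -> X = Y.
Proof.
move=> hs [hX /riccati_shift eX sX] [hY /riccati_shift eY sY].
apply: (map_mx_inj (f := real_complex R)).
have sE Z z : eigenvalue (map_mx (real_complex R) (A - (rho / 2)%:M) -
    map_mx (real_complex R) (B *m invmx Rc *m B^T) *m map_mx (real_complex R) Z) z ->
    complex_eigenvalue (A - B *m invmx Rc *m B^T *m Z - (rho / 2)%:M) z.
  by rewrite /complex_eigenvalue -map_mxM -map_mxB addrAC.
apply: (@stabilizing_unique_complex R n (map_mx (real_complex R) (A - (rho / 2)%:M))
  (map_mx (real_complex R) (B *m invmx Rc *m B^T)) (map_mx (real_complex R) Q)).
- by rewrite map_riccati eX map_mx0.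
- by rewrite map_riccati eY map_mx0.
- by rewrite trmxC_real control_weight_sym.
- by rewrite trmxC_real hX.
- by move=> z /sE/sX.
- by move=> z /sE/sY.
Qed.

(** * Linear differential equations in the weighted L2 class *)

Notation mu := lebesgue_measure.

Lemma continuous_integrable (R : realType) (h : R -> R) (a b : R) :
  continuous h -> mu.-integrable `[a, b] (EFin \o h).
Proof.
move=> ch; apply: continuous_compact_integrable; first exact: segment_compact.
exact: continuous_subspaceT.
Qed.

Lemma is_derive_continuous (R : realType) (f : R -> R) (t df : R) :
  is_derive t (1 : R) f df -> {for t, continuous f}.
Proof. by move=> [d _]; apply/differentiable_continuous/derivable1_diffP. Qed.

Lemma continuous_posmax (R : realType) (f : R -> R) :
  (forall t, 0 <= t -> {for t, continuous f}) -> continuous (fun t : R => f (Num.max t 0)).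
Proof.
move=> cf t; apply: (@continuous_comp _ _ _ (fun t : R => Num.max t 0) f).
  by apply: (@continuous_max R R^o id (cst 0)); [exact: cvg_id|exact: cvg_cst].
by apply: cf; rewrite le_max lexx orbT.
Qed.

(* The lower bound -1 makes the integral differentiable on both sides at 0. *)
Definition prim (R : realType) (h : R -> R) (t : R) : R :=
  (\int[mu]_(x in `[-1, Num.max t 0]) h x)%R - (\int[mu]_(x in `[-1, 0]) h x)%R.

Lemma prim0 (R : realType) (h : R -> R) : prim h 0 = 0.
Proof. by rewrite /prim maxxx subrr. Qed.

Lemma primE (R : realType) (h : R -> R) (t : R) : continuous h -> 0 <= t ->
  prim h t = (\int[mu]_(x in `[0, t]) h x)%R.
Proof.
move=> ch t0; rewrite /prim max_l// Rintegral_itvB ?bnd_simp//.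
- by rewrite Rintegral_itv_obnd_cbnd//; apply: integrableS (continuous_integrable 0 t ch) => //;
    exact: subset_itv_oc_cc.
- exact: continuous_integrable.
Qed.

Lemma is_derive_prim_aux (R : realType) (h : R -> R) (t : R) : continuous h -> 0 <= t ->
  is_derive t (1 : R) (fun t => (\int[mu]_(x in `[-1, t]) h x)%R - (\int[mu]_(x in `[-1, 0]) h x)%R) (h t).
Proof.
move=> ch t0; have t1 : (t < t + 1)%R by rewrite ltrDl.
have tm1 : (-1 < t)%R by rewrite (lt_le_trans _ t0)// ltrN10.
have [df dE] := continuous_FTC1_closed t1 (continuous_integrable (-1) (t + 1) ch) tm1 (ch t).
rewrite derive1E in dE; rewrite -[h t]subr0.
exact: is_deriveB (DeriveDef df dE) (is_derive_cst _ _ _).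
Qed.

Lemma is_derive_prim (R : realType) (h : R -> R) (t : R) : continuous h -> 0 < t ->
  is_derive t (1 : R) (prim h) (h t).
Proof.
move=> ch t0; apply: near_eq_is_derive (is_derive_prim_aux ch (ltW t0)).
near=> s; rewrite /prim max_l//; apply: ltW; near: s; exact: lt_nbhsr.
Unshelve. all: by end_near. Qed.

Lemma continuous_prim (R : realType) (h : R -> R) : continuous h -> continuous (prim h).
Proof.
move=> ch; apply: (@continuous_posmax R (fun t => (\int[mu]_(x in `[-1, t]) h x)%R - (\int[mu]_(x in `[-1, 0]) h x)%R)) => t t0.
exact: is_derive_continuous (is_derive_prim_aux ch t0).
Qed.

Lemma is_deriveMr (R : realType) (f g : R -> R) (t df dg : R) :
  is_derive t (1 : R) f df -> is_derive t (1 : R) g dg ->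
  is_derive t (1 : R) (fun s => f s * g s) (df * g t + f t * dg).
Proof.
move=> hf hg; have := is_deriveM hf hg.
by rewrite [_ *: df]mulrC addrC.
Qed.

Lemma is_derive_bigsum (R : realType) (I : Type) (s : seq I) (F : I -> R -> R) (dF : I -> R) (t : R) :
  (forall i, is_derive t (1 : R) (F i) (dF i)) ->
  is_derive t (1 : R) (fun x => \sum_(i <- s) F i x) (\sum_(i <- s) dF i).
Proof.
move=> h; elim: s => [|i s IH].
  by rewrite big_nil; under eq_fun do rewrite big_nil; exact: is_derive_cst.
by rewrite big_cons; under eq_fun do rewrite big_cons; exact: is_deriveD.
Qed.

Lemma deriv_nonincreasing (R : realType) (f df : R -> R) (T : R) : 0 <= T -> continuous f ->
  (forall t : R, 0 < t -> is_derive t (1 : R) f (df t)) -> (forall t, 0 < t -> df t <= 0) ->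
  f T <= f 0.
Proof.
move=> T0 cf hd hle.
have [->//|T1] := eqVneq T 0.
have {}T1 : 0 < T by rewrite lt_def T1.
have [||c cT E] := @MVT R f df 0 T T1.
- by move=> x; rewrite in_itv/= => /andP[x0 _]; exact/hd.
- exact: continuous_subspaceT.
rewrite -subr_le0 E mulr_le0_ge0 ?subr_ge0//.
by apply: hle; move: cT; rewrite in_itv/= => /andP[].
Qed.

(** Differentiation is entrywise, so that product and sum rules reduce to the scalar ones;
    [mx_deriv_derivable] returns to the norm derivative only where the equations for [s] and [xbar]
    ask for it. *)
Definition mx_deriv (R : realType) (m n : nat) (f : R -> 'M[R]_(m, n)) (t : R) (D : 'M[R]_(m, n)) :=
  forall i j, is_derive t (1 : R) (fun s => f s i j) (D i j).

Lemma mx_deriv_eq (R : realType) (m n : nat) (f : R -> 'M[R]_(m, n)) (t : R) (D D' : 'M[R]_(m, n)) :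
  mx_deriv f t D -> D = D' -> mx_deriv f t D'.
Proof. by move=> ? <-. Qed.

Lemma mx_deriv_derivable (R : realType) (m n : nat) (f : R -> 'M[R]_(m, n)) (t : R) (D : 'M[R]_(m, n)) :
  mx_deriv f t D -> derivable f t 1 /\ derive1 f t = D.
Proof.
move=> h; have df : derivable f t 1 by apply/derivable_mxP => i j; have [] := h i j.
split => //; rewrite derive1E derive_mx//; apply/matrixP => i j; rewrite mxE.
by have [_ ->] := h i j.
Qed.

Lemma mx_derivM (R : realType) (m n p : nat) (f : R -> 'M[R]_(m, n)) (g : R -> 'M[R]_(n, p)) t Df Dg :
  mx_deriv f t Df -> mx_deriv g t Dg ->
  mx_deriv (fun s => f s *m g s) t (Df *m g t + f t *m Dg).
Proof.
move=> hf hg i j; rewrite !mxE -big_split/=.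
under eq_fun do rewrite mxE.
by apply: is_derive_bigsum => k; exact: is_deriveMr.
Qed.

Lemma mx_derivD (R : realType) (m n : nat) (f g : R -> 'M[R]_(m, n)) t Df Dg :
  mx_deriv f t Df -> mx_deriv g t Dg -> mx_deriv (fun s => f s + g s) t (Df + Dg).
Proof.
move=> hf hg i j; rewrite !mxE; under eq_fun do rewrite mxE.
exact: is_deriveD.
Qed.

Lemma mx_deriv_cst (R : realType) (m n : nat) (C : 'M[R]_(m, n)) t : mx_deriv (fun=> C) t 0.
Proof. by move=> i j; rewrite mxE; exact: is_derive_cst. Qed.

Lemma mx_derivN (R : realType) (m n : nat) (f : R -> 'M[R]_(m, n)) t Df :
  mx_deriv f t Df -> mx_deriv (fun s => - f s) t (- Df).
Proof.
by move=> hf i j; rewrite !mxE; under eq_fun do rewrite mxE; exact: is_deriveN.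
Qed.

Lemma mx_derivB (R : realType) (m n : nat) (f g : R -> 'M[R]_(m, n)) t Df Dg :
  mx_deriv f t Df -> mx_deriv g t Dg -> mx_deriv (fun s => f s - g s) t (Df - Dg).
Proof. by move=> hf hg; apply: mx_derivD => //; exact: mx_derivN. Qed.

Lemma mx_derivMl (R : realType) (m n p : nat) (M : 'M[R]_(m, n)) (f : R -> 'M[R]_(n, p)) t Df :
  mx_deriv f t Df -> mx_deriv (fun s => M *m f s) t (M *m Df).
Proof.
move=> hf; apply: mx_deriv_eq (mx_derivM (mx_deriv_cst M t) hf) _.
by rewrite mul0mx add0r.
Qed.

Lemma mx_deriv_tr (R : realType) (m n : nat) (f : R -> 'M[R]_(m, n)) t Df :
  mx_deriv f t Df -> mx_deriv (fun s => (f s)^T) t Df^T.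
Proof. by move=> hf i j; rewrite mxE; under eq_fun do rewrite mxE. Qed.

Definition mx_cont (R : realType) (m n : nat) (f : R -> 'M[R]_(m, n)) :=
  forall i j, continuous (fun s => f s i j).

Lemma continuous_bigsum (R : realType) (T : topologicalType) (I : Type) (s : seq I) (F : I -> T -> R) :
  (forall i, continuous (F i)) -> continuous (fun x => \sum_(i <- s) F i x).
Proof.
move=> h; elim: s => [|i s IH].
  by under eq_fun do rewrite big_nil; exact: cst_continuous.
by under eq_fun do rewrite big_cons; move=> x; apply: cvgD; [exact: h|exact: IH].
Qed.

Lemma mx_contM (R : realType) (m n p : nat) (f : R -> 'M[R]_(m, n)) (g : R -> 'M[R]_(n, p)) :
  mx_cont f -> mx_cont g -> mx_cont (fun s => f s *m g s).
Proof.
move=> hf hg i j; under eq_fun do rewrite mxE.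
by apply: continuous_bigsum => k x; apply: cvgM; [exact: hf|exact: hg].
Qed.

Lemma mx_contD (R : realType) (m n : nat) (f g : R -> 'M[R]_(m, n)) :
  mx_cont f -> mx_cont g -> mx_cont (fun s => f s + g s).
Proof.
by move=> hf hg i j; under eq_fun do rewrite mxE; move=> x; apply: cvgD; [exact: hf|exact: hg].
Qed.

Lemma mx_contN (R : realType) (m n : nat) (f : R -> 'M[R]_(m, n)) :
  mx_cont f -> mx_cont (fun s => - f s).
Proof. by move=> hf i j; under eq_fun do rewrite mxE; move=> x; apply: cvgN; exact: hf. Qed.

Lemma mx_contB (R : realType) (m n : nat) (f g : R -> 'M[R]_(m, n)) :
  mx_cont f -> mx_cont g -> mx_cont (fun s => f s - g s).
Proof. by move=> hf hg; apply: mx_contD => //; exact: mx_contN. Qed.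

Lemma mx_cont_cst (R : realType) (m n : nat) (C : 'M[R]_(m, n)) : mx_cont (fun=> C).
Proof. by move=> i j; exact: cst_continuous. Qed.

Lemma mx_contMl (R : realType) (m n p : nat) (M : 'M[R]_(m, n)) (f : R -> 'M[R]_(n, p)) :
  mx_cont f -> mx_cont (fun s => M *m f s).
Proof. by move=> hf; apply: mx_contM => //; exact: mx_cont_cst. Qed.

Lemma sqnorm_ge0 (R : realType) (n : nat) (v : 'cV[R]_n) : 0 <= sqnorm v.
Proof. by apply: sumr_ge0 => i _; exact: sqr_ge0. Qed.

Lemma continuous_sqnorm (R : realType) (n : nat) (f : R -> 'cV[R]_n) :
  mx_cont f -> continuous (fun s => sqnorm (f s)).
Proof.
move=> hf; apply: continuous_bigsum => k; under eq_fun do rewrite expr2.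
by move=> x; apply: cvgM; exact: hf.
Qed.

(** * The matrix exponential *)

Fixpoint mx_pow (R : realType) (n : nat) (M : 'M[R]_n) (k : nat) : 'M[R]_n :=
  if k is k'.+1 then M *m mx_pow M k' else 1%:M.

Lemma mx_powSr (R : realType) (n : nat) (M : 'M[R]_n) (k : nat) :
  mx_pow M k.+1 = mx_pow M k *m M.
Proof.
by elim: k => [|k IH] /=; [rewrite mulmx1 mul1mx|rewrite -mulmxA -IH].
Qed.

(** The offset [p] makes this the coefficient sequence of M^p exp(tM), so that termwise
    differentiation is just the step from [p] to [p.+1]. *)
Definition mx_exp_coef (R : realType) (n : nat) (M : 'M[R]_n) (p : nat) (i j : 'I_n) (k : nat) : R :=
  mx_pow M (k + p) i j / k`!%:R.

Lemma mx_pow_bound (R : realType) (n : nat) (M : 'M[R]_n) (k : nat) (i j : 'I_n) :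
  `|mx_pow M k i j| <= (\sum_a \sum_b `|M a b|) ^+ k.
Proof.
elim: k i => [|k IH] i /=.
  by rewrite mxE expr0; case: (i == j); rewrite ?normr1 ?normr0.
rewrite mxE (le_trans (ler_norm_sum _ _ _))// exprS.
have K0 : 0 <= (\sum_a \sum_b `|M a b|) ^+ k.
  by apply: exprn_ge0; apply: sumr_ge0 => a _; exact: sumr_ge0.
apply: (@le_trans _ _ ((\sum_l `|M i l|) * (\sum_a \sum_b `|M a b|) ^+ k)).
  by rewrite mulr_suml; apply: ler_sum => l _; rewrite normrM ler_wpM2l.
rewrite ler_wpM2r// [leRHS](bigD1 i)//= lerDl.
by apply: sumr_ge0 => a _; exact: sumr_ge0.
Qed.

Lemma mx_exp_coef_diffs (R : realType) (n : nat) (M : 'M[R]_n) p i j :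
  pseries_diffs (mx_exp_coef M p i j) = mx_exp_coef M p.+1 i j.
Proof.
apply/funext => k; rewrite /pseries_diffs /mx_exp_coef factS natrM addSnnS.
have k0 : k.+1%:R != 0 :> R by rewrite pnatr_eq0.
by rewrite invfM mulrCA mulVKf.
Qed.

(** Entrywise domination by K^p times the exponential series at K|x|, where K is the sum of the
    absolute values of all entries. *)
Lemma is_cvg_mx_exp (R : realType) (n : nat) (M : 'M[R]_n) p i j (x : R) :
  cvgn (pseries (mx_exp_coef M p i j) x).
Proof.
apply: normed_cvg; rewrite /normed_series_of /=.
pose K : R := \sum_a \sum_b `|M a b|.
have K0 : 0 <= K by apply: sumr_ge0 => a _; exact: sumr_ge0.
apply: (@series_le_cvg _ _ (K ^+ p *: exp_coeff (K * `|x|))) => [k|k|k|].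
- exact: normr_ge0.
- by rewrite /= mulr_ge0 ?exprn_ge0// exp_coeff_ge0// mulr_ge0.
- rewrite /mx_exp_coef /exp_coeff/= !normrM normrX.
  rewrite [leRHS](_ : _ = K ^+ (k + p) * k`!%:R^-1 * `|x| ^+ k); last first.
    rewrite -[LHS]/(K ^+ p * ((K * `|x|) ^+ k / k`!%:R)).
    by rewrite exprMn exprD; ring.
  rewrite normfV normr_nat ler_wpM2r ?exprn_ge0// ler_wpM2r ?invr_ge0//.
  exact: mx_pow_bound.
- exact: (is_cvg_seriesZ (is_cvg_series_exp_coeff _)).
Qed.

Definition mx_exp (R : realType) (n : nat) (M : 'M[R]_n) (t : R) : 'M[R]_n :=
  \matrix_(i, j) limn (pseries (mx_exp_coef M 0 i j) t).

Lemma mx_exp0 (R : realType) (n : nat) (M : 'M[R]_n) : mx_exp M 0 = 1%:M.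
Proof.
apply/matrixP => i j; rewrite mxE; apply: lim_near_cst => //.
near=> m; have : (0 < m)%N by near: m; exact: nbhs_infty_gt.
case: (m) => // k _; rewrite /pseries /series/= big_nat_recl// big1 ?addr0.
  by rewrite /mx_exp_coef fact0 divr1 expr0 mulr1.
by move=> l _; rewrite expr0n mulr0.
Unshelve. all: by end_near. Qed.

Lemma mx_deriv_exp_coef (R : realType) (n : nat) (M : 'M[R]_n) (t : R) :
  mx_deriv (mx_exp M) t (\matrix_(i, j) limn (pseries (mx_exp_coef M 1 i j) t)).
Proof.
move=> i j; rewrite mxE; under eq_fun do rewrite mxE.
rewrite -mx_exp_coef_diffs.
apply: (@pseries_snd_diffs _ _ (`|t| + 1)); rewrite ?mx_exp_coef_diffs; try exact: is_cvg_mx_exp.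
by rewrite [ltRHS]ger0_norm ?addr_ge0// ltrDl.
Qed.

Lemma cvg_bigsum (R : realType) (T : Type) (F : set_system T) (FF : Filter F) (I : Type) (s : seq I)
    (f : I -> T -> R) (l : I -> R) :
  (forall i, f i x @[x --> F] --> l i) ->
  \sum_(i <- s) f i x @[x --> F] --> \sum_(i <- s) l i.
Proof.
move=> h; elim: s => [|i s IH].
  by rewrite big_nil; under eq_fun do rewrite big_nil; exact: cvg_cst.
by rewrite big_cons; under eq_fun do rewrite big_cons; apply: cvgD.
Qed.

Lemma pseries_sum (R : realType) (I : finType) (c : I -> R) (f : I -> R^nat) (x : R) :
  (forall i, cvgn (pseries (f i) x)) ->
  limn (pseries (fun k => \sum_i c i * f i k) x) = \sum_i c i * limn (pseries (f i) x).
Proof.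
move=> h; apply/cvg_lim => //.
rewrite (_ : pseries _ x = fun k => \sum_i c i * pseries (f i) x k).
  by apply: cvg_bigsum => i; apply: cvgM; [exact: cvg_cst|exact: h].
apply/funext => k; rewrite /pseries /series/=.
under [RHS]eq_bigr do rewrite mulr_sumr.
rewrite exchange_big/=; apply: eq_bigr => l _.
by rewrite mulr_suml; apply: eq_bigr => i _; rewrite mulrA.
Qed.

Lemma mx_deriv_exp (R : realType) (n : nat) (M : 'M[R]_n) (t : R) :
  mx_deriv (mx_exp M) t (M *m mx_exp M t).
Proof.
apply: mx_deriv_eq (mx_deriv_exp_coef M t) _.
apply/matrixP => i j; rewrite !mxE.
under [RHS]eq_bigr do rewrite mxE.
rewrite -pseries_sum; last by move=> l; exact: is_cvg_mx_exp.
congr (limn (pseries _ t)); apply/funext => k.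
rewrite /mx_exp_coef addn1 mxE mulr_suml; apply: eq_bigr => l _.
by rewrite addn0 mulrA.
Qed.

Lemma mx_exp_comm (R : realType) (n : nat) (M : 'M[R]_n) (t : R) :
  M *m mx_exp M t = mx_exp M t *m M.
Proof.
apply/matrixP => i j; rewrite !mxE.
under eq_bigr do rewrite mxE.
rewrite -pseries_sum; last by move=> l; exact: is_cvg_mx_exp.
under [RHS]eq_bigr do rewrite mxE mulrC.
rewrite -pseries_sum; last by move=> l; exact: is_cvg_mx_exp.
congr (limn (pseries _ t)); apply/funext => k.
rewrite /mx_exp_coef addn0.
have := congr1 (fun N : 'M[R]_n => N i j) (mx_powSr M k).
rewrite /= !mxE => /(congr1 (fun x => x / k`!%:R)); rewrite !mulr_suml => E.
transitivity (\sum_l M i l * mx_pow M k l j / k`!%:R).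
  by apply: eq_bigr => l _; rewrite mulrA.
by rewrite E; apply: eq_bigr => l _; rewrite mulrA [_ * M _ _]mulrC.
Qed.

Lemma mx_cont_exp (R : realType) (n : nat) (M : 'M[R]_n) : mx_cont (mx_exp M).
Proof. by move=> i j t; exact: is_derive_continuous (mx_deriv_exp M t i j). Qed.

Lemma mx_cont_expN (R : realType) (n : nat) (M : 'M[R]_n) : mx_cont (fun t => mx_exp M (- t)).
Proof.
move=> i j t; apply: (@continuous_comp _ _ _ (fun t : R => - t) (fun t => mx_exp M t i j)).
  exact: opp_continuous.
exact: mx_cont_exp.
Qed.

Lemma mx_deriv_expN (R : realType) (n : nat) (M : 'M[R]_n) (t : R) :
  mx_deriv (fun s => mx_exp M (- s)) t (- (M *m mx_exp M (- t))).
Proof.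
move=> i j; rewrite mxE.
have h1 := mx_deriv_exp M (- t) i j.
have h2 : is_derive t (1 : R) (fun s : R => - s) (- 1) by exact: is_deriveN.
have := is_derive1_comp h1 h2.
by rewrite mulrN1.
Qed.

Lemma deriv0_constant (R : realType) (f : R -> R) (T : R) : 0 <= T -> continuous f ->
  (forall t : R, 0 < t -> is_derive t (1 : R) f 0) -> f T = f 0.
Proof.
move=> T0 cf h; apply/eqP; rewrite eq_le; apply/andP; split.
  exact: (deriv_nonincreasing T0 cf h).
rewrite -lerN2; apply: (@deriv_nonincreasing _ (fun s => - f s) (fun=> 0) T) => //.
  by move=> x; apply: cvgN; exact: cf.
by move=> t t0; rewrite -[0]oppr0; apply: is_deriveN; exact: h.
Qed.

Lemma mx_deriv0_constant (R : realType) (m n : nat) (f : R -> 'M[R]_(m, n)) (T : R) : 0 <= T ->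
  mx_cont f -> (forall t : R, 0 < t -> mx_deriv f t 0) -> f T = f 0.
Proof.
move=> T0 cf h; apply/matrixP => i j; apply: (deriv0_constant (f := fun s => f s i j)) => // t t0.
by have := h t t0 i j; rewrite mxE.
Qed.

Lemma mx_expNK (R : realType) (n : nat) (M : 'M[R]_n) (t : R) : 0 <= t ->
  mx_exp M (- t) *m mx_exp M t = 1%:M.
Proof.
move=> t0; rewrite (@mx_deriv0_constant _ _ _ (fun s => mx_exp M (- s) *m mx_exp M s) t t0).
- by rewrite oppr0 mx_exp0 mulmx1.
- by apply: mx_contM; [exact: mx_cont_expN|exact: mx_cont_exp].
move=> s _; apply: mx_deriv_eq (mx_derivM (mx_deriv_expN M s) (mx_deriv_exp M s)) _.
by rewrite mx_exp_comm mulNmx -mulmxA addNr.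
Qed.

Lemma mx_expKN (R : realType) (n : nat) (M : 'M[R]_n) (t : R) : 0 <= t ->
  mx_exp M t *m mx_exp M (- t) = 1%:M.
Proof. by move=> t0; apply: mulmx1C; exact: mx_expNK. Qed.

(** Cauchy-Schwarz by Lagrange's identity: the defect is half the double sum of the squares of
    [a i * b j - a j * b i]. *)
Lemma sqr_sum_mul_le (R : realType) (n : nat) (a b : 'I_n -> R) :
  (\sum_i a i * b i) ^+ 2 <= (\sum_i a i ^+ 2) * (\sum_i b i ^+ 2).
Proof.
have h : 0 <= \sum_i \sum_j (a i * b j - a j * b i) ^+ 2.
  by apply: sumr_ge0 => i _; apply: sumr_ge0 => j _; exact: sqr_ge0.
have E : \sum_i \sum_j (a i * b j - a j * b i) ^+ 2 =
  \sum_i \sum_j (a i ^+ 2 * b j ^+ 2) + \sum_i \sum_j (b i ^+ 2 * a j ^+ 2)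
   - 2 * \sum_i \sum_j ((a i * b i) * (a j * b j)).
  rewrite mulr_sumr -sumrN -!big_split/=; apply: eq_bigr => i _.
  rewrite mulr_sumr -sumrN -!big_split/=; apply: eq_bigr => j _; ring.
rewrite {}E -!big_distrlr/= in h.
by rewrite expr2; move: (\sum_i a i ^+ 2) (\sum_i b i ^+ 2) (\sum_i a i * b i) h => x y z h; lra.
Qed.

(** Squared Frobenius norm, used throughout as a crude bound for the squared operator norm. *)
Definition mxsq (R : realType) (m n : nat) (M : 'M[R]_(m, n)) : R := \sum_i \sum_j M i j ^+ 2.

Lemma mxsq_ge0 (R : realType) (m n : nat) (M : 'M[R]_(m, n)) : 0 <= mxsq M.
Proof. by apply: sumr_ge0 => i _; apply: sumr_ge0 => j _; exact: sqr_ge0. Qed.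

Lemma sqnorm_mulmx (R : realType) (m n : nat) (M : 'M[R]_(m, n)) (v : 'cV[R]_n) :
  sqnorm (M *m v) <= mxsq M * sqnorm v.
Proof.
rewrite /sqnorm /mxsq mulr_suml; apply: ler_sum => i _; rewrite mxE.
exact: sqr_sum_mul_le.
Qed.

Lemma sqnormD_le (R : realType) (n : nat) (u v : 'cV[R]_n) :
  sqnorm (u + v) <= 2 * sqnorm u + 2 * sqnorm v.
Proof.
rewrite /sqnorm !mulr_sumr -big_split/=; apply: ler_sum => i _; rewrite mxE.
by rewrite -subr_ge0 (_ : _ - _ = (u i 0 - v i 0) ^+ 2) ?sqr_ge0//; ring.
Qed.

Lemma sqnormN (R : realType) (n : nat) (v : 'cV[R]_n) : sqnorm (- v) = sqnorm v.
Proof. by apply: eq_bigr => i _; rewrite mxE sqrrN. Qed.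

Lemma sqnorm0 (R : realType) (n : nat) : sqnorm (0 : 'cV[R]_n) = 0.
Proof. by apply: big1 => i _; rewrite mxE expr0n. Qed.

Definition wsq (R : realType) (n : nat) (rho : R) (g : R -> 'cV[R]_n) (t : R) : R :=
  expR (- (rho * t)) * sqnorm (g t).

Lemma wsq_ge0 (R : realType) (n : nat) (rho : R) (g : R -> 'cV[R]_n) t : 0 <= wsq rho g t.
Proof. by rewrite mulr_ge0 ?expR_ge0 ?sqnorm_ge0. Qed.

Lemma is_derive_expw (R : realType) (rho t : R) :
  is_derive t (1 : R) (fun s => expR (- (rho * s))) (- rho * expR (- (rho * t))).
Proof.
have h2 : is_derive t (1 : R) (fun s : R => - (rho * s)) (- rho).
  apply: is_deriveN; rewrite -[rho in is_derive _ _ _ rho]mulr1.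
  exact: (@is_deriveZ _ _ _ id).
have h1 := is_derive_expR (- (rho * t)).
by have := @is_derive1_comp _ expR (fun s : R => - (rho * s)) t _ _ h1 h2; rewrite mulrC.
Qed.

Lemma continuous_expw (R : realType) (rho : R) : continuous (fun s : R => expR (- (rho * s))).
Proof. by move=> t; exact: is_derive_continuous (is_derive_expw rho t). Qed.

Lemma continuous_wsq (R : realType) (n : nat) (rho : R) (g : R -> 'cV[R]_n) :
  mx_cont g -> continuous (wsq rho g).
Proof.
move=> cg t; apply: cvgM; [exact: continuous_expw|exact: continuous_sqnorm].
Qed.

(** The squared norm of the class C_{rho/2}. It is extended-valued so that membership can be
    expressed as finiteness and derived from inequalities. *)
Definition wnorm (R : realType) (n : nat) (rho : R) (g : R -> 'cV[R]_n) : \bar R :=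
  (\int[mu]_(t in `[0%R, +oo[) (wsq rho g t)%:E)%E.

Lemma prim_le_integral (R : realType) (h : R -> R) (T : R) : continuous h -> (forall t, 0 <= h t) ->
  0 <= T -> ((prim h T)%:E <= \int[mu]_(t in `[0%R, +oo[) (h t)%:E)%E.
Proof.
move=> ch h0 T0; rewrite primE// /Rintegral fineK; last first.
  exact: integrable_fin_num (continuous_integrable 0 T ch).
apply: ge0_subset_integral => //.
- by apply/measurable_EFinP; apply: measurable_funTS; exact: continuous_measurable_fun.
- by move=> t _; rewrite lee_fin.
- exact: subset_itvl.
Qed.

(** Monotone convergence over the intervals [0, n+1]. Together with [prim_le_integral] it trades an
    improper integral for estimates on finite horizons, which differential inequalities can
    supply. *)
Lemma integral_le_prim (R : realType) (h : R -> R) (K : R) : continuous h -> (forall t, 0 <= h t) ->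
  (forall T, 0 <= T -> prim h T <= K) -> (\int[mu]_(t in `[0%R, +oo[) (h t)%:E <= K%:E)%E.
Proof.
move=> ch h0 hK; rewrite itv0y_bigcup0S.
have mh (A : set R) : measurable_fun A (EFin \o h).
  by apply/measurable_EFinP; apply: measurable_funTS; exact: continuous_measurable_fun.
have nd : nondecreasing_seq (fun n => `[0, n.+1%:R]%classic : set R).
  by move=> m n mn; apply/subsetPset/subset_itvl; rewrite bnd_simp ler_nat.
have cv : (\int[mu]_(t in `[0%R, n.+1%:R]) (h t)%:E)%E @[n --> \oo] -->
    (\int[mu]_(t in \bigcup_n `[0%R, n.+1%:R]%classic) (h t)%:E)%E.
  apply: (@ge0_nondecreasing_set_cvg_integral _ (measurableTypeR R) R (fun n => `[0%R, n.+1%:R]%classic) (EFin \o h) (@lebesgue_measure R)).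
  - exact: nd.
  - by [].
  - by move=> n; exact: mh.
  - by move=> n t _; rewrite /= lee_fin.
rewrite -(cvg_lim _ cv)//; apply: lime_le; first exact/cvgP/cv.
apply: nearW => n.
have := hK n.+1%:R; rewrite primE// => /(_ (ler0n _ _)).
rewrite -lee_fin /Rintegral fineK//.
exact: integrable_fin_num (continuous_integrable 0 n.+1%:R ch).
Qed.

Lemma dot_le (R : realType) (n : nat) (c : R) (u v : 'cV[R]_n) : 0 < c ->
  2 * (u^T *m v) 0 0 <= c * sqnorm u + c^-1 * sqnorm v.
Proof.
move=> c0; rewrite mxE /sqnorm !mulr_sumr -big_split/=; apply: ler_sum => i _; rewrite mxE.
rewrite -subr_ge0 (_ : _ - _ = c * (u i 0 - c^-1 * v i 0) ^+ 2).
  by rewrite mulr_ge0 ?sqr_ge0// ltW.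
by field; rewrite gt_eqF.
Qed.

(** The dissipation is [- 2 * c] times the square of [v]; Young's inequality for the forcing term
    consumes half of it. *)
Lemma lyapunov_rate (R : realType) (n : nat) (N L : 'M[R]_n) (c : R) (v g : 'cV[R]_n) : 0 < c ->
  (v^T *m L *m N *m v) 0 0 <= - c * sqnorm v ->
  2 * (v^T *m L *m (N *m v + g)) 0 0 <= - c * sqnorm v + c^-1 * mxsq L * sqnorm g.
Proof.
move=> c0 h; have := dot_le v (L *m g) c0; have := sqnorm_mulmx L g.
rewrite mulmxDr !mulmxA [in X in _ -> _ -> X <= _]mxE mulrDr -mulrA.
move: (sqnorm v) (sqnorm g) (sqnorm (L *m g)) ((v^T *m L *m g) 0 0) ((v^T *m L *m N *m v) 0 0) h => a b d e q h h1 h2.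
have : c^-1 * d <= c^-1 * (mxsq L * b) by rewrite ler_wpM2l// invr_ge0 ltW.
lra.
Qed.

(** Differentiating the weight contributes [- rho] times the form, which is the same as subtracting
    [(rho / 2) *: z t] from the derivative of [z]. This is how the shift by [rho / 2] arises. *)
Lemma is_derive_lyapunov (R : realType) (n : nat) (rho : R) (L : 'M[R]_n) (z : R -> 'cV[R]_n) (t : R) dz :
  L^T = L -> mx_deriv z t dz ->
  is_derive t (1 : R) (fun s => expR (- (rho * s)) * ((z s)^T *m L *m z s) 0 0)
    (expR (- (rho * t)) * (2 * ((z t)^T *m L *m (dz - (rho / 2) *: z t)) 0 0)).
Proof.
move=> hL hz.
have hq : mx_deriv (fun s => (z s)^T *m L *m z s) t
    ((dz^T *m L) *m z t + ((z t)^T *m L) *m dz).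
  apply: mx_derivM (hz); apply: mx_deriv_eq (mx_derivM (mx_deriv_tr hz) (mx_deriv_cst L t)) _.
  by rewrite mulmx0 addr0.
have := is_deriveMr (is_derive_expw rho t) (hq 0 0).
congr (is_derive _ _ _ _).
have -> : dz^T *m L *m z t = ((z t)^T *m L *m dz)^T by rewrite !trmx_mul trmxK hL mulmxA.
rewrite mulmxBr -scalemxAr; move: (_ *m L *m z t) (_ *m L *m dz) => X Y.
by rewrite !mxE; field.
Qed.

(** The constant depends on the matrix alone, not on the solution. The same bound can therefore be
    applied path by path and integrated over the probability space. *)
Lemma lyapunov_wnorm (R : realType) (n : nat) (rho : R) (M : 'M[R]_n) :
  hurwitz (M - (rho / 2)%:M) -> exists2 C : R, 0 <= C &
  forall z g : R -> 'cV[R]_n, mx_cont z -> mx_cont g ->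
    (forall t : R, 0 < t -> mx_deriv z t (M *m z t + g t)) ->
    (wnorm rho z <= C%:E * ((sqnorm (z 0))%:E + wnorm rho g))%E.
Proof.
move=> /hurwitz_lyapunov[L hL [c c0 H]].
(* The first summand comes from the forcing, [mxsq L + 1] bounds the form at time 0, and the outer
   [c^-1] undoes the dissipation constant. *)
exists (c^-1 * (c^-1 * mxsq L + mxsq L + 1)).
  by rewrite mulr_ge0 ?addr_ge0 ?mulr_ge0 ?mxsq_ge0// ?invr_ge0 ltW.
set K := _ * _ + _ + _; move=> z g cz cg hz.
have K0 : 0 < K by rewrite /K ltr_wpDl// addr_ge0 ?mxsq_ge0// mulr_ge0 ?mxsq_ge0// invr_ge0 ltW.
have wg0 : (0 <= wnorm rho g)%E.
  by apply: integral_ge0 => t _; rewrite lee_fin wsq_ge0.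
have [gfin|] := boolP (wnorm rho g \is a fin_num); last first.
  rewrite ge0_fin_numE// -leNgt leye_eq => /eqP ->.
  by rewrite addey// gt0_muley ?leey// lte_fin mulr_gt0// invr_gt0.
rewrite -(fineK gfin); set wg := fine _.
rewrite -EFinD -EFinM; apply: integral_le_prim.
- exact: continuous_wsq.
- by move=> t; exact: wsq_ge0.
move=> T T0.
pose V s := expR (- (rho * s)) * ((z s)^T *m L *m z s) 0 0.
have hPg : prim (wsq rho g) T <= wg.
  rewrite -lee_fin fineK//; apply: prim_le_integral => //; first exact: continuous_wsq.
  by move=> t; exact: wsq_ge0.
have cV : continuous V.
  move=> t; apply: cvgM; first exact: continuous_expw.
  apply: mx_contM => // i j; apply: mx_contM; last exact: mx_cont_cst.
  by move=> k l; under eq_fun do rewrite mxE; exact: cz.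
(* This combination is nonincreasing by [lyapunov_rate]. At time [T] the form [V] is dropped since
   it is nonnegative, and at 0 both primitives vanish. *)
pose F s := V s + c * prim (wsq rho z) s - c^-1 * mxsq L * prim (wsq rho g) s.
have : F T <= F 0.
  apply: (@deriv_nonincreasing _ F (fun t => expR (- (rho * t)) * (2 * ((z t)^T *m L *m (M *m z t + g t - (rho / 2) *: z t)) 0 0) +
     c * wsq rho z t - c^-1 * mxsq L * wsq rho g t) T T0).
  - move=> t; apply: cvgB; first (apply: cvgD; first exact: cV).
    + by apply: cvgM; [exact: cvg_cst|exact/continuous_prim/continuous_wsq].
    + by apply: cvgM; [exact: cvg_cst|exact/continuous_prim/continuous_wsq].
  - move=> t t0; apply: is_deriveB; first (apply: is_deriveD; first exact: is_derive_lyapunov (hz t t0)).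
    + exact: is_deriveZ (is_derive_prim (continuous_wsq cz) t0).
    + exact: is_deriveZ (is_derive_prim (continuous_wsq cg) t0).
  - move=> t t0.
    have -> : M *m z t + g t - (rho / 2) *: z t = (M - (rho / 2)%:M) *m z t + g t.
      by rewrite mulmxBl mul_scalar_mx addrAC.
    have := lyapunov_rate (g t) c0 (H (z t)).1.
    rewrite /wsq; have := expR_gt0 (- (rho * t)).
    move: (expR _) (2 * _) (sqnorm (z t)) (sqnorm (g t)) (c^-1 * mxsq L) => e q a b k e0 h.
    rewrite (_ : _ - _ = e * (q - (- c * a + k * b))); last by ring.
    by rewrite mulr_ge0_le0 ?subr_le0// ltW.
rewrite /F !prim0 !mulr0 subr0 addr0.
have V0 : 0 <= V T.
  by rewrite mulr_ge0 ?expR_ge0// (le_trans _ (H _).2)// mulr_ge0 ?sqnorm_ge0// ltW.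
have V00 : V 0 <= (1 + mxsq L) * sqnorm (z 0).
  rewrite /V mulr0 oppr0 expR0 mul1r -mulmxA.
  have := dot_le (z 0) (L *m z 0) ltr01; rewrite invr1 !mul1r.
  have := sqnorm_mulmx L (z 0); have := sqnorm_ge0 (z 0); have := mxsq_ge0 L.
  by have := sqnorm_ge0 (L *m z 0); nra.
have zz0 := sqnorm_ge0 (z 0); have L0 := mxsq_ge0 L.
have kL0 : 0 <= c^-1 * mxsq L by rewrite mulr_ge0// invr_ge0 ltW.
have Pg0 : 0 <= wg by apply: fine_ge0.
move: (prim (wsq rho z) T) (prim (wsq rho g) T) hPg => pz pg hPg h.
have : c * pz <= K * (sqnorm (z 0) + wg).
  rewrite /K; move: (c^-1 * mxsq L) kL0 h => k kL0 h; nra.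
by rewrite -ler_pdivlMl// mulrA.
Qed.

(** * Variation of constants, comparison of primitives, and solutions singled out at infinity *)

Definition mx_prim (R : realType) (m n : nat) (g : R -> 'M[R]_(m, n)) (t : R) : 'M[R]_(m, n) :=
  \matrix_(i, j) prim (fun s => g s i j) t.

Lemma mx_deriv_prim (R : realType) (m n : nat) (g : R -> 'M[R]_(m, n)) (t : R) :
  mx_cont g -> 0 < t -> mx_deriv (mx_prim g) t (g t).
Proof.
move=> cg t0 i j; under eq_fun do rewrite mxE.
exact: is_derive_prim (cg i j) t0.
Qed.

Lemma mx_cont_prim (R : realType) (m n : nat) (g : R -> 'M[R]_(m, n)) :
  mx_cont g -> mx_cont (mx_prim g).
Proof. by move=> cg i j; under eq_fun do rewrite mxE; exact: continuous_prim. Qed.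

Lemma mx_prim0 (R : realType) (m n : nat) (g : R -> 'M[R]_(m, n)) : mx_prim g 0 = 0.
Proof. by apply/matrixP => i j; rewrite !mxE prim0. Qed.

Definition ode_sol (R : realType) (n : nat) (M : 'M[R]_n) (g : R -> 'cV[R]_n) (z0 : 'cV[R]_n) (t : R) :=
  mx_exp M t *m (z0 + mx_prim (fun s => mx_exp M (- s) *m g s) t).

Lemma ode_sol0 (R : realType) (n : nat) (M : 'M[R]_n) g z0 : ode_sol M g z0 0 = z0.
Proof. by rewrite /ode_sol mx_prim0 addr0 mx_exp0 mul1mx. Qed.

Lemma mx_cont_ode_sol (R : realType) (n : nat) (M : 'M[R]_n) g z0 :
  mx_cont g -> mx_cont (ode_sol M g z0).
Proof.
move=> cg; apply: mx_contM; first exact: mx_cont_exp.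
apply: mx_contD; first exact: mx_cont_cst.
by apply: mx_cont_prim; apply: mx_contM => //; exact: mx_cont_expN.
Qed.

Lemma mx_deriv_ode_sol (R : realType) (n : nat) (M : 'M[R]_n) g z0 (t : R) :
  mx_cont g -> 0 < t -> mx_deriv (ode_sol M g z0) t (M *m ode_sol M g z0 t + g t).
Proof.
move=> cg t0.
have ch : mx_cont (fun s => mx_exp M (- s) *m g s).
  by apply: mx_contM => //; exact: mx_cont_expN.
have h := mx_derivM (mx_deriv_exp M t) (mx_derivD (mx_deriv_cst z0 t) (mx_deriv_prim ch t0)).
apply: mx_deriv_eq h _.
by rewrite add0r /ode_sol !mulmxA mx_expKN ?mul1mx// ltW.
Qed.

Lemma ode_unique0 (R : realType) (n : nat) (M : 'M[R]_n) (z : R -> 'cV[R]_n) :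
  mx_cont z -> z 0 = 0 -> (forall t : R, 0 < t -> mx_deriv z t (M *m z t)) ->
  forall t, 0 <= t -> z t = 0.
Proof.
move=> cz z0 hz t t0.
have : mx_exp M (- t) *m z t = 0.
  rewrite (@mx_deriv0_constant _ _ _ (fun s => mx_exp M (- s) *m z s) t t0).
  - by rewrite z0 mulmx0.
  - by apply: mx_contM => //; exact: mx_cont_expN.
  move=> s s0; apply: mx_deriv_eq (mx_derivM (mx_deriv_expN M s) (hz s s0)) _.
  by rewrite mx_exp_comm mulNmx -mulmxA addNr.
by move/(congr1 (mulmx (mx_exp M t))); rewrite mulmxA mx_expKN// mul1mx mulmx0.
Qed.

Lemma prim_le (R : realType) (f g : R -> R) (T : R) : continuous f -> continuous g ->
  (forall t, 0 < t -> f t <= g t) -> 0 <= T -> prim f T <= prim g T.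
Proof.
move=> cf cg fg T0; rewrite -subr_le0.
apply: (le_trans (@deriv_nonincreasing _ (fun t => prim f t - prim g t) (fun t => f t - g t) T _ _ _ _)) => //.
- by move=> t; apply: cvgB; exact: continuous_prim.
- by move=> t t0; apply: is_deriveB; exact: is_derive_prim.
- by move=> t t0; rewrite subr_le0 fg.
- by rewrite !prim0 subrr.
Qed.

Lemma deriv0_zero (R : realType) (f : R -> R) (T : R) : 0 <= T -> continuous f -> f 0 = 0 ->
  (forall t : R, 0 < t -> is_derive t (1 : R) f 0) -> f T = 0.
Proof. by move=> T0 cf f0 h; rewrite -[RHS]f0; apply: deriv0_constant. Qed.

Lemma primD (R : realType) (f g : R -> R) (T : R) : continuous f -> continuous g -> 0 <= T ->
  prim (fun t => f t + g t) T = prim f T + prim g T.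
Proof.
move=> cf cg T0; apply/eqP; rewrite -subr_eq0; apply/eqP.
have cfg : continuous (fun t => f t + g t) by move=> t; apply: cvgD; [exact: cf|exact: cg].
apply: (@deriv0_zero _ (fun t => prim (fun t => f t + g t) t - (prim f t + prim g t)) T) => //.
- by move=> t; apply: cvgB; [exact: continuous_prim|apply: cvgD; exact: continuous_prim].
- by rewrite !prim0 addr0 subrr.
- move=> t t0; rewrite -[0](subrr (f t + g t)); apply: is_deriveB; first exact: is_derive_prim.
  by apply: is_deriveD; exact: is_derive_prim.
Qed.

Lemma primZ (R : realType) (k : R) (f : R -> R) (T : R) : continuous f -> 0 <= T ->
  prim (fun t => k * f t) T = k * prim f T.
Proof.
move=> cf T0; apply/eqP; rewrite -subr_eq0; apply/eqP.
have ckf : continuous (fun t => k * f t) by move=> t; apply: cvgM; [exact: cvg_cst|exact: cf].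
apply: (@deriv0_zero _ (fun t => prim (fun t => k * f t) t - k * prim f t) T) => //.
- by move=> t; apply: cvgB; [exact: continuous_prim|apply: cvgM; [exact: cvg_cst|exact: continuous_prim]].
- by rewrite !prim0 mulr0 subrr.
- move=> t t0; rewrite -[0](subrr (k * f t)); apply: is_deriveB; first exact: is_derive_prim.
  exact: is_deriveZ (is_derive_prim cf t0).
Qed.

Lemma prim_cst (R : realType) (k T : R) : 0 <= T -> prim (fun=> k) T = k * T.
Proof.
move=> T0; have ck : continuous (fun=> k : R) := @cst_continuous R R k.
apply/eqP; rewrite -subr_eq0; apply/eqP.
apply: (@deriv0_zero _ (fun t => prim (fun=> k) t - k * t)) => //.
- move=> t; apply: cvgB; first exact: continuous_prim.
  by apply: cvgM; [exact: cvg_cst|exact: cvg_id].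
- by rewrite prim0 mulr0 subr0.
- move=> t t0; rewrite -[0](subrr k) -[X in _ - X]mulr1.
  have h2 : is_derive t (1 : R) (fun t : R => k * t) (k * 1) by exact: (@is_deriveZ _ _ _ id).
  exact: is_deriveB (is_derive_prim ck t0) h2.
Qed.

Lemma prim_ndecr (R : realType) (f : R -> R) (s t : R) : continuous f -> (forall u, 0 <= f u) ->
  0 <= s -> s <= t -> prim f s <= prim f t.
Proof.
move=> cf f0 s0 st; have t0 := le_trans s0 st.
rewrite -lee_fin !primE// /Rintegral !fineK; last 2 first.
- exact: integrable_fin_num (continuous_integrable 0 t cf).
- exact: integrable_fin_num (continuous_integrable 0 s cf).
apply: ge0_subset_integral => //.
- by apply/measurable_EFinP; apply: measurable_funTS; exact: continuous_measurable_fun.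
- by move=> u _; rewrite lee_fin.
- exact: subset_itvl.
Qed.

(** The matrix is antistable, so the Lyapunov form of [(rho / 2)%:M - N] grows along solutions up to
    the forcing. The terminal condition removes the form at [T], and at 0 it has the favourable
    sign. The constant does not depend on [T], which permits sending [T] to infinity. *)
Lemma lyapunov_backward (R : realType) (n : nat) (rho : R) (N : 'M[R]_n) :
  hurwitz ((rho / 2)%:M - N) -> exists2 C : R, 0 <= C &
  forall (z g : R -> 'cV[R]_n) (T : R), mx_cont z -> mx_cont g ->
    (forall t : R, 0 < t -> mx_deriv z t (N *m z t + g t)) -> 0 <= T -> z T = 0 ->
    prim (wsq rho z) T <= C * prim (wsq rho g) T.
Proof.
move=> /hurwitz_lyapunov[L hL [c c0 H]].
exists (c^-1 * (c^-1 * mxsq L)).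
  by rewrite !mulr_ge0 ?mxsq_ge0// invr_ge0 ltW.
move=> z g T cz cg hz T0 zT.
pose V s := expR (- (rho * s)) * ((z s)^T *m L *m z s) 0 0.
have cV : continuous V.
  move=> t; apply: cvgM; first exact: continuous_expw.
  apply: mx_contM => // i j; apply: mx_contM; last exact: mx_cont_cst.
  by move=> k l; under eq_fun do rewrite mxE; exact: cz.
pose F s := - V s + c * prim (wsq rho z) s - c^-1 * mxsq L * prim (wsq rho g) s.
have : F T <= F 0.
  apply: (@deriv_nonincreasing _ F (fun t => - (expR (- (rho * t)) * (2 * ((z t)^T *m L *m (N *m z t + g t - (rho / 2) *: z t)) 0 0)) +
     c * wsq rho z t - c^-1 * mxsq L * wsq rho g t) T T0).
  - move=> t; apply: cvgB; first (apply: cvgD; first by apply: cvgN; exact: cV).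
    + by apply: cvgM; [exact: cvg_cst|exact/continuous_prim/continuous_wsq].
    + by apply: cvgM; [exact: cvg_cst|exact/continuous_prim/continuous_wsq].
  - move=> t t0; apply: is_deriveB; first (apply: is_deriveD; first exact: is_deriveN (is_derive_lyapunov rho hL (hz t t0))).
    + exact: is_deriveZ (is_derive_prim (continuous_wsq cz) t0).
    + exact: is_deriveZ (is_derive_prim (continuous_wsq cg) t0).
  - move=> t t0.
    have -> : N *m z t + g t - (rho / 2) *: z t = - (((rho / 2)%:M - N) *m z t + - g t).
      by rewrite mulmxBl mul_scalar_mx; move: (N *m z t) => X; apply/matrixP => i j; rewrite !mxE; ring.
    have := lyapunov_rate (- g t) c0 (H (z t)).1.
    rewrite sqnormN mulmxN; set X := (z t)^T *m L *m _.
    have -> : (- X) 0 0 = - X 0 0 by rewrite mxE.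
    rewrite /wsq; have := expR_gt0 (- (rho * t)).
    move: (expR _) (X 0 0) (sqnorm (z t)) (sqnorm (g t)) (c^-1 * mxsq L) => e q a b k e0 h.
    rewrite (_ : _ - _ = e * (2 * q - (- c * a + k * b))); last by ring.
    by rewrite mulr_ge0_le0 ?subr_le0// ltW.
rewrite /F !prim0 !mulr0 subr0 addr0.
have -> : V T = 0 by rewrite /V zT mulmx0 mxE mulr0.
have V0 : 0 <= V 0.
  by rewrite mulr_ge0 ?expR_ge0// (le_trans _ (H _).2)// mulr_ge0 ?sqnorm_ge0// ltW.
move=> h; rewrite -[leRHS]mulrA ler_pdivlMl//; lra.
Qed.

Lemma wnorm_le_prim (R : realType) (n : nat) (rho : R) (g : R -> 'cV[R]_n) (K : R) : mx_cont g ->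
  (forall T, 0 <= T -> prim (wsq rho g) T <= K) -> (wnorm rho g <= K%:E)%E.
Proof.
move=> cg h; apply: integral_le_prim => //; first exact: continuous_wsq.
by move=> t; exact: wsq_ge0.
Qed.

Lemma wnorm_ge0 (R : realType) (n : nat) (rho : R) (g : R -> 'cV[R]_n) : (0 <= wnorm rho g)%E.
Proof. by apply: integral_ge0 => t _; rewrite lee_fin wsq_ge0. Qed.

Lemma prim_le_wnorm (R : realType) (n : nat) (rho : R) (g : R -> 'cV[R]_n) (T : R) : mx_cont g ->
  (wnorm rho g < +oo)%E -> 0 <= T -> prim (wsq rho g) T <= fine (wnorm rho g).
Proof.
move=> cg gfin T0; rewrite -lee_fin fineK ?ge0_fin_numE ?wnorm_ge0//.
by apply: prim_le_integral => //; [exact: continuous_wsq|move=> t; exact: wsq_ge0].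
Qed.

(* [p + i q] solves [w' = (x + i y) w]. *)
Lemma spiral_energy (R : realType) (p q : R -> R) (x y T : R) : continuous p -> continuous q ->
  (forall t : R, 0 < t -> is_derive t (1 : R) p (x * p t - y * q t)) ->
  (forall t : R, 0 < t -> is_derive t (1 : R) q (y * p t + x * q t)) -> 0 <= T ->
  expR (- (2 * x * T)) * (p T * p T + q T * q T) = p 0 * p 0 + q 0 * q 0.
Proof.
move=> cp cq dp dq T0.
have := @deriv0_constant _ (fun t => expR (- (2 * x * t)) * (p t * p t + q t * q t)) T T0.
rewrite mulr0 oppr0 expR0 mul1r; apply.
  move=> s; apply: cvgM; first exact: continuous_expw.
  by apply: cvgD; apply: cvgM; (exact: cp || exact: cq).
move=> s s0.
have := is_deriveMr (is_derive_expw (2 * x) s)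
  (is_deriveD (is_deriveMr (dp s s0) (dp s s0)) (is_deriveMr (dq s s0) (dq s s0))).
by congr (is_derive _ _ _ _); rewrite fctE; ring.
Qed.

(** Pairing a solution with the real and imaginary parts of a left eigenvector gives a planar spiral
    whose energy grows exactly at the rate [2 * (al + rho / 2)]. If [al] were nonnegative, the
    weighted energy would stay above a positive constant and its integral would diverge. *)
Lemma hurwitz_of_wnorm (R : realType) (n : nat) (rho : R) (M : 'M[R]_n) :
  (forall v, exists psi : R -> 'cV[R]_n, [/\ mx_cont psi, psi 0 = v,
     forall t : R, 0 < t -> mx_deriv psi t (M *m psi t) & (wnorm rho psi < +oo)%E]) ->
  hurwitz (M - (rho / 2)%:M).
Proof.
move=> hpsi z /eigenvalueP[v vz v0].
have [k vk] : exists k, v 0 k != 0 by move/rV0Pn: v0.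
(* Starting at the unit vector of a coordinate where [v] does not vanish makes the initial energy
   [cnormsq (v 0 k)], which is positive. *)
have [psi [cpsi psi0 dpsi wpsi]] := hpsi (delta_mx k 0).
pose a : 'rV[R]_n := map_mx (@complex.Re R) v; pose b : 'rV[R]_n := map_mx (@complex.Im R) v.
set al := cRe z; pose be := cIm z.
have aM : a *m M = (al + rho / 2) *: a - be *: b.
  have /(congr1 (map_mx (@complex.Re R))) := vz.
  rewrite map_Re_mulmxr -/a mulmxBr mul_mx_scalar => /eqP; rewrite subr_eq => /eqP ->.
  apply/rowP => j; rewrite !mxE /al /be; case: z {vz al be} (v 0 j) => [x y] [p q] /=; ring.
have bM : b *m M = be *: a + (al + rho / 2) *: b.
  have Im_mul : map_mx (@complex.Im R) (v *m map_mx (real_complex R) (M - (rho / 2)%:M)) = b *m (M - (rho / 2)%:M).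
    apply/rowP => j; rewrite !mxE.
    have Im_sum (I : Type) (s : seq I) (F : I -> R[i]) : cIm (\sum_(i <- s) F i) = \sum_(i <- s) cIm (F i).
      by elim/big_rec2: _ => // i x y _ <-; case: (F i) y => [? ?] [? ?].
    rewrite Im_sum; apply: eq_bigr => i _; rewrite !mxE; case: (v 0 i) => x y /=; ring.
  have /(congr1 (map_mx (@complex.Im R))) := vz.
  rewrite Im_mul mulmxBr mul_mx_scalar => /eqP; rewrite subr_eq => /eqP ->.
  apply/rowP => j; rewrite !mxE /al /be; case: z {vz al be aM Im_mul} (v 0 j) => [x y] [p q] /=; ring.
pose p (t : R) : R := (a *m psi t) 0 0; pose q (t : R) : R := (b *m psi t) 0 0.
pose w := 2 * (al + rho / 2).
pose Y t := expR (- (w * t)) * (p t * p t + q t * q t).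
have dp (t : R) : 0 < t -> is_derive t (1 : R) p ((al + rho / 2) * p t - be * q t).
  move=> t0; apply: is_derive_eq; first exact: (mx_derivMl a (dpsi t t0) 0 0).
  by rewrite mulmxA aM mulmxBl -!scalemxAl /p /q; move: (a *m psi t) (b *m psi t) => U V; rewrite !mxE.
have dq (t : R) : 0 < t -> is_derive t (1 : R) q (be * p t + (al + rho / 2) * q t).
  move=> t0; apply: is_derive_eq; first exact: (mx_derivMl b (dpsi t t0) 0 0).
  by rewrite mulmxA bM mulmxDl -!scalemxAl /p /q; move: (a *m psi t) (b *m psi t) => U V; rewrite !mxE.
have cp : continuous p by have h := @mx_contMl _ _ _ _ a _ cpsi; move=> t; exact: (h 0 0 t).
have cq : continuous q by have h := @mx_contMl _ _ _ _ b _ cpsi; move=> t; exact: (h 0 0 t).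
have Yc t : 0 <= t -> Y t = cnormsq (v 0 k).
  move=> t0; rewrite /Y /w (spiral_energy cp cq dp dq t0) /p /q psi0 /cnormsq.
  have ck (u : 'rV[R]_n) : (u *m delta_mx k (0 : 'I_1)) 0 0 = u 0 k.
    by rewrite -colE mxE.
  by rewrite !ck /a /b !mxE !expr2.
have Yk : 0 < cnormsq (v 0 k).
  move: vk; case: (v 0 k) => x y; rewrite eq_complex /= negb_and /cnormsq/= => h.
  rewrite lt_def addr_ge0 ?sqr_ge0// andbT paddr_eq0 ?sqr_ge0// !sqrf_eq0.
  by rewrite negb_and.
rewrite ltNge; apply/negP => al0.
pose m := mxsq a + mxsq b.
have pq t : p t * p t + q t * q t <= m * sqnorm (psi t).
  have := sqnorm_mulmx a (psi t); have := sqnorm_mulmx b (psi t).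
  by rewrite /m /sqnorm !big_ord1 -/(p t) -/(q t) mulrDl -!expr2 => h1 h2; rewrite addrC [leRHS]addrC lerD.
have low t : 0 <= t -> cnormsq (v 0 k) <= m * wsq rho psi t.
  move=> t0; rewrite -(Yc t t0) /Y /wsq mulrCA.
  apply: (@le_trans _ _ (expR (- (rho * t)) * (p t * p t + q t * q t))); last first.
    by rewrite ler_wpM2l ?expR_ge0.
  rewrite ler_wpM2r//; first by rewrite addr_ge0// -expr2 sqr_ge0.
  rewrite ler_expR lerN2 ler_wpM2r// /w; lra.
have m0 : 0 <= m by rewrite addr_ge0 ?mxsq_ge0.
have wf0 : 0 <= fine (wnorm rho psi) by apply: fine_ge0; exact: wnorm_ge0.
(* At this horizon the constant lower bound integrates to [m] times the weighted norm plus 1, more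
   than the upper bound allows. *)
pose T := (m * fine (wnorm rho psi) + 1) / cnormsq (v 0 k).
have T0 : 0 <= T by apply: divr_ge0; [rewrite addr_ge0 ?mulr_ge0|exact: ltW].
have : prim (fun=> cnormsq (v 0 k)) T <= prim (fun t => m * wsq rho psi t) T.
  apply: prim_le => //; first exact: cst_continuous.
    by move=> t; apply: cvgM; [exact: cvg_cst|exact: continuous_wsq].
  by move=> t t0; apply: low; exact: ltW.
rewrite primZ//; last exact: continuous_wsq.
rewrite prim_cst//.
rewrite /T mulrCA divff ?gt_eqF// mulr1.
have := prim_le_wnorm cpsi wpsi T0 => h1 h2.
have : m * prim (wsq rho psi) T <= m * fine (wnorm rho psi) by rewrite ler_wpM2l.
by move: h2; lra.
Qed.

(* The solutions vanishing at time [k] converge as [k] grows, by the backward Lyapunov estimate. *)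
Lemma backward_solution (R : realType) (n : nat) (rho : R) (N : 'M[R]_n) (g : R -> 'cV[R]_n) :
  hurwitz ((rho / 2)%:M - N) -> mx_cont g -> (wnorm rho g < +oo)%E ->
  exists s : R -> 'cV[R]_n, [/\ mx_cont s,
    forall t : R, 0 < t -> mx_deriv s t (N *m s t + g t) & (wnorm rho s < +oo)%E].
Proof.
move=> hN cg gfin.
pose F (t : R) := mx_exp N (- t).
pose e (j : 'I_n) : R -> 'cV[R]_n := fun t => F t *m delta_mx j 0.
have cF : mx_cont F by exact: mx_cont_expN.
have ce j : mx_cont (e j) by apply: mx_contM => //; exact: mx_cont_cst.
(* The discount [- rho] means the growing weight exp(rho t): antistability of [N] makes the columns
   of exp(-tN) decay fast enough to be square integrable even against it. *)
have efin j : (wnorm (- rho) (e j) < +oo)%E.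
  have [|C C0 HC] := @lyapunov_wnorm R n (- rho) (- N).
    by move: hN; congr (hurwitz _); rewrite mulNr raddfN/= opprK addrC.
  have := HC (e j) (fun=> 0) (ce j) (@mx_cont_cst _ _ _ 0).
  have -> : wnorm (- rho) (fun=> 0 : 'cV[R]_n) = 0%E.
    by rewrite /wnorm integral0_eq// => t _; rewrite /wsq sqnorm0 mulr0.
  move=> h; apply: le_lt_trans (h _) _; last by rewrite adde0 -EFinM ltry.
  move=> t t0; apply: mx_deriv_eq (mx_derivM (mx_deriv_expN N t) (mx_deriv_cst (delta_mx j 0) t)) _.
  by rewrite mulmx0 /e /F !addr0 !mulNmx mulmxA.
pose h (t : R) := F t *m g t.
have ch : mx_cont h by exact: mx_contM.
(* Integrable majorant of the integrand of the Duhamel formula: a factor exp(rho t / 2) is moved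
   from [g] to the exponential matrix, and the product is bounded by the sum of the squares. *)
pose b (t : R) := \sum_j wsq (- rho) (e j) t + wsq rho g t.
have b0 t : 0 <= b t.
  by rewrite addr_ge0 ?wsq_ge0// sumr_ge0// => j _; exact: wsq_ge0.
have cb : continuous b.
  move=> t; apply: cvgD; last exact: continuous_wsq.
  by apply: continuous_bigsum => j; exact: continuous_wsq.
have hb t i : `|h t i 0| <= b t.
  have h2 : `|h t i 0| ^+ 2 <= (\sum_j F t i j ^+ 2) * sqnorm (g t).
    by rewrite real_normK ?num_real// /h mxE; exact: sqr_sum_mul_le.
  have hF : expR (- (- rho * t)) * \sum_j F t i j ^+ 2 <= \sum_j wsq (- rho) (e j) t.
    rewrite mulr_sumr; apply: ler_sum => j _; rewrite /wsq ler_wpM2l ?expR_ge0//.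
    have -> : F t i j = e j t i 0 by rewrite /e -colE [RHS]mxE.
    rewrite /sqnorm (bigD1 i)//= lerDl.
    by apply: sumr_ge0 => k _; exact: sqr_ge0.
  have ee : expR (- (- rho * t)) * expR (- (rho * t)) = 1.
    by rewrite -expRD mulNr opprK subrr expR0.
  have E0 := expR_gt0 (- (- rho * t)); have E1 := expR_gt0 (- (rho * t)).
  have S0 : 0 <= \sum_j F t i j ^+ 2 by apply: sumr_ge0 => k _; exact: sqr_ge0.
  rewrite /b; apply: (le_trans _ (lerD hF (lexx _))).
  have := sqnorm_ge0 (g t).
  move: h2 E0 E1 ee S0; rewrite /wsq.
  move: (expR _) (expR _) (sqnorm (g t)) (\sum_j F t i j ^+ 2) => y x u v h2 x0 y0 xy v0 u0.
  have q : (x * v) * (y * u) = v * u by rewrite mulrACA xy mul1r.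
  have p1 : 0 <= x * v by rewrite mulr_ge0// ltW.
  have p2 : 0 <= y * u by rewrite mulr_ge0// ltW.
  rewrite -(@ler_pXn2r _ 2)// ?nnegrE ?addr_ge0 ?normr_ge0//.
  apply: (le_trans h2); rewrite -q; nra.
pose B := \sum_j fine (wnorm (- rho) (e j)) + fine (wnorm rho g).
have hB T : 0 <= T -> prim b T <= B.
  move=> T0; rewrite primD//; last 2 first.
  - by apply: continuous_bigsum => j; exact: continuous_wsq.
  - exact: continuous_wsq.
  apply: lerD; last exact: prim_le_wnorm.
  have cs (s : seq 'I_n) : continuous (fun t => \sum_(j <- s) wsq (- rho) (e j) t).
    by apply: continuous_bigsum => j; exact: continuous_wsq.
  elim: (index_enum _) => [|j s IH].
    rewrite big_nil (_ : (fun t => _) = fun=> 0); last by apply/funext => t; rewrite big_nil.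
    by rewrite prim_cst// mul0r.
  rewrite big_cons (_ : (fun t => _) = fun t => wsq (- rho) (e j) t + \sum_(j <- s) wsq (- rho) (e j) t); last first.
    by apply/funext => t; rewrite big_cons.
  rewrite primD//; last exact: continuous_wsq.
  by apply: lerD => //; exact: prim_le_wnorm.
(* [K] is the integral of exp(-sN) g(s) over the half-line. The initial value [- K] cancels the
   growing modes of the solution. *)
have [K hK] : exists K : 'cV[R]_n, forall i, mx_prim h k%:R i 0 @[k --> \oo] --> K i 0.
  suff /choice[K hK] : forall i, exists K : R, mx_prim h k%:R i 0 @[k --> \oo] --> K.
    by exists (\col_i K i) => i; rewrite mxE; exact: hK.
  move=> i.
  have chi : continuous (fun t => h t i 0) by exact: ch.
  (* The entries of [h] have no sign, but both [h + b] and [b] are nonnegative with bounded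
     primitives; the integral of [h] converges as the difference of two monotone limits. *)
  have chb : continuous (fun t => h t i 0 + b t) by move=> t; apply: cvgD; [exact: chi|exact: cb].
  have hb0 t : 0 <= h t i 0 + b t.
    by rewrite -lerBlDr sub0r; have := hb t i; rewrite ler_norml => /andP[].
  have inc (f : R -> R) : continuous f -> (forall t, 0 <= f t) -> (forall t, f t <= 2 * b t) ->
      cvgn (fun k : nat => prim f k%:R).
    move=> cf f0 fb; apply: nondecreasing_is_cvgn.
      by move=> k l kl; apply: prim_ndecr => //; rewrite ler_nat.
    exists (2 * B) => _ [k _ <-].
    apply: (@le_trans _ _ (prim (fun t => 2 * b t) k%:R)).
      by apply: prim_le => // t; apply: cvgM; [exact: cvg_cst|exact: cb].
    by rewrite primZ// ler_wpM2l// hB.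
  have i1 : cvgn (fun k : nat => prim (fun t => h t i 0 + b t) k%:R).
    apply: inc => // t; have := hb t i; rewrite ler_norml => /andP[_ hh]; lra.
  have i2 : cvgn (fun k : nat => prim b k%:R).
    by apply: inc => // t; have := b0 t; lra.
  exists (limn (fun k : nat => prim (fun t => h t i 0 + b t) k%:R) - limn (fun k : nat => prim b k%:R)).
  rewrite (_ : (fun k => _) = (fun k : nat => prim (fun t => h t i 0 + b t) k%:R - prim b k%:R)).
    by apply: cvgB; [exact: i1|exact: i2].
  by apply/funext => k; rewrite mxE primD// addrK.
have [C C0 HC] := lyapunov_backward hN.
exists (ode_sol N g (- K)); split.
- exact: mx_cont_ode_sol.
- by move=> t t0; exact: mx_deriv_ode_sol.
apply: (@le_lt_trans _ _ (2 * (C * fine (wnorm rho g)) + 1)%:E); last exact: ltry.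
apply: wnorm_le_prim; first exact: mx_cont_ode_sol.
move=> T T0.
pose q (t : R) := expR (- (rho * t)) * mxsq (mx_exp N t).
have cq : continuous q.
  move=> t; apply: cvgM; first exact: continuous_expw.
  apply: continuous_bigsum => i; apply: continuous_bigsum => j.
  under eq_fun do rewrite expr2.
  by move=> u; apply: cvgM; exact: mx_cont_exp.
(* For fixed [T], the solution started at [- K] and the one vanishing at time [k] differ by exp(tN)
   applied to an error that tends to 0. A large [k] makes this contribution at most 1, which is the
   [+ 1] of the bound, uniform in [T]. *)
have : 2 * (prim q T) * sqnorm (mx_prim h k%:R - K) @[k --> \oo] --> 2 * prim q T * 0.
  apply: cvgM; first exact: cvg_cst.
  rewrite -[0](sqnorm0 R n); apply: cvg_bigsum => i.
  under eq_fun do rewrite expr2; rewrite expr2 mxE.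
  have d0 : (mx_prim h k%:R - K) i 0 @[k --> \oo] --> (0 : R).
    rewrite -(subrr (K i 0)); under eq_fun do rewrite mxE [(- K) i 0]mxE.
    by apply: cvgB; [exact: hK|exact: cvg_cst].
  exact: cvgM.
rewrite mulr0 => /cvgrPdist_lt/(_ 1 ltr01) hnear.
near \oo => k.
have kT : T <= k%:R by near: k; exact: nbhs_infty_ger.
have k1 : 2 * prim q T * sqnorm (mx_prim h k%:R - K) <= 1.
  apply: ltW; apply: le_lt_trans (ler_norm _) _.
  by near: k; move: hnear; apply: filterS => l; rewrite sub0r normrN.
pose sk := ode_sol N g (- mx_prim h k%:R).
have csk : mx_cont sk by exact: mx_cont_ode_sol.
have hsk : prim (wsq rho sk) T <= C * fine (wnorm rho g).
  apply: (@le_trans _ _ (prim (wsq rho sk) k%:R)).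
    by apply: prim_ndecr => //; [exact: continuous_wsq|move=> t; exact: wsq_ge0].
  apply: (le_trans (HC sk g k%:R csk cg _ _ _)) => //.
  - by move=> t t0; exact: mx_deriv_ode_sol.
  - by rewrite /sk /ode_sol addNr mulmx0.
  - by rewrite ler_wpM2l// prim_le_wnorm.
have c1 : continuous (fun t => 2 * wsq rho sk t).
  by move=> t; apply: cvgM; [exact: cvg_cst|exact: continuous_wsq].
have c2 : continuous (fun t => sqnorm (mx_prim h k%:R - K) * q t).
  by move=> t; apply: cvgM; [exact: cvg_cst|exact: cq].
have c3 : continuous (fun t => 2 * (sqnorm (mx_prim h k%:R - K) * q t)).
  by move=> t; apply: cvgM; [exact: cvg_cst|exact: c2].
apply: (@le_trans _ _ (prim (fun t => 2 * wsq rho sk t + 2 * (sqnorm (mx_prim h k%:R - K) * q t)) T)).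
  apply: prim_le => //.
  - by apply: continuous_wsq; exact: mx_cont_ode_sol.
  - by move=> t; apply: cvgD; [exact: c1|exact: c3].
  - move=> t t0; rewrite /wsq.
    have -> : ode_sol N g (- K) t = sk t + mx_exp N t *m (mx_prim h k%:R - K).
      by rewrite /sk /ode_sol -mulmxDr; congr (_ *m _); rewrite [RHS]addrACA addNr add0r addrC.
    have := sqnormD_le (sk t) (mx_exp N t *m (mx_prim h k%:R - K)).
    have := sqnorm_mulmx (mx_exp N t) (mx_prim h k%:R - K).
    rewrite /q; have := expR_gt0 (- (rho * t)).
    move: (sqnorm (sk t + _)) (sqnorm (mx_exp N t *m _)) (expR _) (sqnorm (sk t)) (mxsq _) (sqnorm (mx_prim h k%:R - K)) => m f x a c d x0 h1 h2.
    rewrite [leRHS](_ : _ = x * (2 * a + 2 * (c * d))); last by ring.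
    by rewrite ler_pM2l//; lra.
rewrite primD// primZ//; last exact: continuous_wsq.
rewrite primZ// primZ//.
by move: hsk k1; lra.
Unshelve. all: by end_near. Qed.

(** * Moments and independence of Brownian increments *)

Import HBNNSimple.
Lemma integral_density d (T : measurableType d) (R : realType)
    (m nu : {measure set T -> \bar R}) (p f : T -> R) :
  measurable_fun setT p -> (forall x, 0 <= p x) ->
  (forall A, measurable A -> nu A = \int[m]_(x in A) (p x)%:E)%E ->
  measurable_fun setT f -> (forall x, 0 <= f x) ->
  (\int[nu]_x (f x)%:E = \int[m]_x (f x * p x)%:E)%E.
Proof.
move=> mp p0 nuE mf f0.
have mEf : measurable_fun setT (EFin \o f) by exact/measurable_EFinP.
pose g := nnsfun_approx measurableT mEf.
have gf x : (fun n => (g n x)%:E) @ \oo --> (f x)%:E.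
  by apply: cvg_nnsfun_approx => // y _; rewrite lee_fin.
have gnd x k n : (k <= n)%N -> g k x <= g n x.
  by move=> mn; exact/lefP/nd_nnsfun_approx.
transitivity (limn (fun n => \int[nu]_x (g n x)%:E)%E).
  rewrite -monotone_convergence//.
  - by apply: eq_integral => x _; apply/esym/cvg_lim => //; exact: gf.
  - by move=> n; exact/measurable_EFinP.
  - by move=> n x _; rewrite lee_fin.
  - by move=> x _ k n mn; rewrite lee_fin gnd.
rewrite (_ : (fun n => _) = (fun n => \int[m]_x (g n x * p x)%:E)%E).
  rewrite -monotone_convergence//.
  - apply: eq_integral => x _; apply/cvg_lim => //.
    under eq_fun do rewrite EFinM; rewrite EFinM.
    by apply: cvgeZr => //; exact: gf.
  - by move=> n; apply/measurable_EFinP; apply: measurable_funM.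
  - by move=> n x _; rewrite lee_fin mulr_ge0.
  - by move=> x _ k n mn; rewrite lee_fin ler_wpM2r// gnd.
apply/funext => n; rewrite integralT_nnsfun sintegralE.
transitivity (\int[m]_x \sum_(y \in range (g n))
    ((y * \1_(g n @^-1` [set y]) x)%:E * (p x)%:E))%E; last first.
  apply: eq_integral => x _; rewrite EFinM (fimfunE (g n)) -fsumEFin//.
  by rewrite ge0_mule_fsuml// => y; exact: nnfun_muleindic_ge0.
rewrite ge0_integral_fsum//; last 2 first.
- move=> r; under eq_fun do rewrite -EFinM.
  apply/measurable_EFinP; apply: measurable_funM => //.
  by apply: measurable_funM => //; exact: measurable_indic.
- by move=> r x _; apply: mule_ge0; rewrite ?lee_fin// -lee_fin; exact: nnfun_muleindic_ge0.
apply: eq_fsbigr => r; rewrite inE => -[x _ rx].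
have r0 : 0 <= r by rewrite -rx.
under [RHS]eq_integral do rewrite EFinM -muleA.
rewrite ge0_integralZl//; last 2 first.
- by apply: emeasurable_funM; apply/measurable_EFinP.
- by move=> y _; rewrite mule_ge0 ?lee_fin.
congr (_ * _)%E; rewrite nuE// [LHS]integral_mkcond; apply: eq_integral => y _.
by rewrite /patch indicE; case: ifPn => yA; rewrite ?mul1e ?mul0e.
Qed.

Lemma integral_normal_prob (R : realType) (s : R) (f : R -> R) :
  measurable_fun setT f -> (forall x, 0 <= f x) ->
  (\int[normal_prob 0 s]_x (f x)%:E = \int[mu]_x (f x * normal_pdf 0 s x)%:E)%E.
Proof.
move=> mf f0; apply: (@integral_density _ (measurableTypeR R)) => //.
- exact: measurable_normal_pdf.
- exact: normal_pdf_ge0.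
Qed.

Lemma normal_pdf_scale (R : realType) (s x : R) : 0 < s ->
  normal_pdf 0 s (s * x) * s = normal_pdf 0 1 x.
Proof.
move=> s0; have sn0 : s != 0 by rewrite gt_eqF.
rewrite (normal_pdfE _ sn0) (normal_pdfE _ (oner_neq0 R)) /normal_fun !subr0.
rewrite /normal_peak expr1n mul1r mulrAC; congr (_ * expR _).
  rewrite -mulrnAr sqrtrM ?sqr_ge0// sqrtr_sqr gtr0_norm// invfM.
  by rewrite mulrAC mulVf// mul1r.
by field; rewrite sn0.
Qed.

(** Substitution by a dilation. It refers every Brownian increment to one standard normal law, so
    that only moments of that law have to be discussed. *)
Lemma normal_prob_scale (R : realType) (s : R) (f : R -> R) : 0 < s ->
  continuous f -> (forall x, 0 <= f x) ->
  (\int[normal_prob 0 s]_x (f x)%:E = \int[normal_prob 0 1]_x (f (s * x))%:E)%E.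
Proof.
move=> s0 cf f0; have mf := continuous_measurable_fun cf.
have cfs : continuous (fun x => f (s * x)).
  by move=> x; apply: (@continuous_comp _ _ _ (fun x => s * x) f); [exact: mulrl_continuous|exact: cf].
rewrite (integral_normal_prob s mf f0).
rewrite (integral_normal_prob 1 (continuous_measurable_fun cfs) (fun x => f0 (s * x))).
have F'E : (fun x : R => s * x)^`()%classic = cst s.
  by apply/funext => x; rewrite derive1E deriveM// derive_cst derive_id scaler0 addr0 scaler1.
rewrite (@increasing_ge0_integration_by_substitutionT _ (fun x => s * x) (fun x => f x * normal_pdf 0 s x)).
- apply: eq_integral => x _; congr (_%:E).
  by rewrite F'E /= fctE -mulrA normal_pdf_scale.
- by move=> x y xy; rewrite ltr_pM2l.
- by rewrite F'E; exact: cst_continuous.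
- by rewrite F'E; exact: is_cvg_cst.
- by rewrite F'E; exact: is_cvg_cst.
- by move=> x; apply: derivableM.
- by apply/gt0_cvgMrNy => //; exact: cvg_id.
- by apply/gt0_cvgMry => //; exact: cvg_id.
- move=> x; apply: cvgM; first exact: cf.
  by apply: continuous_normal_pdf; rewrite gt_eqF.
- by move=> x; rewrite mulr_ge0// normal_pdf_ge0.
Qed.

(** The integrand is dominated by a multiple of the normal density of variance 2: with y = x^2/4,
    the claim is y exp(-2y) <= exp(-y), which holds because y <= exp(y). The factor 4 in the
    constant comes from x^2 = 4y. *)
Lemma normal_moment2_fin (R : realType) :
  (\int[normal_prob (0 : R) 1]_x (x ^+ 2)%:E < +oo)%E.
Proof.
have cs : continuous (fun x : R => x ^+ 2) by exact: sqr_continuous.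
rewrite (integral_normal_prob 1 (continuous_measurable_fun cs) (@sqr_ge0 R)).
pose q : R := Num.sqrt 2.
have q0 : q != 0 by rewrite gt_eqF// sqrtr_gt0 ltr0n.
have [k [k0 hk]] : exists k : R, 0 <= k /\ forall x : R, x ^+ 2 * normal_pdf 0 1 x <= k * normal_pdf 0 q x.
  exists (4 * normal_peak 1 / normal_peak q); split.
    by rewrite !mulr_ge0 ?invr_ge0 ?normal_peak_ge0.
  move=> x; rewrite (normal_pdfE _ q0) (normal_pdfE _ (oner_neq0 R)).
  have pq : normal_peak q != 0 by rewrite gt_eqF// normal_peak_gt0.
  have -> (a b c : R) : b != 0 -> 4 * a / b * (b * c) = a * (4 * c) by move=> b0; field.
  rewrite mulrCA ler_wpM2l ?normal_peak_ge0//.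
  rewrite /normal_fun !subr0 expr1n (@sqr_sqrtr R 2) ?ler0n//.
  set y := x ^+ 2 / 4.
  have -> : - x ^+ 2 / (1 *+ 2) = - y - y by rewrite /y; field.
  have -> : - x ^+ 2 / (2 *+ 2) = - y by rewrite /y; field.
  have -> : x ^+ 2 = 4 * y by rewrite /y; field.
  rewrite expRD mulrA ler_pM2r ?expR_gt0// -mulrA ler_piMr ?ler0n//.
  rewrite expRN ler_pdivrMr ?expR_gt0// mul1r.
  by apply: le_trans (expR_ge1Dx y); rewrite lerDr.
  exact: pq.
apply: (@le_lt_trans _ _ (\int[mu]_x (k%:E * (normal_pdf 0 q x)%:E))%E).
  apply: ge0_le_integral => //.
  - by move=> x _; rewrite lee_fin mulr_ge0 ?sqr_ge0 ?normal_pdf_ge0.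
  - apply/measurable_EFinP; apply: measurable_funM; last exact: measurable_normal_pdf.
    exact: continuous_measurable_fun.
  - apply/measurable_EFinP; apply: measurable_funM => //; exact: measurable_normal_pdf.
  - by move=> x _; rewrite -EFinM lee_fin.
rewrite ge0_integralZl//; first by rewrite integral_normal_pdf mule1 ltry.
- by apply/measurable_EFinP; exact: measurable_normal_pdf.
- by move=> x _; rewrite lee_fin normal_pdf_ge0.
Qed.

(* Since the first moment is finite, this says that the mean is 0. *)
Lemma normal_prob_abs (R : realType) :
  (\int[normal_prob (0 : R) 1]_x `|x|%:E =
   2%:E * \int[normal_prob (0 : R) 1]_x (Num.max x 0)%:E)%E.
Proof.
have ca : continuous (fun x : R => `|x|) by move=> x; exact: norm_continuous.
have cm : continuous (fun x : R => Num.max x 0).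
  by move=> x; apply: continuous_max; [exact: cvg_id|exact: cvg_cst].
have cp : continuous (normal_pdf (0 : R) 1).
  by apply: continuous_normal_pdf; exact: oner_neq0.
rewrite (integral_normal_prob 1 (continuous_measurable_fun ca) (@normr_ge0 _ _)).
rewrite (integral_normal_prob 1 (continuous_measurable_fun cm)); last first.
  by move=> x; rewrite le_max lexx orbT.
rewrite ge0_symfun_integralT.
- congr (_ * _)%E; rewrite -set_itvcy integral_mkcond; apply: eq_integral => x _.
  rewrite /patch; case: ifPn.
    by rewrite inE/= in_itv/= andbT => x0; rewrite ger0_norm// max_l.
  rewrite notin_setE/= in_itv/= andbT => /negP; rewrite -ltNge => x0.
  by rewrite max_r ?ltW// mul0r.
- by move=> x; rewrite mulr_ge0 ?normal_pdf_ge0.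
- by move=> x; apply: cvgM; [exact: ca|exact: cp].
- move=> x; rewrite /= normrN; congr (_ * _).
  by rewrite !normal_pdfE ?oner_neq0// /normal_fun !subr0 sqrrN.
Qed.

(** The joint law agrees with the product of the marginal laws on rectangles, hence everywhere;
    Tonelli then separates the two factors. *)
Lemma indep_integralM_mfun d (T : measurableType d) (R : realType)
    (P : probability T R) (X Z : {mfun T >-> R}) (f g : R -> R) :
  (forall A B, measurable A -> measurable B ->
     P (X @^-1` A `&` Z @^-1` B) = P (X @^-1` A) * P (Z @^-1` B))%E ->
  measurable_fun setT f -> measurable_fun setT g ->
  (forall x, 0 <= f x) -> (forall x, 0 <= g x) ->
  (\int[P]_w (f (X w) * g (Z w))%:E =
   (\int[P]_w (f (X w))%:E) * (\int[P]_w (g (Z w))%:E))%E.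
Proof.
move=> ind mf mg f0 g0.
have mXZ : measurable_fun setT (fun w => (X w, Z w)) by exact: measurable_fun_pair.
pose XZ : {mfun T >-> (R * R)%type} := HB.pack (fun w => (X w, Z w)) (isMeasurableFun.Build _ _ _ _ _ mXZ).
have mfx : measurable_fun setT (fun z : R * R => (f z.1)%:E).
  by apply/measurable_EFinP; apply: measurableT_comp.
have mgx : measurable_fun setT (fun z : R * R => (g z.2)%:E).
  by apply/measurable_EFinP; apply: measurableT_comp.
have mfg : measurable_fun setT (fun z : R * R => ((f z.1)%:E * (g z.2)%:E)%E).
  exact: emeasurable_funM.
transitivity (\int[distribution P XZ]_z ((f z.1)%:E * (g z.2)%:E))%E.
  rewrite ge0_integral_distribution//.
  by move=> z; rewrite mule_ge0 ?lee_fin.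
transitivity (\int[(distribution P X \x distribution P Z)%E]_z ((f z.1)%:E * (g z.2)%:E))%E.
  apply: eq_measure_integral => A mA _; apply/esym.
  by apply: product_measure_unique.
rewrite fubini_tonelli1//; last by move=> z; rewrite mule_ge0 ?lee_fin.
rewrite /fubini_F/=.
under eq_integral => x _.
  rewrite ge0_integralZl ?lee_fin//; last 2 first.
  - exact/measurable_EFinP.
  - by move=> y _; rewrite lee_fin.
  over.
rewrite ge0_integralZr//; last 3 first.
- exact/measurable_EFinP.
- by move=> y _; rewrite lee_fin.
- by apply: integral_ge0 => y _; rewrite lee_fin.
congr (_ * _)%E; rewrite ge0_integral_distribution//; exact/measurable_EFinP.
Qed.

Lemma indep_integralM d (T : measurableType d) (R : realType)
    (P : probability T R) (X Z : T -> R) (f g : R -> R) :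
  measurable_fun setT X -> measurable_fun setT Z ->
  (forall A B, measurable A -> measurable B ->
     P (X @^-1` A `&` Z @^-1` B) = P (X @^-1` A) * P (Z @^-1` B))%E ->
  measurable_fun setT f -> measurable_fun setT g ->
  (forall x, 0 <= f x) -> (forall x, 0 <= g x) ->
  (\int[P]_w (f (X w) * g (Z w))%:E =
   (\int[P]_w (f (X w))%:E) * (\int[P]_w (g (Z w))%:E))%E.
Proof.
move=> mX mZ.
pose X' : {mfun T >-> R} := HB.pack X (isMeasurableFun.Build _ _ _ _ _ mX).
pose Z' : {mfun T >-> R} := HB.pack Z (isMeasurableFun.Build _ _ _ _ _ mZ).
exact: (@indep_integralM_mfun _ _ _ P X' Z').
Qed.

(** * Integrable and square-integrable random variables *)

Definition L1 d (T : measurableType d) (R : realType) (P : probability T R)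
  (X : T -> R) := P.-integrable setT (EFin \o X).
Definition L2 d (T : measurableType d) (R : realType) (P : probability T R)
  (X : T -> R) := measurable_fun setT X /\ L1 P (fun w => X w ^+ 2).
Definition Ex d (T : measurableType d) (R : realType) (P : probability T R)
  (X : T -> R) : R := Rintegral P setT X.

Lemma L1_meas d (T : measurableType d) (R : realType) (P : probability T R) (X : T -> R) :
  L1 P X -> measurable_fun setT X.
Proof. by move=> /measurable_int/measurable_EFinP. Qed.

Lemma L1_le d (T : measurableType d) (R : realType) (P : probability T R) (X Y : T -> R) :
  measurable_fun setT X -> L1 P Y -> (forall w, `|X w| <= Y w) -> L1 P X.
Proof.
move=> mX hY hXY; apply: (le_integrable measurableT _ _ hY).
- exact/measurable_EFinP.
- by move=> w _; rewrite /= lee_fin (le_trans (hXY w))// ler_norm.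
Qed.

Lemma L1D d (T : measurableType d) (R : realType) (P : probability T R) (X Y : T -> R) :
  L1 P X -> L1 P Y -> L1 P (fun w => X w + Y w).
Proof. by move=> hX hY; exact: (integrableD measurableT hX hY). Qed.

Lemma L1Z d (T : measurableType d) (R : realType) (P : probability T R) a (X : T -> R) :
  L1 P X -> L1 P (fun w => a * X w).
Proof. by move=> hX; exact: (integrableZl measurableT a hX). Qed.

Lemma L1B d (T : measurableType d) (R : realType) (P : probability T R) (X Y : T -> R) :
  L1 P X -> L1 P Y -> L1 P (fun w => X w - Y w).
Proof. by move=> hX hY; exact: (integrableB measurableT hX hY). Qed.

Lemma L1_cst d (T : measurableType d) (R : realType) (P : probability T R) a :
  L1 P (fun _ => a).
Proof. exact: finite_measure_integrable_cst. Qed.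

Lemma L1_fin d (T : measurableType d) (R : realType) (P : probability T R) (X : T -> R) :
  measurable_fun setT X -> (forall w, 0 <= X w) ->
  (\int[P]_w (X w)%:E < +oo)%E -> L1 P X.
Proof.
move=> mX X0 h; apply/integrableP; split; first exact/measurable_EFinP.
by under eq_integral do rewrite /= ger0_norm//.
Qed.

Lemma L2_mul d (T : measurableType d) (R : realType) (P : probability T R) (X Y : T -> R) :
  L2 P X -> L2 P Y -> L1 P (fun w => X w * Y w).
Proof.
move=> [mX hX] [mY hY]; apply: L1_le (L1D hX hY) _; first exact: measurable_funM.
move=> w; rewrite normrM; have := sqr_ge0 (`|X w| - `|Y w|).
rewrite -(real_normK (num_real (X w))) -(real_normK (num_real (Y w))).
have := mulr_ge0 (normr_ge0 (X w)) (normr_ge0 (Y w)); nra.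
Qed.

Lemma L2_cst d (T : measurableType d) (R : realType) (P : probability T R) a :
  L2 P (fun _ => a).
Proof. by split => //; exact: L1_cst. Qed.

Lemma L2_L1 d (T : measurableType d) (R : realType) (P : probability T R) (X : T -> R) :
  L2 P X -> L1 P X.
Proof.
move=> hX; have := L2_mul hX (L2_cst P 1).
by congr L1; apply/funext => w; rewrite mulr1.
Qed.

Lemma L2D d (T : measurableType d) (R : realType) (P : probability T R) (X Y : T -> R) :
  L2 P X -> L2 P Y -> L2 P (fun w => X w + Y w).
Proof.
move=> hX hY; split; first by apply: measurable_funD; [exact: hX.1|exact: hY.1].
have := L1D (L1D hX.2 hY.2) (L1Z 2 (L2_mul hX hY)).
by congr L1; apply/funext => w; ring.
Qed.

Lemma L2Z d (T : measurableType d) (R : realType) (P : probability T R) a (X : T -> R) :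
  L2 P X -> L2 P (fun w => a * X w).
Proof.
move=> hX; split; first by apply: measurable_funM => //; exact: hX.1.
have := L1Z (a ^+ 2) hX.2; by congr L1; apply/funext => w; ring.
Qed.

Lemma L2B d (T : measurableType d) (R : realType) (P : probability T R) (X Y : T -> R) :
  L2 P X -> L2 P Y -> L2 P (fun w => X w - Y w).
Proof.
move=> hX hY; have := L2D hX (L2Z (-1) hY).
by congr L2; apply/funext => w; rewrite mulN1r.
Qed.

Lemma ExD d (T : measurableType d) (R : realType) (P : probability T R) (X Y : T -> R) :
  L1 P X -> L1 P Y -> Ex P (fun w => X w + Y w) = Ex P X + Ex P Y.
Proof. exact: RintegralD. Qed.

Lemma ExB d (T : measurableType d) (R : realType) (P : probability T R) (X Y : T -> R) :
  L1 P X -> L1 P Y -> Ex P (fun w => X w - Y w) = Ex P X - Ex P Y.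
Proof. exact: RintegralB. Qed.

Lemma ExZ d (T : measurableType d) (R : realType) (P : probability T R) a (X : T -> R) :
  L1 P X -> Ex P (fun w => a * X w) = a * Ex P X.
Proof. exact: RintegralZl. Qed.

Lemma Ex_cst d (T : measurableType d) (R : realType) (P : probability T R) a :
  Ex P (fun _ => a) = a.
Proof. by rewrite /Ex Rintegral_cst//= [X in fine X]probability_setT mulr1. Qed.

Lemma Ex_ge0 d (T : measurableType d) (R : realType) (P : probability T R) (X : T -> R) :
  (forall w, 0 <= X w) -> 0 <= Ex P X.
Proof. by move=> X0; apply: Rintegral_ge0. Qed.

Lemma Ex_le d (T : measurableType d) (R : realType) (P : probability T R) (X Y : T -> R) :
  L1 P X -> L1 P Y -> (forall w, X w <= Y w) -> Ex P X <= Ex P Y.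
Proof. by move=> hX hY h; apply: le_Rintegral. Qed.

Lemma L1_sum d (T : measurableType d) (R : realType) (P : probability T R)
    (I : Type) (r : seq I) (F : I -> T -> R) :
  (forall i, L1 P (F i)) -> L1 P (fun w => \sum_(i <- r) F i w).
Proof.
move=> hF; elim: r => [|i r IH].
  by under eq_fun do rewrite big_nil; exact: L1_cst.
by under eq_fun do rewrite big_cons; exact: L1D.
Qed.

Lemma Ex_sum d (T : measurableType d) (R : realType) (P : probability T R)
    (I : Type) (r : seq I) (F : I -> T -> R) :
  (forall i, L1 P (F i)) ->
  Ex P (fun w => \sum_(i <- r) F i w) = \sum_(i <- r) Ex P (F i).
Proof.
move=> hF; elim: r => [|i r IH].
  by under eq_fun do rewrite big_nil; rewrite big_nil Ex_cst.
under eq_fun do rewrite big_cons.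
by rewrite big_cons ExD ?IH//; exact: L1_sum.
Qed.

Lemma ExE d (T : measurableType d) (R : realType) (P : probability T R) (X : T -> R) :
  L1 P X -> (\int[P]_w (X w)%:E = (Ex P X)%:E)%E.
Proof. by move=> hX; rewrite /Ex /Rintegral fineK//; exact: integrable_fin_num. Qed.

(** The last hypothesis expresses that [Z] has mean 0. The product formula for independent variables
    is available for nonnegative functions, so both factors are split into positive and negative
    parts and the four products cancel in pairs. *)
Lemma indep_Ex_mul0 d (T : measurableType d) (R : realType)
    (P : probability T R) (X Z : T -> R) :
  (forall A B, measurable A -> measurable B ->
     P (X @^-1` A `&` Z @^-1` B) = P (X @^-1` A) * P (Z @^-1` B))%E ->
  L2 P X -> L2 P Z ->
  Ex P (fun w => Num.max (Z w) 0) = Ex P (fun w => Num.max (- Z w) 0) ->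
  Ex P (fun w => X w * Z w) = 0.
Proof.
move=> ind hX hZ sym.
pose fp (x : R) : R := Num.max x 0; pose fn (x : R) : R := Num.max (- x) 0.
have mfp : measurable_fun setT fp by exact: measurable_funrpos.
have mfn : measurable_fun setT fn by exact: measurable_funrneg.
have fp0 x : 0 <= fp x by rewrite le_max lexx orbT.
have fn0 x : 0 <= fn x by rewrite le_max lexx orbT.
have fB x : x = fp x - fn x.
  rewrite /fp /fn; case: (leP 0 x) => x0.
    by rewrite max_r ?subr0// oppr_le0.
  by rewrite max_l ?oppr_ge0 ?ltW// sub0r opprK.
have fpa x : fp x ^+ 2 <= x ^+ 2.
  rewrite /fp; case: (leP 0 x) => // x0; first by rewrite expr0n sqr_ge0.
have fna x : fn x ^+ 2 <= x ^+ 2.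
  rewrite -(sqrrN x) /fn; case: (leP 0 (- x)) => // x0; first by rewrite expr0n sqr_ge0.
have L2f (f : R -> R) (Y : T -> R) : measurable_fun setT f -> (forall x, f x ^+ 2 <= x ^+ 2) -> L2 P Y -> L2 P (f \o Y).
  move=> mf hf [mY hY]; have mfY : measurable_fun setT (f \o Y) by exact: measurableT_comp.
  split => //; apply: L1_le hY _; first exact: measurable_funX.
  by move=> w; rewrite ger0_norm ?sqr_ge0// hf.
have ExM (f g : R -> R) : measurable_fun setT f -> (forall x, f x ^+ 2 <= x ^+ 2) -> (forall x, 0 <= f x) ->
    measurable_fun setT g -> (forall x, g x ^+ 2 <= x ^+ 2) -> (forall x, 0 <= g x) ->
    Ex P (fun w => f (X w) * g (Z w)) = Ex P (f \o X) * Ex P (g \o Z).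
  move=> mf hf f0 mg hg g0; rewrite /Ex /Rintegral.
  rewrite (indep_integralM hX.1 hZ.1 ind mf mg f0 g0) fineM//.
  - by rewrite (ExE (L2_L1 (L2f _ _ mf hf hX))).
  - by rewrite (ExE (L2_L1 (L2f _ _ mg hg hZ))).
have Xp := L2f _ _ mfp fpa hX; have Xn := L2f _ _ mfn fna hX.
have Zp := L2f _ _ mfp fpa hZ; have Zn := L2f _ _ mfn fna hZ.
have sym' : Ex P (fp \o Z) = Ex P (fn \o Z) by exact: sym.
have -> : (fun w => X w * Z w) = (fun w => (fp (X w) * fp (Z w) - fp (X w) * fn (Z w))
    - (fn (X w) * fp (Z w) - fn (X w) * fn (Z w))).
  by apply/funext => w; rewrite {1}(fB (X w)) {1}(fB (Z w)); ring.
have h1 := L2_mul Xp Zp; have h2 := L2_mul Xp Zn.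
have h3 := L2_mul Xn Zp; have h4 := L2_mul Xn Zn.
rewrite (ExB (L1B h1 h2) (L1B h3 h4)) (ExB h1 h2) (ExB h3 h4).
by rewrite !ExM// sym' !subrr.
Qed.

(* Only the finiteness of this second moment is used, not its value 1. *)
Definition gauss2 (R : realType) : R := Ex (normal_prob (0 : R) 1) (fun x => x ^+ 2).

Lemma normal_L2 (R : realType) : L2 (normal_prob (0 : R) 1) (fun x => x).
Proof.
split; first exact: measurable_id.
apply: L1_fin; [exact: measurable_funX|by move=> x; rewrite sqr_ge0|].
exact: normal_moment2_fin.
Qed.

Lemma L1_maxl d (T : measurableType d) (R : realType) (P : probability T R) (X : T -> R) :
  L1 P X -> L1 P (fun w => Num.max (X w) 0).
Proof.
move=> hX; apply: (@L1_le _ _ _ _ _ (fun w => `|X w|)).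
- by apply: measurable_maxr => //; exact: L1_meas hX.
- exact: integrable_abse hX.
- by move=> w; case: (leP 0 (X w)) => x0 //; rewrite normr0.
Qed.

Lemma normal_sym (R : realType) :
  (\int[normal_prob (0 : R) 1]_x (Num.max x 0)%:E =
   \int[normal_prob (0 : R) 1]_x (Num.max (- x) 0)%:E)%E.
Proof.
have h1 := L2_L1 (normal_L2 R).
have hN : L1 (normal_prob (0 : R) 1) (fun x => - x).
  by have := L1Z (-1) h1; congr L1; apply/funext => x; rewrite mulN1r.
have hp := L1_maxl h1; have hn := L1_maxl hN.
have := @normal_prob_abs R.
have -> : (fun x : R => `|x|%:E) = (fun x => (Num.max x 0 + Num.max (- x) 0)%:E).
  apply/funext => x; congr EFin; case: (leP 0 x) => x0.
    by rewrite ger0_norm// (max_r (_ : - x <= 0)) ?addr0// oppr_le0.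
  by rewrite ltr0_norm// (max_l (_ : 0 <= - x)) ?add0r// oppr_ge0 ltW.
rewrite (ExE (L1D hp hn)) (ExD hp hn) (ExE hp) (ExE hn) -EFinM => -[] h.
by congr EFin; lra.
Qed.

(** * Increments and covariance of Brownian motion *)

Lemma ge0_integral_law d d' (T : measurableType d) (S : measurableType d') (R : realType)
    (P : probability T R) (Z : T -> S) (nu : {measure set S -> \bar R}) (f : S -> R) :
  measurable_fun setT Z ->
  (forall E, measurable E -> pushforward P Z E = nu E) ->
  measurable_fun setT f -> (forall x, 0 <= f x) ->
  (\int[P]_w (f (Z w))%:E = \int[nu]_x (f x)%:E)%E.
Proof.
move=> mZ hN mf f0.
pose Z' : {mfun T >-> S} := HB.pack Z (isMeasurableFun.Build _ _ _ _ _ mZ).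
have mEf : measurable_fun setT (EFin \o f) by exact/measurable_EFinP.
transitivity (\int[distribution P Z']_x (f x)%:E)%E.
  by rewrite ge0_integral_distribution// => x; rewrite lee_fin.
by apply: eq_measure_integral => A mA _; exact: hN.
Qed.

Lemma bm_increment_integral d (T : measurableType d) (R : realType)
    (P : probability T R) (W : R -> T -> R) (s t : R) (f : R -> R) :
  brownian_motion P W -> 0 <= s -> s < t -> continuous f -> (forall x, 0 <= f x) ->
  (\int[P]_w (f (W t w - W s w))%:E =
   \int[normal_prob 0 1]_x (f (Num.sqrt (t - s) * x))%:E)%E.
Proof.
move=> [mW _ _ hN _] s0 st cf f0.
have mZ : measurable_fun setT (fun w => W t w - W s w).
  by apply: measurable_funB; apply: mW => //; apply: le_trans s0 _; exact: ltW.
rewrite -normal_prob_scale ?sqrtr_gt0 ?subr_gt0//.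
apply: (@ge0_integral_law _ _ T (measurableTypeR R) R P _ (normal_prob 0 (Num.sqrt (t - s))) f mZ _ _ f0).
- exact: (hN _ _ s0 st).
- exact: continuous_measurable_fun.
Qed.

Lemma bm_increment_L2 d (T : measurableType d) (R : realType)
    (P : probability T R) (W : R -> T -> R) (s t : R) :
  brownian_motion P W -> 0 <= s -> s < t ->
  L2 P (fun w => W t w - W s w) /\
  Ex P (fun w => (W t w - W s w) ^+ 2) = gauss2 R * (t - s).
Proof.
move=> bm s0 st; have [mW _ _ _ _] := bm.
have mZ : measurable_fun setT (fun w => W t w - W s w).
  by apply: measurable_funB; apply: mW => //; apply: le_trans s0 _; exact: ltW.
have e : (\int[P]_w ((W t w - W s w) ^+ 2)%:E = (gauss2 R * (t - s))%:E)%E.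
  have cs : continuous (fun x : R => x ^+ 2) by exact: sqr_continuous.
  rewrite (bm_increment_integral bm s0 st cs (@sqr_ge0 R)).
  under eq_integral do rewrite exprMn sqr_sqrtr ?subr_ge0 ?(ltW st)//.
  have h := (normal_L2 R).2.
  by rewrite (ExE (L1Z (t - s) h)) (ExZ _ h) mulrC.
split; last by rewrite /Ex /Rintegral e.
split => //; apply: L1_fin; [exact: measurable_funX|by move=> w; exact: sqr_ge0|].
by rewrite e ltry.
Qed.

Lemma bm_increment_sym d (T : measurableType d) (R : realType)
    (P : probability T R) (W : R -> T -> R) (s t : R) :
  brownian_motion P W -> 0 <= s -> s < t ->
  Ex P (fun w => Num.max (W t w - W s w) 0) =
  Ex P (fun w => Num.max (- (W t w - W s w)) 0).
Proof.
move=> bm s0 st; rewrite /Ex /Rintegral; congr fine.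
have cp : continuous (fun x : R => Num.max x 0).
  by move=> x; apply: continuous_max; [exact: cvg_id|exact: cvg_cst].
have cn : continuous (fun x : R => Num.max (- x) 0).
  by move=> x; apply: continuous_max; [exact: cvgN|exact: cvg_cst].
have ge (x : R) : 0 <= Num.max x 0 by rewrite le_max lexx orbT.
rewrite (bm_increment_integral bm s0 st cp ge).
rewrite (bm_increment_integral bm s0 st cn (fun x => ge (- x))).
set a := Num.sqrt (t - s); have a0 : 0 <= a by rewrite sqrtr_ge0.
have mcp : measurable_fun setT (fun x : R => (Num.max x 0)%:E).
  by apply/measurable_EFinP; exact: (continuous_measurable_fun cp).
have mcn : measurable_fun setT (fun x : R => (Num.max (- x) 0)%:E).
  by apply/measurable_EFinP; exact: (continuous_measurable_fun cn).
have mx (x : R) : Num.max (a * x) 0 = a * Num.max x 0 by rewrite maxr_pMr// mulr0.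
under eq_integral do rewrite mx EFinM.
under [RHS]eq_integral do rewrite -mulrN mx EFinM.
rewrite !ge0_integralZl ?lee_fin// ?normal_sym//.
- by move=> x _; rewrite lee_fin.
- by move=> x _; rewrite lee_fin.
Qed.

(** Measurability for the natural filtration of [W] at time [s]. Its sigma-algebra is that of the
    independence clause of [brownian_motion], packaged as a measurable type so that the usual
    closure properties of measurable functions apply. *)
Definition adapted d (T : measurableType d) (R : realType) (W : R -> T -> R)
    (s : R) (Y : T -> R) :=
  @measurable_fun _ _
    (g_sigma_algebraType (\bigcup_(k in `[0, s]) preimage_set_system setT (W k) measurable))
    R setT Y.

Lemma adapted_W d (T : measurableType d) (R : realType) (W : R -> T -> R)
    (s t : R) : 0 <= t <= s -> adapted W s (W t).
Proof.
move=> ts _ E mE; apply: sub_gen_smallest; exists t; first by rewrite /= in_itv.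
by exists E.
Qed.

Lemma adapted_cst d (T : measurableType d) (R : realType) (W : R -> T -> R)
    (s : R) (a : R) : adapted W s (fun _ => a).
Proof. exact: measurable_cst. Qed.

Lemma adaptedM d (T : measurableType d) (R : realType) (W : R -> T -> R)
    (s : R) (X Y : T -> R) :
  adapted W s X -> adapted W s Y -> adapted W s (fun w => X w * Y w).
Proof. exact: measurable_funM. Qed.

(** Martingale property in L2 form: the increment is independent of the past and symmetrically
    distributed. *)
Lemma bm_orthogonal d (T : measurableType d) (R : realType)
    (P : probability T R) (W : R -> T -> R) (s t : R) (Y : T -> R) :
  brownian_motion P W -> 0 <= s -> s <= t -> adapted W s Y -> L2 P Y ->
  Ex P (fun w => Y w * (W t w - W s w)) = 0.
Proof.
move=> bm s0; rewrite le_eqVlt => /predU1P[<- _ _|st aY LY].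
  by under eq_fun do rewrite subrr mulr0; rewrite Ex_cst.
apply: indep_Ex_mul0 => //.
- move=> A B mA mB; have [_ _ ind _ _] := bm; apply: (ind _ _ s0 st).
    by have := aY measurableT A mA; rewrite setTI.
  by apply: sub_gen_smallest; exists tt => //; exists B => //; rewrite setTI.
- exact: (bm_increment_L2 bm s0 st).1.
- exact: bm_increment_sym.
Qed.

Lemma bm_start d (T : measurableType d) (R : realType)
    (P : probability T R) (W : R -> T -> R) : brownian_motion P W ->
  L2 P (W 0) /\ Ex P (fun w => W 0 w ^+ 2) = 0.
Proof.
move=> [mW W0 _ _ _]; have m0 := mW 0 (lexx 0).
have e : (\int[P]_w (W 0 w ^+ 2)%:E = 0)%E.
  rewrite (ae_eq_integral (cst 0%E))//; first by rewrite integral_cst// mul0e.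
    by apply/measurable_EFinP; exact: measurable_funX.
  by apply: filterS W0 => w /= -> _; rewrite expr0n.
split; last by rewrite /Ex /Rintegral e.
split => //; apply: L1_fin; [exact: measurable_funX|by move=> w; exact: sqr_ge0|].
by rewrite e ltry.
Qed.

Lemma bm_L2 d (T : measurableType d) (R : realType)
    (P : probability T R) (W : R -> T -> R) (t : R) : brownian_motion P W ->
  0 <= t -> L2 P (W t).
Proof.
move=> bm; rewrite le_eqVlt => /predU1P[<-|t0]; first exact: (bm_start bm).1.
have := L2D (bm_increment_L2 bm (lexx 0) t0).1 (bm_start bm).1.
by congr L2; apply/funext => w; rewrite subrK.
Qed.

Lemma bm_variance d (T : measurableType d) (R : realType)
    (P : probability T R) (W : R -> T -> R) (t : R) : brownian_motion P W ->
  0 <= t -> Ex P (fun w => W t w ^+ 2) = gauss2 R * t.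
Proof.
move=> bm; rewrite le_eqVlt => /predU1P[<-|t0].
  by rewrite (bm_start bm).2 mulr0.
have [h1 h2] := bm_increment_L2 bm (lexx 0) t0.
have [k1 k2] := bm_start bm.
have o : Ex P (fun w => W 0 w * (W t w - W 0 w)) = 0.
  by apply: bm_orthogonal => //; [exact: ltW|apply: adapted_W; rewrite lexx].
have -> : (fun w => W t w ^+ 2) = (fun w => ((W t w - W 0 w) ^+ 2 + W 0 w ^+ 2) +
    2 * (W 0 w * (W t w - W 0 w))) by apply/funext => w; ring.
have h3 := L2_mul k1 h1.
by rewrite (ExD (L1D h1.2 k1.2) (L1Z 2 h3)) (ExD h1.2 k1.2) (ExZ _ h3) h2 k2 o; ring.
Qed.

Lemma bm_covariance d (T : measurableType d) (R : realType)
    (P : probability T R) (W : R -> T -> R) (s t : R) : brownian_motion P W ->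
  0 <= s -> 0 <= t -> Ex P (fun w => W s w * W t w) = gauss2 R * Num.min s t.
Proof.
move=> bm; wlog st : s t / s <= t => [hw s0 t0|s0 t0].
  have [st|/ltW st] := leP s t; first by rewrite hw// min_l.
  by under eq_fun do rewrite mulrC; rewrite hw// min_l.
have ls := bm_L2 bm s0; have lt := bm_L2 bm t0.
have -> : (fun w => W s w * W t w) = (fun w => W s w * (W t w - W s w) + W s w ^+ 2).
  by apply/funext => w; ring.
rewrite (ExD (L2_mul ls (L2B lt ls)) ls.2) bm_variance// bm_orthogonal//.
  by rewrite add0r min_l.
by apply: adapted_W; rewrite s0 lexx.
Qed.

(** * The Wiener integral *)

Lemma Rintegral_sum d (T : measurableType d) (R : realType)
    (m : {measure set T -> \bar R}) (D : set T) (I : eqType) (l : seq I) (F : I -> T -> R) :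
  measurable D -> (forall p, p \in l -> m.-integrable D (EFin \o F p)) ->
  m.-integrable D (EFin \o (fun x => \sum_(p <- l) F p x)) /\
  Rintegral m D (fun x => \sum_(p <- l) F p x) = \sum_(p <- l) Rintegral m D (F p).
Proof.
move=> mD; elim: l => [|p l IH] h.
  have -> : (fun x => \sum_(p <- [::]) F p x) = cst 0.
    by apply/funext => x; rewrite big_nil.
  split; first exact: integrable0.
  by rewrite big_nil Rintegral_cst// mul0r.
have hp := h p (mem_head _ _).
have [h1 h2] := IH (fun q ql => h q (mem_behead (s := p :: l) ql)).
have -> : (fun x => \sum_(p <- (p :: l)) F p x) = fun x => F p x + \sum_(p <- l) F p x.
  by apply/funext => x; rewrite big_cons.
by split; [exact: (integrableD mD hp h1)|rewrite big_cons RintegralD// h2].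
Qed.

Lemma Rintegral_sqr_sum d (T : measurableType d) (R : realType)
    (m : {measure set T -> \bar R}) (D : set T) (I : eqType) (l : seq I) (F : I -> T -> R) :
  measurable D ->
  (forall p q, p \in l -> q \in l -> m.-integrable D (EFin \o (fun x => F p x * F q x))) ->
  Rintegral m D (fun x => (\sum_(p <- l) F p x) ^+ 2) =
  \sum_(p <- l) \sum_(q <- l) Rintegral m D (fun x => F p x * F q x).
Proof.
move=> mD h.
have hp p : p \in l -> m.-integrable D (EFin \o (fun x => \sum_(q <- l) F p x * F q x)).
  by move=> pl; apply: (Rintegral_sum mD _).1 => q ql; exact: h.
have -> : (fun x => (\sum_(p <- l) F p x) ^+ 2) =
    fun x => \sum_(p <- l) \sum_(q <- l) F p x * F q x.
  by apply/funext => x; rewrite expr2 big_distrl/=; apply: eq_bigr => p _; rewrite big_distrr.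
rewrite (Rintegral_sum mD hp).2 big_seq_cond [RHS]big_seq_cond.
apply: eq_bigr => p; rewrite andbT => pl.
by apply: (Rintegral_sum mD _).2 => q ql; exact: h.
Qed.

(* Elementary stochastic integral of the step function [elem_fun l], stopped at [t]. *)
Definition elem_int (T : Type) (R : realType) (W : R -> T -> R) (l : seq (R * R))
    (t : R) (w : T) : R := \sum_(p <- l) p.1 * W (Num.min t p.2) w.
Definition elem_fun (R : realType) (l : seq (R * R)) (x : R) : R :=
  \sum_(p <- l) p.1 * \1_(`[0, p.2[%classic) x.

Definition nneg_times (R : realType) (l : seq (R * R)) := forall p, p \in l -> 0 <= p.2.

Lemma elem_int_cons (T : Type) (R : realType) (W : R -> T -> R) p l t w :
  elem_int W (p :: l) t w = p.1 * W (Num.min t p.2) w + elem_int W l t w.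
Proof. by rewrite /elem_int big_cons. Qed.

Lemma elem_int_L2 d (T : measurableType d) (R : realType)
    (P : probability T R) (W : R -> T -> R) l (t : R) : brownian_motion P W ->
  nneg_times l -> 0 <= t -> L2 P (elem_int W l t).
Proof.
move=> bm; elim: l => [|p l IH] h t0.
  by rewrite /elem_int; under eq_fun do rewrite big_nil; exact: L2_cst.
have -> : elem_int W (p :: l) t = fun w => p.1 * W (Num.min t p.2) w + elem_int W l t w.
  by apply/funext => w; exact: elem_int_cons.
apply: L2D; last by apply: IH => // q ql; apply: h; rewrite in_cons ql orbT.
apply/L2Z/(bm_L2 bm); rewrite le_min t0 h//; exact: mem_head.
Qed.

Lemma elem_int_adapted d (T : measurableType d) (R : realType)
    (W : R -> T -> R) l (s t : R) :
  nneg_times l -> 0 <= s -> s <= t -> adapted W t (elem_int W l s).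
Proof.
move=> + s0 st; elim: l => [|p l IH] h.
  by rewrite /elem_int; under eq_fun do rewrite big_nil; exact: adapted_cst.
have -> : elem_int W (p :: l) s = fun w => p.1 * W (Num.min s p.2) w + elem_int W l s w.
  by apply/funext => w; exact: elem_int_cons.
apply: measurable_funD; last by apply: IH => // q ql; apply: h; rewrite in_cons ql orbT.
apply: adaptedM; first exact: adapted_cst.
by apply: adapted_W; rewrite le_min s0 h ?mem_head//= ge_min st.
Qed.

Lemma elem_int_orthogonal d (T : measurableType d) (R : realType)
    (P : probability T R) (W : R -> T -> R) l (s t : R) Y : brownian_motion P W ->
  nneg_times l -> 0 <= s -> s <= t -> adapted W s Y -> L2 P Y ->
  Ex P (fun w => Y w * (elem_int W l t w - elem_int W l s w)) = 0.
Proof.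
move=> bm + s0 st aY LY; have t0 := le_trans s0 st.
elim: l => [|p l IH] h.
  under eq_fun do rewrite /elem_int !big_nil subrr mulr0.
  exact: Ex_cst.
have hl : nneg_times l by move=> q ql; apply: h; rewrite in_cons ql orbT.
have p0 : 0 <= p.2 by apply: h; exact: mem_head.
have -> : (fun w => Y w * (elem_int W (p :: l) t w - elem_int W (p :: l) s w)) =
  (fun w => p.1 * (Y w * (W (Num.min t p.2) w - W (Num.min s p.2) w)) +
    Y w * (elem_int W l t w - elem_int W l s w)).
  by apply/funext => w; rewrite !elem_int_cons; ring.
have L2W u : 0 <= u -> L2 P (W (Num.min u p.2)).
  by move=> u0; apply: (bm_L2 bm); rewrite le_min u0.
have h1 := L2_mul LY (L2B (L2W _ t0) (L2W _ s0)).
have h2 := L2_mul LY (L2B (elem_int_L2 bm hl t0) (elem_int_L2 bm hl s0)).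
rewrite (ExD (L1Z _ h1) h2) (ExZ _ h1) IH// addr0.
have [ps|/ltW sp] := leP p.2 s.
  rewrite ?(min_r ps) (min_r (le_trans ps st)).
  by under eq_fun do rewrite subrr mulr0; rewrite Ex_cst mulr0.
by rewrite ?(min_l sp) bm_orthogonal ?mulr0// le_min st.
Qed.

Lemma measurable_elem_fun (R : realType) (l : seq (R * R)) :
  measurable_fun setT (elem_fun l).
Proof.
by apply: measurable_sum => p; exact: measurable_funM.
Qed.

(** Both sides are bilinear in the list entries, so it suffices to compare two indicators: the
    covariance of the stopped Brownian values is [gauss2 R] times the minimum of the times, and this
    minimum is the length of the intersection of the intervals. *)
Lemma elem_int_isometry d (T : measurableType d) (R : realType)
    (P : probability T R) (W : R -> T -> R) l (t : R) : brownian_motion P W ->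
  nneg_times l -> 0 <= t ->
  Ex P (fun w => elem_int W l t w ^+ 2) =
  gauss2 R * Rintegral mu `[0, t[ (fun x => elem_fun l x ^+ 2).
Proof.
move=> bm h t0.
pose I (s : R) := `[0, s[%classic : set R.
have mI s : measurable (I s) by exact: measurable_itv.
have muI s : (mu (I s) < +oo)%E.
  by rewrite /I lebesgue_measure_itv/=; case: ifP => _; rewrite ?ltry// -EFinD ltry.
have muIE (s : R) : 0 <= s -> (mu (I s) = s%:E)%E.
  move=> s0; rewrite /I lebesgue_measure_itv/= lte_fin; case: ifPn => [_|].
    by rewrite -EFinD subr0.
  by rewrite -leNgt => s0'; congr EFin; apply/eqP; rewrite eq_le s0 s0'.
have intb (f : R -> R) : measurable_fun setT f -> (exists M : R, forall x, `|f x| <= M) ->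
    mu.-integrable (I t) (EFin \o f).
  move=> mf [M hM]; apply: measurable_bounded_integrable.
  - exact: mI.
  - exact: muI.
  - exact: measurable_funTS.
  - by exists M; split; [exact: num_real|] => y My z _; exact: le_trans (hM z) (ltW My).
pose f2 (p q : R * R) (x : R) := (p.1 * \1_(I p.2) x) * (q.1 * \1_(I q.2) x).
have mf1 (p : R * R) : measurable_fun setT (fun x => p.1 * \1_(I p.2) x).
  by apply: measurable_funM => //; exact: measurable_indic.
have f1b (p : R * R) x : `|p.1 * \1_(I p.2) x| <= `|p.1|.
  rewrite normrM ler_piMr// indicE; by case: (_ \in _); rewrite ?normr1 ?normr0.
have f2i p q : mu.-integrable (I t) (EFin \o f2 p q).
  apply: intb; first exact: measurable_funM.
  by exists (`|p.1| * `|q.1|) => x; rewrite normrM ler_pM.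
have f2E p q : 0 <= p.2 -> 0 <= q.2 -> Rintegral mu (I t) (f2 p q) =
    p.1 * q.1 * Num.min (Num.min t p.2) (Num.min t q.2).
  move=> p0 q0.
  have -> : f2 p q = fun x => p.1 * q.1 * \1_(I p.2 `&` I q.2) x.
    by apply/funext => x; rewrite /f2 indicI /= mulrACA.
  rewrite RintegralZl; last 2 first.
  - exact: mI.
  - apply: intb; first by apply: measurable_indic; apply: measurableI; exact: mI.
    by exists 1 => x; rewrite indicE; case: (_ \in _); rewrite ?normr1 ?normr0.
  congr (_ * _); rewrite /Rintegral integral_indic; last 2 first.
  - exact: mI.
  - by apply: measurableI; exact: mI.
  have -> : I p.2 `&` I q.2 `&` I t = I (Num.min (Num.min t p.2) (Num.min t q.2)).
    apply/seteqP; split => x /=; rewrite /I /= !in_itv/= !lt_min.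
      by move=> [[/andP[-> ->] /andP[_ ->]] /andP[_ ->]].
    by move=> /and3P[-> /andP[-> ->] /andP[_ ->]].
  have m0 : 0 <= Num.min (Num.min t p.2) (Num.min t q.2) by rewrite !le_min t0 p0 q0.
  by rewrite -[RHS]/(fine _%:E); congr fine; exact: muIE.
have L2W p : p \in l -> L2 P (fun w => p.1 * W (Num.min t p.2) w).
  by move=> pl; apply: L2Z; apply: (bm_L2 bm); rewrite le_min t0 h.
rewrite /Ex (Rintegral_sqr_sum (F := fun p w => p.1 * W (Num.min t p.2) w) measurableT); last first.
  by move=> p q pl ql; apply: L2_mul; exact: L2W.
rewrite (@Rintegral_sqr_sum _ _ _ mu (I t) _ l (fun p x => p.1 * \1_(I p.2) x)); last 2 first.
- exact: mI.
- by move=> p q _ _; exact: f2i.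
rewrite big_distrr/= big_seq_cond [RHS]big_seq_cond; apply: eq_bigr => p; rewrite andbT => pl.
rewrite big_distrr/= big_seq_cond [RHS]big_seq_cond; apply: eq_bigr => q; rewrite andbT => ql.
rewrite f2E ?h// -[LHS]/(Ex P _).
have -> : (fun w => (p.1 * W (Num.min t p.2) w) * (q.1 * W (Num.min t q.2) w)) =
    fun w => (p.1 * q.1) * (W (Num.min t p.2) w * W (Num.min t q.2) w).
  by apply/funext => w; ring.
have m0 r : r \in l -> 0 <= Num.min t r.2 by move=> rl; rewrite le_min t0 h.
rewrite ExZ; last by apply: L2_mul; apply: (bm_L2 bm); exact: m0.
by rewrite (bm_covariance bm)// ?m0//; ring.
Qed.

Lemma adapted_measurable d (T : measurableType d) (R : realType)
    (P : probability T R) (W : R -> T -> R) s (Y : T -> R) :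
  brownian_motion P W -> adapted W s Y -> measurable_fun setT Y.
Proof.
move=> [mW _ _ _ _] aY _ E mE; have := aY measurableT E mE; rewrite setTI.
apply: smallest_sub; first exact: sigma_algebra_measurable.
move=> A [k /= k0 [B mB <-]]; apply: mW => //.
by move: k0; rewrite in_itv/= => /andP[].
Qed.

Lemma measurable_exists_norm_ge d (T : measurableType d) (R : realType)
    (X : nat -> T -> R) (N : nat) (e : R) : (forall k, measurable_fun setT (X k)) ->
  measurable [set w | exists2 k, (k <= N)%N & e <= `|X k w|].
Proof.
move=> mX.
have -> : [set w | exists2 k, (k <= N)%N & e <= `|X k w|] =
    \bigcup_(k in [set k | (k <= N)%N]) (X k @^-1` [set x | e <= `|x|]).
  by apply/seteqP; split => w /=; move=> [k h1 h2]; exists k.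
apply: bigcup_measurable => k _; rewrite -[X in measurable X]setTI.
apply: mX => //.
have -> : [set x : R | e <= `|x|] = ~` `]-e, e[%classic.
  by apply/seteqP; split => x /=; rewrite in_itv/= -ltr_norml leNgt => /negP.
by apply: measurableC; exact: measurable_itv.
Qed.

(* [b k] is the indicator of the event that [k] is the first time where [|X k| >= e]. *)
Lemma kolmogorov_ineq d (T : measurableType d) (R : realType)
    (P : probability T R) (W : R -> T -> R) l (tau : nat -> R) N (e : R) :
  brownian_motion P W -> nneg_times l -> 0 <= tau 0%N ->
  {homo tau : i j / (i <= j)%N >-> i <= j} -> 0 < e ->
  (P [set w | exists2 k, (k <= N)%N & (e <= `|elem_int W l (tau k) w|)%R] *
    (e ^+ 2)%:E <= (Ex P (fun w => elem_int W l (tau N) w ^+ 2))%:E)%E.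
Proof.
move=> bm hl tau0 tauM e0.
pose X k := elem_int W l (tau k).
have tau_ge0 k : 0 <= tau k by apply: le_trans tau0 (tauM _ _ _).
have L2X k : L2 P (X k) by exact: elem_int_L2.
pose small (x : R) : R := (`|x| < e)%R%:R.
have msmall : measurable_fun setT small.
  have -> : small = \1_[set x : R | `|x| < e].
    apply/funext => x; rewrite indicE /small; case: (ltP `|x| e) => h.
      by rewrite mem_set.
    by rewrite memNset//= ltNge h.
  apply: measurable_indic.
  have -> : [set x : R | `|x| < e] = `]-e, e[%classic.
    by apply/seteqP; split => x /=; rewrite in_itv/= ltr_norml.
  exact: measurable_itv.
pose g k w := \prod_(j < k) small (X j w).
pose b k w := g k w - g k.+1 w.
have g01 k w : g k w = 0 \/ g k w = 1.
  rewrite /g; elim: k => [|k IH]; first by right; rewrite big_ord0.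
  rewrite big_ord_recr/= /small; case: ltP => _; rewrite ?mulr1 ?mulr0//; by left.
have bE k w : b k w = g k w * (1 - small (X k w)).
  by rewrite /b /g big_ord_recr/= mulrBr mulr1.
have b01 k w : b k w = 0 \/ b k w = 1.
  rewrite bE /small; case: (g01 k w) => ->; rewrite ?mul0r; first by left.
  by case: ltP => _; rewrite ?subrr ?subr0 ?mul1r; [left|right].
have bX k w : e ^+ 2 * b k w <= b k w * X k w ^+ 2.
  rewrite mulrC; have [->|b1] := b01 k w; first by rewrite !mul0r.
  rewrite b1 !mul1r -[leRHS]real_normK ?num_real// ler_sqr ?nnegrE ?(ltW e0)//.
  move: b1; rewrite bE /small; case: ltP => // _; rewrite subrr mulr0 => /eqP.
  by rewrite eq_sym oner_eq0.
have sumb w : \sum_(k < N.+1) b k w = 1 - g N.+1 w.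
  have -> : 1 = g 0%N w by rewrite /g big_ord0.
  elim: N.+1 => [|k IH]; first by rewrite big_ord0 subrr.
  by rewrite big_ord_recr/= IH /b; ring.
have ag k : adapted W (tau k) (fun w => 1 - small (X k w)) /\ adapted W (tau k) (g k).
  have asm j : (j <= k)%N -> adapted W (tau k) (fun w => small (X j w)).
    move=> jk; apply: measurableT_comp => //.
    by apply: elem_int_adapted => //; exact: tauM.
  split.
    by apply: measurable_funB; [exact: adapted_cst|exact: asm].
  have : forall j, (j <= k)%N -> adapted W (tau k) (g j).
    elim=> [|j IH] jk.
      have -> : g 0%N = fun _ => 1 by apply/funext => w; rewrite /g big_ord0.
      exact: adapted_cst.
    have -> : g j.+1 = fun w => g j w * small (X j w).
      by apply/funext => w; rewrite /g big_ord_recr.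
    by apply: adaptedM; [apply: IH; exact: ltnW|apply: asm; exact: ltnW].
  by apply.
have ab k : adapted W (tau k) (b k).
  have -> : b k = fun w => g k w * (1 - small (X k w)) by apply/funext => w; exact: bE.
  by apply: adaptedM; [exact: (ag k).2|exact: (ag k).1].
have mb k : measurable_fun setT (b k) := adapted_measurable bm (ab k).
have abX k : adapted W (tau k) (fun w => b k w * X k w).
  by apply: adaptedM => //; exact: elem_int_adapted.
have bsq k w : b k w ^+ 2 <= 1.
  by have [->|->] := b01 k w; rewrite ?expr0n ?expr1n ?ler01.
have L2bX k : L2 P (fun w => b k w * X k w).
  have mbX : measurable_fun setT (fun w => b k w * X k w).
    by apply: measurable_funM => //; exact: (L2X k).1.
  split => //; apply: L1_le (L2X k).2 _; first exact: measurable_funX.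
  move=> w; rewrite ger0_norm ?sqr_ge0// exprMn ler_piMl ?sqr_ge0//.
have L2b k : L2 P (b k).
  split => //; apply: L1_le (L1_cst P 1) _; first exact: measurable_funX.
  by move=> w; rewrite ger0_norm ?sqr_ge0.
have o k : (k <= N)%N -> Ex P (fun w => b k w * X k w * (X N w - X k w)) = 0.
  by move=> kN; apply: elem_int_orthogonal => //; exact: tauM.
(* On the event of first passage at [k], the square of [X N] is expanded around [X k] and the square
   of the difference is discarded. The cross terms have expectation 0, since everything up to [k] is
   adapted. *)
have key w : e ^+ 2 * (\sum_(k < N.+1) b k w) +
    2 * \sum_(k < N.+1) b k w * X k w * (X N w - X k w) <= X N w ^+ 2.
  have : \sum_(k < N.+1) b k w * X N w ^+ 2 <= X N w ^+ 2.
    rewrite -big_distrl/= ler_piMl ?sqr_ge0// sumb.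
    by case: (g01 N.+1 w) => ->; rewrite ?subr0 ?subrr.
  apply: le_trans; rewrite !big_distrr/= -big_split/=; apply: ler_sum => k _.
  apply: le_trans (_ : b k w * X k w ^+ 2 + 2 * (b k w * X k w * (X N w - X k w)) <= _).
    by rewrite lerD2r bX.
  have b0 : 0 <= b k w by have [->|->] := b01 k w.
  have := mulr_ge0 b0 (sqr_ge0 (X N w - X k w)); nra.
have L1s : L1 P (fun w => \sum_(k < N.+1) b k w).
  by apply: L1_sum => k; exact: L2_L1.
have L1o (k : 'I_N.+1) : L1 P (fun w => b k w * X k w * (X N w - X k w)).
  by apply: L2_mul => //; exact: L2B.
have L1so : L1 P (fun w => \sum_(k < N.+1) b k w * X k w * (X N w - X k w)).
  exact: L1_sum.
have := Ex_le (L1D (L1Z (e ^+ 2) L1s) (L1Z 2 L1so)) (L2X N).2 key.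
rewrite (ExD (L1Z (e ^+ 2) L1s) (L1Z 2 L1so)) (ExZ _ L1s) (ExZ _ L1so) (Ex_sum _ L1o).
rewrite [X in 2 * X]big1 ?mulr0 ?addr0 => [|k _]; last by apply: o; rewrite -ltnS.
rewrite -lee_fin; apply: le_trans; rewrite [X in (_ <= X)%E]EFinM muleC.
apply: lee_wpmul2l; first by rewrite lee_fin sqr_ge0.
rewrite -(ExE L1s).
have mE : measurable [set w | exists2 k, (k <= N)%N & e <= `|X k w|].
  by apply: measurable_exists_norm_ge => k; exact: (L2X k).1.
rewrite -[X in P X]setIT -integral_indic//; apply: ge0_le_integral => //.
- by apply/measurable_EFinP; apply: measurable_indic.
- by apply/measurable_EFinP; exact: L1_meas L1s.
move=> w _; rewrite lee_fin sumb indicE; case: (boolP (w \in _)) => [|_].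
  rewrite inE /= => -[k kN ek].
  rewrite /g (bigD1 (Ordinal (kN : (k < N.+1)%N)))//= {1}/small ltNge ek mul0r subr0//.
by case: (g01 N.+1 w) => ->; rewrite ?subr0 ?subrr.
Qed.

(** States, noise and coefficients matter on nonnegative times only. Extending them by their value
    at 0 gives globally continuous functions, for which primitives, derivatives and measurability
    need no restriction to a domain. *)
Lemma within_continuous_posmax (R : realType) (V : topologicalType) (f : R -> V) :
  {within `[0, +oo[, continuous f} -> continuous (fun t : R => f (Num.max t 0)).
Proof.
move=> /subspace_continuousP cf t U hU.
have A0 : `[0, +oo[%classic (Num.max t 0) by rewrite /= in_itv/= andbT le_max lexx orbT.
have h : nbhs (Num.max t 0) [set s | `[0, +oo[%classic s -> U (f s)] := cf _ A0 U hU.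
have cm : (fun t : R => Num.max t 0) @ t --> Num.max t 0.
  by apply: continuous_max; [exact: cvg_id|exact: cvg_cst].
apply: (@filterS _ (nbhs t) _ _ _ _ (cm _ h)) => s hs; apply: hs.
by rewrite /= in_itv/= andbT le_max lexx orbT.
Qed.

(** Uniform continuity on a segment, by compactness; the second point [y] may leave the segment, so
    a mesh does not have to be fitted to its ends. *)
Lemma heine (R : realType) (f : R -> R) (a b e : R) : continuous f -> 0 < e ->
  exists N : nat, forall x, a <= x <= b -> forall y, `|y - x| <= N.+1%:R^-1 ->
    `|f y - f x| <= e.
Proof.
move=> cf e0.
have [N _ hN] : \forall N \near \oo,
    `[a, b]%classic `<=` (fun x => forall y, `|y - x| <= N.+1%:R^-1 -> `|f y - f x| <= e).
  apply: (iffLR (compact_near_coveringP _) (@segment_compact R a b)) => x _.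
  have e2 : 0 < e / 2 by rewrite divr_gt0.
  have := cf x => /cvgrPdist_le/(_ _ e2)/nbhs_ballP[r /= r0 hr].
  exists (ball x (r / 2), [set N | N.+1%:R^-1 < r / 2]).
    split; first by apply: nbhsx_ballx; rewrite divr_gt0.
    have r2 : 0 < r / 2 by rewrite divr_gt0.
    exact: (near_infty_natSinv_lt (PosNum r2)).
  move=> [x' N] /= [xx' hN] y yx'.
  have h1 : `|f x - f x'| <= e / 2.
    by apply: hr; apply: lt_trans xx' _; rewrite ltr_pdivrMr// ltr_pMr// ltr1n.
  have h2 : `|f x - f y| <= e / 2.
    apply: hr; have xx : `|x - x'| < r / 2 := xx'.
    rewrite /ball/=; rewrite (_ : x - y = (x - x') - (y - x')); last by ring.
    apply: le_lt_trans (ler_normB _ _) _; rewrite [ltRHS](splitr r).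
    by apply: ltrD => //; exact: le_lt_trans hN.
  rewrite (_ : f y - f x' = (f x - f x') - (f x - f y)); last by ring.
  by apply: le_trans (ler_normB _ _) _; rewrite [leRHS](splitr e) lerD.
by exists N => x xab; apply: (hN N (leqnn N)); rewrite /= in_itv.
Qed.

(** The explicit tail bound is the point: it does not depend on the sequence, so it becomes uniform
    in time when applied to [u] depending on [t]. *)
Lemma geometric_cvg (R : realType) (u : nat -> R) (J : nat) :
  (forall j, (J <= j)%N -> `|u j.+1 - u j| <= 2^-1 ^+ j) ->
  cvgn u /\ forall j, (J <= j)%N -> `|limn u - u j| <= 2 * 2^-1 ^+ j.
Proof.
move=> h; have hd j : (J <= j)%N -> - 2^-1 ^+ j <= u j.+1 - u j <= 2^-1 ^+ j.
  by move=> /h; rewrite ler_norml.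
have hk j k : (J <= j)%N -> `|u (j + k)%N - u j| <= 2 * 2^-1 ^+ j - 2 * 2^-1 ^+ (j + k).
  move=> Jj; elim: k => [|k IH]; first by rewrite addn0 !subrr normr0.
  rewrite addnS (_ : u (j + k).+1 - u j = (u (j + k).+1 - u (j + k)%N) + (u (j + k)%N - u j)); last by ring.
  apply: le_trans (ler_normD _ _) _.
  have := h _ (leq_trans Jj (leq_addr k j)); move: IH; rewrite exprS; lra.
have e0 j : 0 <= (2^-1 : R) ^+ j by rewrite exprn_ge0// invr_ge0.
have cu : cvgn u.
  (* Adding a correction that increases by exactly the permitted step size makes the sequence
     nondecreasing and bounded. *)
  have cv : cvgn (fun k => u (J + k)%N + 2 * (1 - 2^-1 ^+ (J + k))).
    apply: nondecreasing_is_cvgn.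
      apply/nondecreasing_seqP => i.
      have /andP[h1 _] := hd _ (leq_addr i J).
      by move: h1; rewrite !addnS/= exprS; lra.
    exists (u J + 2 + 2) => _ [k _ <-].
    have := hk J k (leqnn J); rewrite ler_norml => /andP[_].
    have : (2^-1 : R) ^+ J <= 1 by rewrite exprn_ile1// invr_le1 ?unitfE// ler1n.
    by have := e0 (J + k)%N; lra.
  have c2 : (fun k => 2 * (1 - (2^-1 : R) ^+ (J + k))) @ \oo --> (2 * (1 - 0) : R).
    apply: cvgM; first exact: cvg_cst.
    apply: cvgB; first exact: cvg_cst.
    rewrite (_ : (fun k => _) = (fun k => (2^-1 : R) ^+ (k + J))); last first.
      by apply/funext => k; rewrite addnC.
    rewrite (cvg_shiftn J (fun k => (2^-1 : R) ^+ k)).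
    by apply: cvg_expr; rewrite ger0_norm ?invr_ge0// invf_lt1// ltr1n.
  have : cvgn (fun k => u (J + k)%N).
    rewrite (_ : (fun k => u (J + k)%N) = (fun k => u (J + k)%N + 2 * (1 - 2^-1 ^+ (J + k)) -
      2 * (1 - 2^-1 ^+ (J + k)))); last by apply/funext => k; rewrite addrK.
    by apply: is_cvgB => //; exact: (cvgP _ c2).
  rewrite (_ : (fun k => _) = (fun k => u (k + J)%N)).
    by move/cvg_ex => [a]; rewrite (cvg_shiftn J u) => /cvgP.
  by apply/funext => k; rewrite addnC.
split => // j Jj.
have cn : (fun k => `|u (j + k)%N - u j|) @ \oo --> `|limn u - u j|.
  apply: cvg_norm; apply: cvgB; last exact: cvg_cst.
  rewrite (_ : (fun k => _) = (fun k => u (k + j)%N)); first by rewrite (cvg_shiftn j u).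
  by apply/funext => k; rewrite addnC.
rewrite -(cvg_lim _ cn)//; apply: limr_le; first exact: (cvgP _ cn).
near=> k; apply: le_trans (hk j k Jj) _; have := e0 (j + k)%N; lra.
Unshelve. all: by end_near. Qed.

(** A violation at [t] persists near [t] by continuity, while truncating [t] to a fine dyadic grid
    gives a grid point that is near [t] and lies below it, hence in the range. *)
Lemma dyadic_dense (R : realType) (f : R -> R) (K : nat) (e : R) : continuous f ->
  (forall q l : nat, (l <= K * 2 ^ q)%N -> `|f (l%:R / 2 ^+ q)| <= e) ->
  forall t, 0 <= t <= K%:R -> `|f t| <= e.
Proof.
move=> cf h t /andP[t0 tK]; rewrite leNgt; apply/negP => et.
have := cf t => /cvgrPdist_lt/(_ (`|f t| - e)); rewrite subr_gt0 => /(_ et).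
move=> /nbhs_ballP[r /= r0 hr].
have [q hq] : exists q : nat, (2^-1 : R) ^+ q < r.
  have c : (fun k => (2^-1 : R) ^+ k) @ \oo --> (0 : R).
    by apply: cvg_expr; rewrite ger0_norm ?invr_ge0// invf_lt1// ltr1n.
  have := c => /cvgrPdist_lt/(_ _ r0)[q _ hq].
  by exists q; have := hq q (leqnn q); rewrite /= sub0r normrN ger0_norm.
pose l := Num.truncn (t * 2 ^+ q).
have q0 : 0 < (2 : R) ^+ q by rewrite exprn_gt0.
have /truncn_itv/andP[l1 l2] : 0 <= t * 2 ^+ q by rewrite mulr_ge0// ltW.
have lK : (l <= K * 2 ^ q)%N.
  rewrite -(ler_nat R) natrM natrX; apply: le_trans l1 _.
  by rewrite ler_wpM2r// ltW.
have d : `|t - l%:R / 2 ^+ q| < r.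
  rewrite ger0_norm; last by rewrite subr_ge0 ler_pdivrMr.
  apply: le_lt_trans hq; rewrite exprVn lerBlDr -(ler_pM2r q0).
  rewrite mulrDl mulVf ?gt_eqF// divfK ?gt_eqF// addrC natr1.
  exact: ltW.
have h1 := hr _ d; have h2 := h q l lK.
have : `|f t| <= `|f t - f (l%:R / 2 ^+ q)| + `|f (l%:R / 2 ^+ q)|.
  by apply: le_trans (ler_normD _ _); rewrite subrK.
by move: h1 h2; rewrite /=; lra.
Qed.

(** Left-endpoint step approximation of [g] with mesh [h]. The indicator of the cell from kh to
    (k+1)h is the difference of two indicators starting at 0, hence two list entries per cell. *)
Definition steps (R : realType) (g : R -> R) (h : R) (n : nat) : seq (R * R) :=
  flatten [seq [:: (g (k%:R * h), k.+1%:R * h); (- g (k%:R * h), k%:R * h)] | k <- iota 0 n].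
Definition neg_steps (R : realType) (l : seq (R * R)) : seq (R * R) :=
  [seq (- p.1, p.2) | p <- l].

Lemma steps_recr (R : realType) (g : R -> R) (h : R) (n : nat) :
  steps g h n.+1 = steps g h n ++
    [:: (g (n%:R * h), n.+1%:R * h); (- g (n%:R * h), n%:R * h)].
Proof. by rewrite /steps -[in LHS]addn1 iotaD map_cat flatten_cat. Qed.

Lemma nneg_steps (R : realType) (g : R -> R) (h : R) (n : nat) :
  0 <= h -> nneg_times (steps g h n).
Proof.
move=> h0; elim: n => [//|n IH] p; rewrite steps_recr mem_cat => /orP[/IH//|].
by rewrite !inE => /orP[/eqP->|/eqP->] /=; rewrite mulr_ge0.
Qed.

Lemma nneg_neg_steps (R : realType) (l : seq (R * R)) :
  nneg_times l -> nneg_times (neg_steps l).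
Proof. by move=> h p /mapP[q /h q0 ->]. Qed.

Lemma nneg_cat (R : realType) (l1 l2 : seq (R * R)) :
  nneg_times l1 -> nneg_times l2 -> nneg_times (l1 ++ l2).
Proof. by move=> h1 h2 p; rewrite mem_cat => /orP[/h1|/h2]. Qed.

Lemma elem_int_cat (T : Type) (R : realType) (W : R -> T -> R) l1 l2 t w :
  elem_int W (l1 ++ l2) t w = elem_int W l1 t w + elem_int W l2 t w.
Proof. by rewrite /elem_int big_cat. Qed.

Lemma elem_int_neg (T : Type) (R : realType) (W : R -> T -> R) l t w :
  elem_int W (neg_steps l) t w = - elem_int W l t w.
Proof.
by rewrite /elem_int big_map -sumrN; apply: eq_bigr => p _ /=; rewrite mulNr.
Qed.

Lemma elem_fun_cat (R : realType) (l1 l2 : seq (R * R)) x :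
  elem_fun (l1 ++ l2) x = elem_fun l1 x + elem_fun l2 x.
Proof. by rewrite /elem_fun big_cat. Qed.

Lemma elem_fun_neg (R : realType) (l : seq (R * R)) x :
  elem_fun (neg_steps l) x = - elem_fun l x.
Proof.
by rewrite /elem_fun big_map -sumrN; apply: eq_bigr => p _ /=; rewrite mulNr.
Qed.

Lemma elem_int_steps (T : Type) (R : realType) (W : R -> T -> R) g h n t w :
  elem_int W (steps g h n) t w = \sum_(k < n) (W (Num.min t (k.+1%:R * h)) w
    - W (Num.min t (k%:R * h)) w) * g (k%:R * h).
Proof.
elim: n => [|n IH]; first by rewrite big_ord0 /elem_int big_nil.
rewrite steps_recr elem_int_cat IH big_ord_recr /= /elem_int !big_cons big_nil/=.
by ring.
Qed.

Lemma elem_fun_steps_ge (R : realType) (g : R -> R) (h : R) (n : nat) x :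
  0 <= h -> n%:R * h <= x -> elem_fun (steps g h n) x = 0.
Proof.
move=> h0; elim: n => [|n IH] hx; first by rewrite /elem_fun big_nil.
have hn : n%:R * h <= x by apply: le_trans hx; rewrite ler_wpM2r// ler_nat.
rewrite steps_recr elem_fun_cat IH// add0r /elem_fun !big_cons big_nil/= !indicE.
rewrite !memNset ?mulr0 ?addr0//= in_itv/= => /andP[_]; rewrite ltNge ?hx ?hn//.
Qed.

Lemma elem_fun_steps (R : realType) (g : R -> R) (h : R) (n : nat) x :
  0 <= h -> 0 <= x -> x < n%:R * h -> exists k : nat, [/\ (k < n)%N,
    k%:R * h <= x < k.+1%:R * h & elem_fun (steps g h n) x = g (k%:R * h)].
Proof.
move=> h0 x0; elim: n => [|n IH] hx.
  by move: hx; rewrite mul0r ltNge x0.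
have [hn|hn] := ltP x (n%:R * h).
  have [k [kn kx e]] := IH hn; exists k; split => //; first exact: ltnW.
  rewrite steps_recr elem_fun_cat e /elem_fun !big_cons big_nil/= !indicE.
  by rewrite !mem_set/= ?in_itv/= ?x0 ?hx ?hn// !mulr1 addr0 subrr addr0.
exists n; split => //; first by rewrite hn hx.
rewrite steps_recr elem_fun_cat elem_fun_steps_ge// add0r /elem_fun !big_cons big_nil/= !indicE.
rewrite mem_set/= ?in_itv/= ?x0 ?hx// memNset/= ?in_itv/= ?x0 /=; last first.
  by rewrite ltNge hn.
by rewrite mulr1 mulr0 !addr0.
Qed.

Lemma gauss2_ge0 (R : realType) : 0 <= gauss2 R.
Proof. by apply: Ex_ge0 => x; exact: sqr_ge0. Qed.

Lemma elem_int_le d (T : measurableType d) (R : realType)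
    (P : probability T R) (W : R -> T -> R) l (t : R) (phi : R -> R) : brownian_motion P W ->
  nneg_times l -> 0 <= t -> mu.-integrable `[0, t[ (EFin \o phi) ->
  (forall x, 0 <= x < t -> elem_fun l x ^+ 2 <= phi x) ->
  Ex P (fun w => elem_int W l t w ^+ 2) <= gauss2 R * Rintegral mu `[0, t[ phi.
Proof.
move=> bm hl t0 hphi he; rewrite (elem_int_isometry bm hl t0) ler_wpM2l ?gauss2_ge0//.
have mI : measurable (`[0, t[%classic : set R) by exact: measurable_itv.
apply: le_Rintegral => //.
  apply: le_integrable hphi => //.
    apply/measurable_EFinP; apply: measurable_funTS; apply: measurable_funX.
    exact: measurable_elem_fun.
  move=> x /=; rewrite in_itv/= => xt; rewrite lee_fin ger0_norm ?sqr_ge0//.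
  by apply: le_trans (he x xt) _; exact: ler_norm.
Qed.

Lemma elem_int_bound d (T : measurableType d) (R : realType)
    (P : probability T R) (W : R -> T -> R) l (t e : R) : brownian_motion P W ->
  nneg_times l -> 0 <= t -> (forall x, 0 <= x < t -> `|elem_fun l x| <= e) ->
  Ex P (fun w => elem_int W l t w ^+ 2) <= gauss2 R * (e ^+ 2 * t).
Proof.
move=> bm hl t0 he.
have mI : measurable (`[0, t[%classic : set R) by exact: measurable_itv.
have muI : (mu `[0%R, t[ = t%:E)%E.
  rewrite lebesgue_measure_itv/= lte_fin; case: ifPn => [_|].
    by rewrite -EFinD subr0.
  by rewrite -leNgt => t0'; congr EFin; apply/eqP; rewrite eq_le t0 t0'.
have -> : e ^+ 2 * t = Rintegral mu `[0, t[ (fun=> e ^+ 2).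
  by rewrite Rintegral_cst//; congr (_ * _); rewrite -[LHS]/(fine t%:E) -muI.
apply: elem_int_le => //.
  apply/integrableP; split; first exact/measurable_EFinP/measurable_cst.
  by rewrite /= integral_cst//; rewrite [X in (_ * X)%E]muI -EFinM ltry.
move=> x xt; rewrite -real_normK ?num_real// ler_sqr ?nnegrE ?he//.
exact: le_trans (normr_ge0 _) (he x xt).
Qed.

(** Identifies the sums in [is_wiener_integral] with elementary integrals: no grid point exceeds
    [t], so stopping at [t] has no effect. *)
Lemma wiener_sum_steps (T : Type) (R : realType) (W : R -> T -> R) (g : R -> R) (t : R)
    (m : nat) w : 0 <= t -> (0 < m)%N ->
  \sum_(k < m) (W (t * k.+1%:R / m%:R) w - W (t * k%:R / m%:R) w) * g (t * k%:R / m%:R) =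
  elem_int W (steps g (t / m%:R) m) t w.
Proof.
move=> t0 m0; rewrite elem_int_steps; apply: eq_bigr => k _.
have kt i : (i <= m)%N -> Num.min t (i%:R * (t / m%:R)) = t * i%:R / m%:R.
  move=> im; rewrite min_r; first by rewrite mulrCA mulrA.
  by rewrite mulrCA -[leRHS]mulr1 ler_wpM2l// ler_pdivrMr ?ltr0n// mul1r ler_nat.
by rewrite !kt ?(ltnW (ltn_ord k))//; congr (_ * g _); rewrite mulrCA mulrA.
Qed.

Definition dyadic_event (T : Type) (R : realType) (W : R -> T -> R) (l : seq (R * R))
    (K : nat) (e : R) (q : nat) : set T :=
  [set w | exists2 k, (k <= K * 2 ^ q)%N & e <= `|elem_int W l (k%:R / 2 ^+ q) w|].

Lemma measurable_dyadic_event d (T : measurableType d) (R : realType)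
    (P : probability T R) (W : R -> T -> R) l K e q : brownian_motion P W ->
  nneg_times l -> measurable (dyadic_event W l K e q).
Proof.
move=> bm hl; apply: (measurable_exists_norm_ge (X := fun k => elem_int W l (k%:R / 2 ^+ q))) => k.
by apply: (elem_int_L2 bm hl _).1; apply: mulr_ge0.
Qed.

(** The maximal inequality has the same right-hand side on every dyadic grid. The grids are nested,
    so the events increase with [q] and the bound passes to their union. *)
Lemma dyadic_event_bound d (T : measurableType d) (R : realType)
    (P : probability T R) (W : R -> T -> R) l K e : brownian_motion P W ->
  nneg_times l -> 0 < e ->
  (P (\bigcup_q dyadic_event W l K e q) * (e ^+ 2)%:E <=
   (Ex P (fun w => elem_int W l K%:R w ^+ 2))%:E)%E.
Proof.
move=> bm hl e0.
have p2 q : 0 < (2 : R) ^+ q by rewrite exprn_gt0.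
have mE q := measurable_dyadic_event K e q bm hl.
have bd q : (P (dyadic_event W l K e q) <= (Ex P (fun w => elem_int W l K%:R w ^+ 2) / e ^+ 2)%:E)%E.
  have e2 : (0 < (e ^+ 2)%:E)%E by rewrite lte_fin exprn_gt0.
  rewrite EFinM lee_pdivlMr ?exprn_gt0//.
  have := @kolmogorov_ineq _ _ _ P W l (fun k => k%:R / 2 ^+ q) (K * 2 ^ q) e bm hl.
  rewrite mul0r lexx => /(_ isT); rewrite natrM natrX mulfK ?gt_eqF//; apply => //.
  by move=> i j ij; rewrite ler_wpM2r ?invr_ge0 ?(ltW (p2 q))// ler_nat.
rewrite -lee_pdivlMr ?exprn_gt0// -EFinM.
have nd : nondecreasing_seq (dyadic_event W l K e).
  apply/nondecreasing_seqP => q; apply/subsetPset => w [k kK hk].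
  exists (2 * k)%N; first by rewrite expnS mulnCA leq_mul2l.
  by rewrite exprS natrM invfM mulrACA divff ?pnatr_eq0// mul1r.
have mU : measurable (\bigcup_q dyadic_event W l K e q) by exact: bigcupT_measurable.
have cv := @nondecreasing_cvg_mu _ _ _ P _ mE mU nd.
rewrite -(cvg_lim _ cv)//; apply: lime_le; first exact: (cvgP _ cv).
by apply: nearW => q; exact: bd.
Qed.

Lemma steps_approx (R : realType) (g : R -> R) (h t e : R) (n : nat) : 0 <= h ->
  (forall x, 0 <= x <= t -> forall y, `|y - x| <= h -> `|g y - g x| <= e) ->
  t <= n%:R * h -> forall x, 0 <= x < t -> `|elem_fun (steps g h n) x - g x| <= e.
Proof.
move=> h0 hg tn x /andP[x0 xt].
have [k [kn /andP[k1 k2] ->]] := elem_fun_steps g h0 x0 (lt_le_trans xt tn).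
apply: hg; first by rewrite x0 ltW.
rewrite distrC ger0_norm ?subr_ge0// lerBlDl.
by rewrite -natr1 mulrDl mul1r in k2; exact: ltW.
Qed.

Lemma elem_int_posmax (T : Type) (R : realType) (W : R -> T -> R) l w :
  nneg_times l -> continuous (fun t : R => W (Num.max t 0) w) ->
  continuous (fun t : R => elem_int W l (Num.max t 0) w).
Proof.
move=> hl cW; have cmin (p : R) : continuous (fun t : R => Num.min t p).
  by move=> t; apply: continuous_min; [exact: cvg_id|exact: cvg_cst].
elim: l hl => [|p l IH] hl.
  have -> : (fun t : R => elem_int W [::] (Num.max t 0) w) = fun _ => 0.
    by apply/funext => t; rewrite /elem_int big_nil.
  exact: cst_continuous.
have -> : (fun t : R => elem_int W (p :: l) (Num.max t 0) w) =
    fun t : R => p.1 * (fun t : R => W (Num.max t 0) w) (Num.min t p.2) + elem_int W l (Num.max t 0) w.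
  apply/funext => t; rewrite elem_int_cons/=; congr (_ * W _ w + _).
  have p0 : 0 <= p.2 by apply: hl; exact: mem_head.
  have [t0|/ltW t0] := leP t 0; rewrite ?(max_r t0) ?(max_l t0).
    by rewrite (min_l p0) (min_l (le_trans t0 p0)) (max_r t0).
  by rewrite max_l// le_min t0.
move=> t; apply: cvgD.
  apply: cvgM; first exact: cvg_cst.
  apply: (@continuous_comp _ _ _ (fun t : R => Num.min t p.2) (fun t : R => W (Num.max t 0) w)).
    exact: cmin.
  exact: cW.
by apply: IH => q ql; apply: hl; rewrite in_cons ql orbT.
Qed.

Lemma cvge0_squeeze (R : realType) (u : nat -> \bar R) :
  (forall m, (0 <= u m)%E) -> (forall e : R, 0 < e -> \forall m \near \oo, (u m <= e%:E)%E) ->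
  u @ \oo --> 0%E.
Proof.
move=> u0 hu; apply/fine_cvgP; split.
  have := hu 1 ltr01; apply: filterS => m hm.
  by rewrite ge0_fin_numE// (le_lt_trans hm)// ltry.
apply/cvgrPdist_le => e e0; have := hu e e0; apply: filterS => m hm.
rewrite /= sub0r normrN ger0_norm ?fine_ge0//.
have um : u m \is a fin_num by rewrite ge0_fin_numE// (le_lt_trans hm)// ltry.
by rewrite -lee_fin fineK.
Qed.

(** Transfers an L2 bound from approximations to a limit that exists only pathwise off a null set.
    The approximations are set to 0 on [Bad], where [Y] vanishes, so that convergence holds
    everywhere and Fatou applies. *)
Lemma fatou_L2_le d (T : measurableType d) (R : realType) (P : probability T R)
    (X : nat -> T -> R) (Y Z : T -> R) (Bad : set T) (B : \bar R) :
  (forall j, measurable_fun setT (X j)) -> measurable_fun setT Z ->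
  measurable Bad -> P Bad = 0%E ->
  (forall w, ~ Bad w -> X ^~ w @ \oo --> Y w) -> (forall w, Bad w -> Y w = 0) ->
  (forall j, (\int[P]_w ((X j w - Z w) ^+ 2)%:E <= B)%E) ->
  (\int[P]_w ((Y w - Z w) ^+ 2)%:E <= B)%E.
Proof.
move=> mX mZ mB PB XY Y0 hB.
pose X' j w := \1_(~` Bad) w * X j w.
have mX' j : measurable_fun setT (X' j).
  by apply: measurable_funM => //; apply: measurable_indic; exact: measurableC.
have X'Y w : X' ^~ w @ \oo --> Y w.
  have [Bw|nBw] := pselect (Bad w).
    rewrite Y0// /X'; under eq_fun do rewrite indicE memNset ?mul0r//.
    exact: cvg_cst.
  rewrite /X'; under eq_fun do rewrite indicE mem_set ?mul1r//.
  exact: XY.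
have msq (f : T -> R) : measurable_fun setT f -> measurable_fun setT (fun w => ((f w - Z w) ^+ 2)%:E).
  by move=> mf; apply/measurable_EFinP; apply: measurable_funX; exact: measurable_funB.
have -> : (\int[P]_w ((Y w - Z w) ^+ 2)%:E =
    \int[P]_w limn_einf (fun j => ((X' j w - Z w) ^+ 2)%:E))%E.
  apply: eq_integral => w _; apply/esym.
  apply: (cvg_limn_einf_sup _).1; apply: cvg_EFin; first exact: nearW.
  have c : (fun j => X' j w - Z w) @ \oo --> Y w - Z w by apply: cvgB; [exact: X'Y|exact: cvg_cst].
  exact: (cvgM c c).
apply: le_trans (fatou _ measurableT _ _) _.
- by move=> j; exact: msq.
- by move=> j w _; rewrite lee_fin sqr_ge0.
have -> : (fun j => \int[P]_w ((X' j w - Z w) ^+ 2)%:E)%E = (fun j => \int[P]_w ((X j w - Z w) ^+ 2)%:E)%E.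
  apply/funext => j; apply: ae_eq_integral => //; [exact: msq|exact: msq|].
  exists Bad; split => // w /= /not_implyP[_]; apply: contra_notP => nB.
  by rewrite /X' indicE mem_set// mul1r.
rewrite limn_einf_lim; apply: lime_le; first exact: is_cvg_einfs.
apply: nearW => k; apply: le_trans (hB k); apply: ereal_inf_lbound.
by exists k => //=.
Qed.

(* On dyadic times the maximal inequality controls consecutive left-endpoint integrals, so by
   Borel-Cantelli they converge locally uniformly in time off a null set. *)
Lemma wiener_process_exists d (T : measurableType d) (R : realType)
    (P : probability T R) (W : R -> T -> R) (g : R -> R) :
  brownian_motion P W -> continuous g ->
  exists J : R -> T -> R, [/\ forall w, continuous (fun t => J t w),
    forall t, measurable_fun setT (J t) &
    forall t, 0 <= t -> (fun m : nat => \int[P]_w ((J t w - \sum_(k < m)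
      (W (t * k.+1%:R / m%:R) w - W (t * k%:R / m%:R) w) * g (t * k%:R / m%:R)) ^+ 2)%:E)%E
      @ \oo --> 0%E].
Proof.
move=> bm cg; have [mW _ _ _ cW] := bm.
(* The accuracy must beat the threshold 2^-j of the events below: the maximal inequality gives 4
   [gauss2 R] (j+1) 64^-j / 4^-j, which is at most 4 [gauss2 R] 2^-j and thus summable. Any
   sufficiently fast geometric rate would do. *)
pose dl (j : nat) : R := 8^-1 ^+ j.
have dl0 j : 0 < dl j by rewrite exprn_gt0// invr_gt0.
have [Nf hNf] : {Nf : nat -> nat & forall j x, 0 <= x <= j.+1%:R -> forall y,
    `|y - x| <= (Nf j).+1%:R^-1 -> `|g y - g x| <= dl j}.
  by apply: (@choice _ _ (fun j N => forall x, 0 <= x <= j.+1%:R -> forall y,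
    `|y - x| <= N.+1%:R^-1 -> `|g y - g x| <= dl j)) => j; exact: heine.
pose h j : R := (Nf j).+1%:R^-1.
have h0 j : 0 <= h j by rewrite invr_ge0.
pose n j := (j.+1 * (Nf j).+1)%N.
have nh j : (n j)%:R * h j = j.+1%:R by rewrite natrM mulfK.
(* The horizon j+1 grows with [j], so that a single sequence of approximations serves all times. *)
pose L j := steps g (h j) (n j).
have nL j : nneg_times (L j) by exact: nneg_steps.
have appL j x : 0 <= x < j.+1%:R -> `|elem_fun (L j) x - g x| <= dl j.
  by apply: steps_approx => //; [exact: hNf|rewrite nh].
pose D j := L j.+1 ++ neg_steps (L j).
have nD j : nneg_times (D j) by apply: nneg_cat => //; exact: nneg_neg_steps.
have DE j t w : elem_int W (D j) t w = elem_int W (L j.+1) t w - elem_int W (L j) t w.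
  by rewrite elem_int_cat elem_int_neg.
have dlS j : dl j.+1 <= dl j.
  by rewrite /dl exprS ler_piMl ?(ltW (dl0 j))// invf_le1// ler1n.
have appD j x : 0 <= x < j.+1%:R -> `|elem_fun (D j) x| <= 2 * dl j.
  move=> hx; rewrite elem_fun_cat elem_fun_neg.
  have h1 := appL j _ hx; have h2 : `|elem_fun (L j.+1) x - g x| <= dl j.+1.
    by apply: appL; case/andP: hx => -> /lt_le_trans ->//; rewrite ler_nat.
  rewrite (_ : _ - _ = (elem_fun (L j.+1) x - g x) - (elem_fun (L j) x - g x)); last by ring.
  by apply: le_trans (ler_normB _ _) _; have := dlS j; lra.
(* At some dyadic time up to j+1, two consecutive approximations differ by at least 2^-j. Only
   countably many times enter, which makes the event measurable. *)
pose E j := \bigcup_q dyadic_event W (D j) j.+1 (2^-1 ^+ j) q.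
have mE j : measurable (E j).
  by apply: bigcupT_measurable => q; exact: measurable_dyadic_event bm (nD j).
have PE j : (P (E j) <= (4 * gauss2 R * 2^-1 ^+ j)%:E)%E.
  have e2 : 0 < ((2^-1 : R) ^+ j) ^+ 2 by rewrite !exprn_gt0// invr_gt0.
  have := dyadic_event_bound j.+1 bm (nD j) (exprn_gt0 j (_ : 0 < (2^-1 : R))).
  rewrite invr_gt0 ltr0Sn => /(_ isT).
  rewrite -lee_pdivlMr// => /le_trans; apply; rewrite -EFinM lee_fin ler_pdivrMr//.
  apply: le_trans (elem_int_bound bm (nD j) (ler0n _ _) (appD j)) _.
  rewrite exprMn [leRHS](_ : _ = gauss2 R * (2 ^+ 2 * (2^-1 ^+ j * (2^-1 ^+ j) ^+ 2))); last by ring.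
  rewrite ler_wpM2l ?gauss2_ge0// -mulrA ler_wpM2l ?exprn_ge0//.
  have e8 : dl j = (2^-1 ^+ j) ^+ 3 by rewrite /dl -exprAC; congr (_ ^+ j); field.
  have e1 : 0 <= (2^-1 : R) ^+ j by rewrite exprn_ge0// invr_ge0.
  have e3 : j.+1%:R * (2^-1 : R) ^+ j <= 1.
    rewrite exprVn ler_pdivrMr ?exprn_gt0// mul1r -natrX ler_nat.
    by rewrite ltn_expl.
  have e4 : (2^-1 : R) ^+ j <= 1 by rewrite exprn_ile1// ?invr_ge0// invf_le1// ler1n.
  rewrite e8 (_ : (_ ^+ 3) ^+ 2 * _ = (j.+1%:R * 2^-1 ^+ j) * (2^-1 ^+ j) ^+ 5); last by ring.
  apply: le_trans (ler_wpM2r _ e3) _; first by rewrite exprn_ge0.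
  by rewrite mul1r -exprS; apply: ler_wiXn2l.
have PB : P (lim_sup_set E) = 0%E.
  apply: lim_sup_set_cvg0 => //.
  apply: (@le_lt_trans _ _ (\sum_(0 <= j <oo) (4 * gauss2 R * 2^-1 ^+ j)%:E)%E).
    by apply: lee_nneseries => // j _; exact: PE.
  apply: (@le_lt_trans _ _ (8 * gauss2 R)%:E); last exact: ltry.
  have c0 : 0 <= 4 * gauss2 R by rewrite mulr_ge0// gauss2_ge0.
  apply: lime_le.
    by apply: is_cvg_nneseries => j _ _; rewrite lee_fin mulr_ge0// exprn_ge0// invr_ge0.
  apply: nearW => k; rewrite sumEFin lee_fin -big_distrr/=.
  have -> : \sum_(0 <= j < k) (2^-1 : R) ^+ j = 2 - 2 * 2^-1 ^+ k.
    elim: k => [|k IH]; first by rewrite big_nil; ring.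
    by rewrite big_nat_recr//= IH exprS; field.
  rewrite [leRHS](_ : _ = 4 * gauss2 R * 2); last by ring.
  by rewrite ler_wpM2l// gerBl mulr_ge0// exprn_ge0// invr_ge0.
have [A [mA PA hA]] := cW.
(* Outcomes lying in infinitely many [E j], together with a null set containing all discontinuous
   Brownian paths. [J] is put to 0 there, so that its paths are continuous for every outcome. *)
pose Bad := lim_sup_set E `|` A.
have mB : measurable (lim_sup_set E).
  by apply: bigcapT_measurable => i; apply: bigcup_measurable => j _.
have mBad : measurable Bad by exact: measurableU.
have PBad : P Bad = 0%E by rewrite measureU0.
have cWw w : ~ Bad w -> continuous (fun t : R => W (Num.max t 0) w).
  move=> nB; apply: (@within_continuous_posmax R R (fun t => W t w)); apply: contra_notP nB => nc.
  by right; exact: hA.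
have good w : ~ Bad w -> exists J, forall j, (J <= j)%N -> forall t, 0 <= t <= j.+1%:R ->
    `|elem_int W (L j.+1) t w - elem_int W (L j) t w| <= 2^-1 ^+ j.
  move=> nB; have [J hJ] : exists J, forall j, (J <= j)%N -> ~ E j w.
    apply: contra_notP nB => /forallNP nB; left => J _.
    have /existsNP[j /not_implyP[Jj /contrapT Ej]] := nB J.
    by exists j.
  exists J => j Jj t t01.
  have := @dyadic_dense _ (fun t => elem_int W (D j) (Num.max t 0) w) j.+1 (2^-1 ^+ j).
  move=> /(_ (elem_int_posmax (nD j) (cWw w nB))) => hd.
  have := hd _ t t01; rewrite max_l; last by case/andP: t01.
  rewrite DE; apply=> q l lq; rewrite max_l; last by rewrite mulr_ge0// invr_ge0 exprn_ge0.
  rewrite leNgt; apply/negP => /ltW hl; apply: (hJ j Jj).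
  by exists q => //; exists l.
pose M j (t : R) w : R := elem_int W (L j) (Num.max t 0) w.
pose J (t : R) w : R := if pselect (Bad w) then 0 else limn (fun j => M j t w).
have JE t w : ~ Bad w -> J t w = limn (fun j => M j t w) by rewrite /J; case: pselect.
have mM j t : measurable_fun setT (M j t).
  by apply: (elem_int_L2 bm (nL j) _).1; rewrite le_max lexx orbT.
have cvgM w : ~ Bad w -> exists J0, forall j, (J0 <= j)%N -> forall t, t <= j.+1%:R ->
    cvgn (fun j => M j t w) /\ `|J t w - M j t w| <= 2 * 2^-1 ^+ j.
  move=> nB; have [J0 hJ0] := good w nB; exists J0 => j J0j t tj.
  have [|c1 c2] := @geometric_cvg _ (fun j => M j t w) j.
    move=> i ji; apply: hJ0; first exact: leq_trans ji.
    rewrite le_max lexx orbT ge_max ler0n andbT/=.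
    by apply: le_trans tj _; rewrite ler_nat.
  by split; [exact: c1|rewrite JE//; exact: c2].
have JM t w : ~ Bad w -> (fun j => M j t w) @ \oo --> J t w.
  move=> nB; have [J0 hJ0] := cvgM w nB.
  have [|c _] := hJ0 (maxn J0 (Num.truncn t).+1) (leq_maxl _ _) t.
    apply: le_trans (ltW (truncnS_gt t)) _; rewrite ler_nat.
    by rewrite leqW// leq_maxr.
  by rewrite JE.
have JB t w : Bad w -> J t w = 0 by rewrite /J; case: pselect.
exists J; split.
- move=> w; have [Bw|nB] := pselect (Bad w).
    have -> : J ^~ w = fun _ => 0 by apply/funext => t; exact: JB.
    exact: cst_continuous.
  have [J0 hJ0] := cvgM w nB; move=> t0; apply/cvgrPdist_le => e e0.
  have [j [J0j tj ej]] : exists j, [/\ (J0 <= j)%N, t0 + 1 <= j.+1%:R & 4 * 2^-1 ^+ j <= e / 2].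
    have c : (fun k => (2^-1 : R) ^+ k) @ \oo --> (0 : R).
      by apply: cvg_expr; rewrite ger0_norm ?invr_ge0// invf_lt1// ltr1n.
    have e8 : 0 < e / 8 by rewrite divr_gt0.
    have := c => /cvgrPdist_le/(_ _ e8)[q _ hq].
    pose j := maxn q (maxn J0 (Num.truncn (t0 + 1)).+1); exists j; split.
    - by rewrite !leq_max leqnn orbT.
    - apply: le_trans (ltW (truncnS_gt (t0 + 1))) _; rewrite ler_nat.
      by rewrite leqW// !leq_max leqnn !orbT.
    have := hq j (leq_maxl _ _); rewrite /= sub0r normrN ger0_norm ?exprn_ge0 ?invr_ge0//.
    by lra.
  have e2 : 0 < e / 2 by rewrite divr_gt0.
  have cMj : continuous (fun t : R => M j t w) := elem_int_posmax (nL j) (cWw w nB).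
  have := cMj t0 => /cvgrPdist_le/(_ _ e2) near1.
  near=> t.
  have t1 : t <= t0 + 1 by apply: ltW; near: t; apply: lt_nbhsl; rewrite ltrDl.
  have [_ h1] := hJ0 j J0j t0 (le_trans (ler_wpDr ler01 (lexx t0)) tj).
  have [_ h2] := hJ0 j J0j t (le_trans t1 tj).
  have h3 : `|M j t0 w - M j t w| <= e / 2 by near: t; exact: near1.
  rewrite (_ : J t0 w - J t w = (J t0 w - M j t0 w) - (J t w - M j t w) + (M j t0 w - M j t w)); last by ring.
  apply: le_trans (ler_normD _ _) _.
  have := ler_normB (J t0 w - M j t0 w) (J t w - M j t w); lra.
- move=> t; apply: (measurable_fun_cvg (h := fun j w => \1_(~` Bad) w * M j t w)).
    by move=> j; apply: measurable_funM => //; apply: measurable_indic; exact: measurableC.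
  move=> w _; have [Bw|nBw] := pselect (Bad w).
    rewrite JB//; under eq_fun do rewrite indicE memNset ?mul0r//.
    exact: cvg_cst.
  under eq_fun do rewrite indicE mem_set ?mul1r//.
  exact: JM.
move=> t t0; apply: cvge0_squeeze.
  by move=> m; apply: integral_ge0 => w _; rewrite lee_fin sqr_ge0.
move=> e e0.
(* Both step functions will be within [e'] of [g], so their integrals differ in mean square by at
   most [gauss2 R * ((2 * e') ^+ 2 * t)]. This [c] brings the bound below [e]; its summand 1 keeps
   it positive. *)
pose c := 4 * gauss2 R * t + 1.
have c0 : 0 < c by rewrite ltr_wpDl// !mulr_ge0// gauss2_ge0.
pose e' := Num.min 1 (e / c).
have e'0 : 0 < e' by rewrite lt_min ltr01 divr_gt0.
have e'B : gauss2 R * ((2 * e') ^+ 2 * t) <= e.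
  have h1 : e' <= 1 by rewrite ge_min lexx.
  have h2 : e' * c <= e by rewrite -ler_pdivlMr// ge_min lexx orbT.
  apply: le_trans h2; have -> : gauss2 R * ((2 * e') ^+ 2 * t) = e' * (4 * gauss2 R * t * e') by ring.
  have k0 : 0 <= 4 * gauss2 R * t by rewrite !mulr_ge0// gauss2_ge0.
  apply: ler_wpM2l; first exact: ltW.
  by apply: le_trans (ler_piMr k0 h1) _; rewrite lerDl.
have [N hN] := @heine _ g 0 t e' cg e'0.
near=> m.
have m0 : (0 < m)%N by near: m; exact: nbhs_infty_gt.
have mn0 : (m%:R : R) != 0 by rewrite pnatr_eq0 -lt0n.
have hm : t / m%:R <= N.+1%:R^-1.
  rewrite ler_pdivrMr ?ltr0n// mulrC ler_pdivlMr//.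
  by near: m; exact: nbhs_infty_ger.
have hm0 : 0 <= t / m%:R by rewrite divr_ge0.
pose S := steps g (t / m%:R) m.
have nS : nneg_times S by exact: nneg_steps.
have appS x : 0 <= x < t -> `|elem_fun S x - g x| <= e'.
  apply: steps_approx => //; last by rewrite mulrCA divff// mulr1.
  by move=> x' hx' y /le_trans/(_ hm); exact: hN.
under eq_integral do rewrite wiener_sum_steps//.
have [j0 [j01 j02]] : exists j0, t <= j0.+1%:R /\ dl j0 <= e'.
  have cc : (fun k => (8^-1 : R) ^+ k) @ \oo --> (0 : R).
    by apply: cvg_expr; rewrite ger0_norm ?invr_ge0// invf_lt1// ltr1n.
  have := cc => /cvgrPdist_le/(_ _ e'0)[q _ hq].
  exists (maxn q (Num.truncn t)); split.
    by apply: le_trans (ltW (truncnS_gt t)) _; rewrite ler_nat ltnS leq_maxr.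
  by have := hq _ (leq_maxl q (Num.truncn t)); rewrite /= sub0r normrN ger0_norm ?(ltW (dl0 _)).
have dlj j : (j0 <= j)%N -> dl j <= e'.
  move=> jj; apply: le_trans j02; rewrite /dl; apply: ler_wiXn2l => //.
  by rewrite invf_le1// ler1n.
(* The sum with [m] terms is compared with the tail of the approximations defining [J], uniformly in
   the tail index; Fatou passes to [J]. *)
apply: (@fatou_L2_le _ _ _ P (fun j => M (j0 + j)%N t) (J t) (elem_int W S t) Bad) => //.
- exact: (elem_int_L2 bm nS t0).1.
- move=> w nB; rewrite (_ : (fun j => _) = (fun j => M (j + j0)%N t w)); last first.
    by apply/funext => j; rewrite addnC.
  by rewrite (cvg_shiftn j0 (fun j => M j t w)); exact: JM.
- by move=> w; exact: JB.
move=> j; set i := (j0 + j)%N.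
have nLS : nneg_times (L i ++ neg_steps S) by apply: nneg_cat => //; exact: nneg_neg_steps.
have -> : (fun w => ((M i t w - elem_int W S t w) ^+ 2)%:E) =
    fun w => (elem_int W (L i ++ neg_steps S) t w ^+ 2)%:E.
  by apply/funext => w; rewrite /M max_l// elem_int_cat elem_int_neg.
rewrite (ExE (elem_int_L2 bm nLS t0).2) lee_fin; apply: le_trans e'B.
apply: elem_int_bound => // x hx; rewrite elem_fun_cat elem_fun_neg.
have h1 := appS x hx; have h2 : `|elem_fun (L i) x - g x| <= e'.
  apply: le_trans (dlj i (leq_addr _ _)); apply: appL.
  case/andP: hx => -> /lt_le_trans -> //; apply: le_trans j01 _; rewrite ler_nat.
  by rewrite ltnS leq_addr.
rewrite (_ : _ - _ = (elem_fun (L i) x - g x) - (elem_fun S x - g x)); last by ring.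
by apply: le_trans (ler_normB _ _) _; lra.
Unshelve. all: by end_near. Qed.

(** Integrals of nonnegative functions are suprema over simple functions below them, so monotonicity
    requires no measurability. This lets costs be compared without first proving their integrands
    measurable. *)
Lemma ge0_le_integral_nomeas d (T : measurableType d) (R : realType)
    (m : {measure set T -> \bar R}) (f g : T -> \bar R) :
  (forall x, 0 <= f x)%E -> (forall x, f x <= g x)%E ->
  (\int[m]_x f x <= \int[m]_x g x)%E.
Proof.
move=> f0 fg; have g0 x : (0 <= g x)%E := le_trans (f0 x) (fg x).
rewrite !ge0_integralTE//; apply: le_ereal_sup => _ [h hf <-]; exists h => //.
by move=> x; apply: le_trans (fg x); exact: hf.
Qed.

(** Rounding the time down to multiples of 1/(n+1) leaves countably many times, each contributing a
    measurable rectangle; continuity of the paths gives convergence as the mesh shrinks. *)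
Lemma measurable_cont_process d (T : measurableType d) (R : realType) (F : R -> T -> R) :
  (forall w, continuous (fun t => F t w)) -> (forall t, 0 <= t -> measurable_fun setT (F t)) ->
  measurable_fun setT (fun p : T * R => F (Num.max p.2 0) p.1).
Proof.
move=> cF mF.
pose x (p : T * R) : R := Num.max p.2 0.
have x0 p : 0 <= x p by rewrite le_max lexx orbT.
have mx : measurable_fun setT x.
  apply: (measurableT_comp (f := fun t : R => Num.max t 0)) => //.
  by apply: measurable_maxr.
pose k n p := Num.truncn (x p * n.+1%:R).
pose Fn n p := F ((k n p)%:R / n.+1%:R) p.1.
apply: (measurable_fun_cvg (h := Fn)).
  move=> n _ E mE; rewrite setTI.
  have -> : Fn n @^-1` E = \bigcup_i ((fst @^-1` (F (i%:R / n.+1%:R) @^-1` E)) `&`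
      ((fun p => x p * n.+1%:R) @^-1` `[i%:R, i.+1%:R[%classic)).
    apply/seteqP; split => p /=.
      move=> h; exists (k n p) => //; split => //=.
      by rewrite in_itv/=; apply: truncn_itv; rewrite mulr_ge0.
    move=> [i _ [/= h]]; rewrite in_itv/= => hi.
    by rewrite /Fn /k (truncn_def hi).
  apply: bigcupT_measurable => i; apply: measurableI.
    rewrite -[X in measurable X]setTI; apply: measurable_fst => //.
    by rewrite -[X in measurable X]setTI; apply: mF => //; rewrite divr_ge0.
  rewrite -[X in measurable X]setTI; exact: measurable_funM.
move=> p _; have c : (fun n => (k n p)%:R / n.+1%:R) @ \oo --> x p.
  apply/cvgrPdist_lt => e e0; near=> n.
  have /andP[h1 h2] : (k n p)%:R <= x p * n.+1%:R < (k n p).+1%:R.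
    by apply: truncn_itv; rewrite mulr_ge0.
  have n0 : 0 < n.+1%:R :> R by rewrite ltr0n.
  rewrite ger0_norm; last by rewrite subr_ge0 ler_pdivrMr.
  apply: (@le_lt_trans _ _ n.+1%:R^-1); last first.
    by near: n; exact: (near_infty_natSinv_lt (PosNum e0)).
  rewrite lerBlDr (_ : _ + _ = (k n p).+1%:R / n.+1%:R); last first.
    by rewrite -[in RHS]natr1 mulrDl mul1r addrC.
  by rewrite ler_pdivlMr// ltW.
exact: (cvg_comp _ _ c (cF p.1 (x p))).
Unshelve. all: by end_near. Qed.

Lemma measurable_integral_time d (T : measurableType d) (R : realType) (F : R -> T -> R)
    (D : set R) : measurable D ->
  (forall w, continuous (fun t => F t w)) -> (forall t, 0 <= t -> measurable_fun setT (F t)) ->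
  (forall t w, 0 <= F t w) ->
  measurable_fun setT (fun w => \int[mu]_(t in D) (F (Num.max t 0) w)%:E)%E.
Proof.
move=> mD cF mF F0.
pose f (p : T * R) : \bar R := ((F (Num.max p.2 0) p.1) * \1_D p.2)%:E.
have mf : measurable_fun setT f.
  apply/measurable_EFinP; apply: measurable_funM; first exact: measurable_cont_process.
  by apply: (measurableT_comp (f := \1_D : R -> R)) => //; exact: measurable_indic.
have f0 p : (0 <= f p)%E by rewrite lee_fin mulr_ge0// indicE; case: (_ \in _).
have := @measurable_fun_fubini_tonelli_F _ _ T (measurableTypeR R) R mu f mf f0.
congr measurable_fun; apply/funext => w; rewrite [RHS]integral_mkcond; apply: eq_integral => t _.
by rewrite /f /patch indicE; case: ifPn => tD; rewrite ?mulr1 ?mulr0.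
Qed.

Lemma measurable_prim d (T : measurableType d) (R : realType) (F : R -> T -> R) (t : R) :
  (forall w, continuous (fun t => F t w)) -> (forall t, 0 <= t -> measurable_fun setT (F t)) ->
  0 <= t -> measurable_fun setT (fun w => prim (fun s => F s w) t).
Proof.
move=> cF mF t0.
pose Fp s w := Num.max (F s w) 0; pose Fn s w := Num.max (- F s w) 0.
have cmax (f : R -> R) : continuous f -> continuous (fun s => Num.max (f s) 0).
  by move=> cf s; apply: continuous_max; [exact: cf|exact: cvg_cst].
have cFp w : continuous (fun s => Fp s w) by apply: cmax; exact: cF.
have cFn w : continuous (fun s => Fn s w) by apply: cmax => s; apply: cvgN; exact: cF.
have mFp s : 0 <= s -> measurable_fun setT (Fp s).
  by move=> s0; apply: measurable_maxr => //; exact: mF.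
have mFn s : 0 <= s -> measurable_fun setT (Fn s).
  by move=> s0; apply: measurable_maxr => //; apply: measurableT_comp => //; exact: mF.
have key (G : R -> T -> R) : (forall w, continuous (fun t => G t w)) ->
    (forall t, 0 <= t -> measurable_fun setT (G t)) -> (forall t w, 0 <= G t w) ->
    measurable_fun setT (fun w => prim (fun s => G s w) t).
  move=> cG mG G0.
  have -> : (fun w => prim (fun s => G s w) t) =
      fine \o (fun w => \int[mu]_(s in `[0%R, t]) (G (Num.max s 0) w)%:E)%E.
    apply/funext => w; rewrite primE//=; congr fine; apply: eq_integral => s.
    by rewrite inE/= in_itv/= => /andP[s0 _]; rewrite max_l.
  apply: measurableT_comp; first exact: fine_measurable.
  by apply: measurable_integral_time.
have -> : (fun w => prim (fun s => F s w) t) =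
    fun w => prim (fun s => Fp s w) t - prim (fun s => Fn s w) t.
  apply/funext => w; rewrite -[RHS]addr0.
  have -> : (fun s => F s w) = fun s => Fp s w + (-1) * Fn s w.
    apply/funext => s; rewrite /Fp /Fn mulN1r; have [h|/ltW h] := leP 0 (F s w).
      by rewrite ?(max_l h) max_r ?oppr_le0// subr0.
    by rewrite ?(max_r h) max_l ?oppr_ge0// sub0r opprK.
  rewrite primD//; last by move=> s; apply: cvgM; [exact: cvg_cst|exact: cFn].
  by rewrite primZ// mulN1r addr0.
apply: measurable_funB; apply: key => //.
- by move=> s w; rewrite /Fp le_max lexx orbT.
- by move=> s w; rewrite /Fn le_max lexx orbT.
Qed.

(** Half of the Ito isometry, up to a constant. The factor 4 comes from using (a+b)^2 <= 2a^2 + 2b^2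
    twice: between [Y] and an approximating sum, and between its step function and [g]. *)
Lemma wiener_L2_bound d (T : measurableType d) (R : realType)
    (P : probability T R) (W : R -> T -> R) (g : R -> R) (t : R) (Y : T -> R) :
  brownian_motion P W -> continuous g -> 0 <= t -> measurable_fun setT Y ->
  (fun m : nat => \int[P]_w ((Y w - \sum_(k < m)
      (W (t * k.+1%:R / m%:R) w - W (t * k%:R / m%:R) w) * g (t * k%:R / m%:R)) ^+ 2)%:E)%E
      @ \oo --> 0%E ->
  (\int[P]_w (Y w ^+ 2)%:E <= (4 * gauss2 R * prim (fun s => g s ^+ 2) t)%:E)%E.
Proof.
move=> bm cg t0 mY cv.
have cg2 : continuous (fun s => g s ^+ 2) by move=> s; apply: (cvgM (cg s) (cg s)).
(* Collects the two errors: [2 * e'] from replacing [Y] by the sum, and [4 * gauss2 R * t * e'] from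
   replacing [g] by its step function. *)
pose K := 2 + 4 * gauss2 R * t.
have K0 : 0 < K by rewrite ltr_wpDr// !mulr_ge0// gauss2_ge0.
apply/lee_addgt0Pr => e e0.
pose e' := Num.min 1 (e / K).
have e'0 : 0 < e' by rewrite lt_min ltr01 divr_gt0.
have e'1 : e' <= 1 by rewrite ge_min lexx.
have e'K : e' * K <= e by rewrite -ler_pdivlMr// ge_min lexx orbT.
have [N hN] := @heine _ g 0 t e' cg e'0.
have [m [m0 mN hm]] : exists m : nat, [/\ (0 < m)%N, t * N.+1%:R <= m%:R &
    (\int[P]_w ((Y w - \sum_(k < m)
      (W (t * k.+1%:R / m%:R) w - W (t * k%:R / m%:R) w) * g (t * k%:R / m%:R)) ^+ 2)%:E <= e'%:E)%E].
  have /fine_cvgP[fin /cvgrPdist_le/(_ _ e'0) ncv] := cv.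
  near \oo => m; exists m; split.
  - by near: m; exact: nbhs_infty_gt.
  - by near: m; exact: nbhs_infty_ger.
  - have fm : (\int[P]_w ((Y w - \sum_(k < m)
      (W (t * k.+1%:R / m%:R) w - W (t * k%:R / m%:R) w) * g (t * k%:R / m%:R)) ^+ 2)%:E)%E
      \is a fin_num by near: m.
    rewrite -(fineK fm) lee_fin; apply: le_trans (ler_norm _) _.
    by rewrite -normrN -sub0r; near: m.
have mn0 : (m%:R : R) != 0 by rewrite pnatr_eq0 -lt0n.
have hm' : t / m%:R <= N.+1%:R^-1.
  by rewrite ler_pdivrMr ?ltr0n// mulrC ler_pdivlMr.
have hm0 : 0 <= t / m%:R by rewrite divr_ge0.
pose S := steps g (t / m%:R) m.
have nS : nneg_times S by exact: nneg_steps.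
have appS x : 0 <= x < t -> `|elem_fun S x - g x| <= e'.
  apply: steps_approx => //; last by rewrite mulrCA divff// mulr1.
  by move=> x' hx' y /le_trans/(_ hm'); exact: hN.
have LS := elem_int_L2 bm nS t0.
have mD : measurable_fun setT (fun w => Y w - elem_int W S t w).
  by apply: measurable_funB => //; exact: LS.1.
have hD : (\int[P]_w ((Y w - elem_int W S t w) ^+ 2)%:E <= e'%:E)%E.
  by move: hm; under eq_integral do rewrite wiener_sum_steps//.
have hS : (\int[P]_w (elem_int W S t w ^+ 2)%:E <= (gauss2 R * (2 * prim (fun s => g s ^+ 2) t + 2 * e' * t))%:E)%E.
  rewrite (ExE LS.2) lee_fin.
  have cphi : continuous (fun s => 2 * g s ^+ 2 + 2 * e').
    by move=> s; apply: cvgD; [apply: cvgM; [exact: cvg_cst|exact: cg2]|exact: cvg_cst].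
  have iphi : mu.-integrable `[0, t] (EFin \o (fun s => 2 * g s ^+ 2 + 2 * e')).
    exact: continuous_integrable.
  have iphi' : mu.-integrable `[0, t[ (EFin \o (fun s => 2 * g s ^+ 2 + 2 * e')).
    apply: integrableS iphi => //; apply: subset_itvl; by rewrite bnd_simp.
  apply: le_trans (elem_int_le (phi := fun s => 2 * g s ^+ 2 + 2 * e') bm nS t0 _ _) _.
  - exact: iphi'.
  - move=> x hx; have := appS x hx.
    rewrite -[X in X <= _](ger0_norm (normr_ge0 _)) => hx'.
    have : `|elem_fun S x - g x| ^+ 2 <= e' ^+ 2 by rewrite ler_sqr ?nnegrE ?(ltW e'0)//; move: hx'; rewrite normr_id.
    rewrite real_normK ?num_real// => hx2.
    have he2 : e' ^+ 2 <= e' by rewrite expr2 ler_piMl// ltW.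
    have := sqr_ge0 (elem_fun S x - 2 * g x); nra.
  - rewrite ler_wpM2l ?gauss2_ge0//.
    rewrite (Rintegral_itv_bndo_bndc iphi') -primE// primD//.
    - by rewrite (primZ 2 cg2 t0) prim_cst.
    - by move=> s; apply: cvgM; [exact: cvg_cst|exact: cg2].
    - by move=> s; exact: cvg_cst.
have : (\int[P]_w (Y w ^+ 2)%:E <= \int[P]_w (2%:E * ((Y w - elem_int W S t w) ^+ 2)%:E + 2%:E * (elem_int W S t w ^+ 2)%:E))%E.
  apply: ge0_le_integral_nomeas => w; first by rewrite lee_fin sqr_ge0.
  rewrite -!EFinM -EFinD lee_fin.
  by have := sqr_ge0 (Y w - 2 * elem_int W S t w); nra.
move/le_trans; apply.
rewrite ge0_integralD//; last 4 first.
- by move=> w _; rewrite -EFinM lee_fin mulr_ge0// sqr_ge0.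
- by apply: measurable_funeM; apply/measurable_EFinP; exact: measurable_funX.
- by move=> w _; rewrite -EFinM lee_fin mulr_ge0// sqr_ge0.
- by apply: measurable_funeM; apply/measurable_EFinP; apply: measurable_funX; exact: LS.1.
rewrite !ge0_integralZl//; last 4 first.
- by apply/measurable_EFinP; apply: measurable_funX; exact: LS.1.
- by move=> w _; rewrite lee_fin sqr_ge0.
- by apply/measurable_EFinP; exact: measurable_funX.
- by move=> w _; rewrite lee_fin sqr_ge0.
apply: le_trans (leeD (lee_wpmul2l _ hD) (lee_wpmul2l _ hS)) _ => //.
rewrite -!EFinM -!EFinD lee_fin -lerBlDl; apply: le_trans e'K; rewrite /K.
by rewrite le_eqVlt; apply/orP; left; apply/eqP; ring.
Unshelve. all: by end_near. Qed.

(** * Continuous processes and their expected weighted norms *)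

Definition cont_proc d (T : measurableType d) (R : realType) (n : nat)
    (G : R -> T -> 'cV[R]_n) :=
  (forall w, mx_cont (fun t => G t w)) /\
  forall t k, 0 <= t -> measurable_fun setT (fun w => G t w k 0).

Lemma measurable_sqnorm d (T : measurableType d) (R : realType) (n : nat)
    (G : T -> 'cV[R]_n) : (forall k, measurable_fun setT (fun w => G w k 0)) ->
  measurable_fun setT (fun w => sqnorm (G w)).
Proof. by move=> mG; apply: measurable_sum => k; exact: measurable_funX. Qed.

Lemma integral_sqnorm d (T : measurableType d) (R : realType) (P : probability T R)
    (n : nat) (G : T -> 'cV[R]_n) : (forall k, measurable_fun setT (fun w => G w k 0)) ->
  (\int[P]_w (sqnorm (G w))%:E = \sum_k \int[P]_w (G w k 0 ^+ 2)%:E)%E.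
Proof.
move=> mG; under eq_integral do rewrite /sqnorm -sumEFin.
rewrite ge0_integral_sum// => k.
  by apply/measurable_EFinP; exact: measurable_funX.
by move=> w _; rewrite lee_fin sqr_ge0.
Qed.

(** Integration by parts against exp(-rho s), with the nonnegative boundary term dropped. Here
    positivity of [rho] turns the growing variance of the noise into a finite cost. *)
Lemma prim_weighted (R : realType) (rho : R) (h : R -> R) (t : R) : 0 < rho -> continuous h ->
  (forall s, 0 <= h s) -> 0 <= t ->
  prim (fun s => expR (- (rho * s)) * prim h s) t <=
  rho^-1 * prim (fun s => expR (- (rho * s)) * h s) t.
Proof.
move=> rho0 ch h0 t0.
have ce := @continuous_expw R rho; have cp := continuous_prim ch.
have ceh : continuous (fun s => expR (- (rho * s)) * h s).
  by move=> s; apply: cvgM; [exact: ce|exact: ch].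
have cep : continuous (fun s => expR (- (rho * s)) * prim h s).
  by move=> s; apply: cvgM; [exact: ce|exact: cp].
pose F s := prim (fun s => expR (- (rho * s)) * prim h s) s +
  (- rho^-1) * prim (fun s => expR (- (rho * s)) * h s) s +
  rho^-1 * (expR (- (rho * s)) * prim h s).
have : F t = 0.
  apply: deriv0_zero => //.
  - move=> s; apply: cvgD; first apply: cvgD.
    + exact: continuous_prim.
    + by apply: cvgM; [exact: cvg_cst|exact: continuous_prim].
    + by apply: cvgM; [exact: cvg_cst|exact: cep].
  - by rewrite /F !prim0 !(mulr0, addr0).
  - move=> s s0.
    have d1 := is_derive_prim cep s0; have d2 := is_derive_prim ceh s0.
    have d3 := is_deriveMr (is_derive_expw rho s) (is_derive_prim ch s0).
    have d4 := is_deriveMr (is_derive_cst (- rho^-1) s (1 : R)) d2.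
    have d5 := is_deriveMr (is_derive_cst rho^-1 s (1 : R)) d3.
    have d6 := is_deriveD (is_deriveD d1 d4) d5.
    apply: is_derive_eq d6 _; rewrite /= /cst.
    by field; rewrite gt_eqF.
rewrite /F => Ft.
have p0 : 0 <= prim h t.
  by have := prim_ndecr ch h0 (lexx 0) t0; rewrite prim0.
have : 0 <= rho^-1 * (expR (- (rho * t)) * prim h t).
  by rewrite mulr_ge0 ?invr_ge0 ?(ltW rho0)// mulr_ge0// expR_ge0.
lra.
Qed.

Lemma measurable_wnorm d (T : measurableType d) (R : realType) (n : nat) (rho : R)
    (G : R -> T -> 'cV[R]_n) : cont_proc G ->
  measurable_fun setT (fun w => wnorm rho (fun t => G t w)).
Proof.
move=> [cG mG].
have -> : (fun w => wnorm rho (fun t => G t w)) = (fun w =>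
    \int[mu]_(t in `[0%R, +oo[) ((fun t w => wsq rho (fun t => G t w) t) (Num.max t 0) w)%:E)%E.
  apply/funext => w; apply: eq_integral => t; rewrite inE/= in_itv/= andbT => t0.
  by rewrite max_l.
apply: (measurable_integral_time (F := fun t w => wsq rho (fun t => G t w) t)).
- exact: measurable_itv.
- by move=> w; apply: continuous_wsq; exact: cG.
- move=> t t0; apply: measurable_funM => //.
  by apply: measurable_sqnorm => k; exact: mG.
- by move=> t w; exact: wsq_ge0.
Qed.

(** Tonelli, with the half-line encoded as an indicator so that the joint integrand lives on the
    whole product; it allows second moments to be bounded one time at a time. *)
Lemma integral_wnorm d (T : measurableType d) (R : realType) (P : probability T R)
    (n : nat) (rho : R) (G : R -> T -> 'cV[R]_n) : cont_proc G ->
  (\int[P]_w wnorm rho (fun t => G t w) =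
   \int[mu]_(t in `[0%R, +oo[) ((expR (- (rho * t)))%:E * \int[P]_w (sqnorm (G t w))%:E))%E.
Proof.
move=> [cG mG].
pose F t w := wsq rho (fun t => G t w) t.
pose D := (`[0, +oo[%classic : set R).
pose f (p : T * R) : \bar R := ((F (Num.max p.2 0) p.1) * \1_D p.2)%:E.
have mf : measurable_fun setT f.
  apply/measurable_EFinP; apply: measurable_funM.
    apply: (@measurable_cont_process _ T R F); first by move=> w; apply: continuous_wsq; exact: cG.
    move=> t t0; apply: measurable_funM => //.
    by apply: measurable_sqnorm => k; exact: mG.
  apply: (measurableT_comp (f := \1_D : R -> R)) => //; apply: measurable_indic.
  exact: measurable_itv.
have f0 p : (0 <= f p)%E.
  by rewrite lee_fin mulr_ge0 ?wsq_ge0// indicE; case: (_ \in _).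
have fE t w : t \in D -> f (w, t) = (F t w)%:E.
  rewrite inE /D/= in_itv/= andbT => t0.
  by rewrite /f/= max_l// indicE mem_set ?mulr1// /D /= in_itv/= andbT.
have fE0 t w : t \notin D -> f (w, t) = 0%E.
  by move=> tD; rewrite /f/= indicE (negbTE tD) mulr0.
have := @fubini_tonelli _ _ T (measurableTypeR R) R P mu f mf f0.
have -> : (\int[P]_x \int[mu]_y f (x, y) = \int[P]_w wnorm rho (fun t => G t w))%E.
  apply: eq_integral => w _; rewrite /wnorm [RHS]integral_mkcond; apply: eq_integral => t _.
  by rewrite /patch; case: ifPn => tD; [exact: fE|exact: fE0].
move=> ->; rewrite [RHS]integral_mkcond; apply: eq_integral => t _.
rewrite /patch; case: ifPn => tD; last first.
  by rewrite integral0_eq// => w _; exact: fE0.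
have t0 : 0 <= t by move: tD; rewrite inE /D/= in_itv/= andbT.
rewrite -ge0_integralZl//.
- by apply: eq_integral => w _; rewrite fE// EFinM.
- by apply/measurable_EFinP; apply: measurable_sqnorm => k; exact: mG.
- by move=> w _; rewrite lee_fin sqnorm_ge0.
Qed.

Lemma noise_wnorm_fin d (T : measurableType d) (R : realType) (P : probability T R)
    (n : nat) (rho K : R) (h : R -> R) (J : R -> T -> 'cV[R]_n) :
  0 < rho -> 0 <= K -> cont_proc J -> continuous h -> (forall s, 0 <= h s) ->
  (\int[mu]_(t in `[0%R, +oo[) (expR (- (rho * t)) * h t)%:E < +oo)%E ->
  (forall t : R, 0 <= t -> (\int[P]_w (sqnorm (J t w))%:E <= (K * prim h t)%:E)%E) ->
  (\int[P]_w wnorm rho (fun t => J t w) < +oo)%E.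
Proof.
move=> rho0 K0 cJ ch h0 hfin hJ; rewrite integral_wnorm//.
have ce := @continuous_expw R rho; have cp := continuous_prim ch.
have cep : continuous (fun s => K * (expR (- (rho * s)) * prim h s)).
  by move=> s; apply: cvgM; [exact: cvg_cst|apply: cvgM; [exact: ce|exact: cp]].
have ceh : continuous (fun s => expR (- (rho * s)) * h s).
  by move=> s; apply: cvgM; [exact: ce|exact: ch].
have eh0 s : 0 <= expR (- (rho * s)) * h s by rewrite mulr_ge0 ?expR_ge0.
have p0 t : 0 <= prim h t.
  have [t0|t0] := leP 0 t; first by have := prim_ndecr ch h0 (lexx 0) t0; rewrite prim0.
  by rewrite /prim (max_r (ltW t0)) subrr.
apply: (@le_lt_trans _ _ (\int[mu]_(t in `[0%R, +oo[) (K * (expR (- (rho * t)) * prim h t))%:E)%E).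
  rewrite [leLHS]integral_mkcond [leRHS]integral_mkcond; apply: ge0_le_integral_nomeas => t.
    rewrite /patch; case: ifPn => // tD; rewrite mule_ge0 ?lee_fin ?expR_ge0//.
    by apply: integral_ge0 => w _; rewrite lee_fin sqnorm_ge0.
  rewrite /patch; case: ifPn => // tD.
  have t0 : 0 <= t by move: tD; rewrite inE/= in_itv/= andbT.
  rewrite mulrCA EFinM; apply: lee_wpmul2l; first by rewrite lee_fin expR_ge0.
  exact: hJ.
pose B := fine (\int[mu]_(t in `[0%R, +oo[) (expR (- (rho * t)) * h t)%:E)%E.
apply: (@le_lt_trans _ _ (K * (rho^-1 * B))%:E); last exact: ltry.
apply: integral_le_prim => //.
  by move=> t; rewrite mulr_ge0// mulr_ge0 ?expR_ge0.
move=> t t0.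
rewrite primZ//; last by move=> s; apply: cvgM; [exact: ce|exact: cp].
rewrite ler_wpM2l//; apply: le_trans (prim_weighted rho0 ch h0 t0) _.
rewrite ler_wpM2l ?invr_ge0 ?(ltW rho0)// /B.
rewrite -lee_fin fineK; first exact: prim_le_integral.
by rewrite ge0_fin_numE//; apply: integral_ge0 => s _; rewrite lee_fin.
Qed.

Lemma posmax_mx_cont (R : realType) (n : nat) (g : R -> 'cV[R]_n) :
  {within `[0, +oo[, continuous g} -> mx_cont (fun t => g (Num.max t 0)).
Proof.
move=> cg i j; have c := within_continuous_posmax cg.
move=> t; apply: (@continuous_comp _ _ _ (fun t : R => g (Num.max t 0)) (fun M : 'cV[R]_n => M i j)).
  exact: c.
exact: coord_continuous.
Qed.

Lemma mx_cont_continuous (R : realType) (n : nat) (g : R -> 'cV[R]_n) :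
  mx_cont g -> continuous g.
Proof.
move=> cg t; apply/cvg_ballP => e e0.
near=> s; split => // i j; rewrite ord1.
move: i {j}; near: s; apply: filter_forall => i.
by have := cg i 0 t => /cvg_ballP/(_ e e0).
Unshelve. all: by end_near. Qed.

Lemma wiener_vec_bound d (T : measurableType d) (R : realType)
    (P : probability T R) (n : nat) (W : R -> T -> R) (sigma : R -> 'cV[R]_n) (t : R)
    (J : T -> 'cV[R]_n) :
  brownian_motion P W -> mx_cont (fun s => sigma (Num.max s 0)) -> 0 <= t ->
  (forall k, measurable_fun setT (fun w => J w k 0)) ->
  is_wiener_integral P W sigma t J ->
  (\int[P]_w (sqnorm (J w))%:E <=
   (4 * gauss2 R * prim (fun s => sqnorm (sigma (Num.max s 0))) t)%:E)%E.
Proof.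
move=> bm cs t0 mJ; rewrite /is_wiener_integral /= => cv.
have mW s : 0 <= s -> measurable_fun setT (W s) by case: bm => h _ _ _ _; exact: h.
have tk0 m k : 0 <= t * k%:R / m%:R by rewrite !mulr_ge0// invr_ge0.
have bd k : (\int[P]_w (J w k 0 ^+ 2)%:E <=
    (4 * gauss2 R * prim (fun s => sigma (Num.max s 0) k 0 ^+ 2) t)%:E)%E.
  apply: (wiener_L2_bound bm (cs k 0) t0 (mJ k)).
  apply: (@squeeze_cvge _ _ _ _ (fun=> 0%E) _ _ _ _ (cvg_cst _) cv).
  apply: nearW => m; apply/andP; split.
    by apply: integral_ge0 => w _; rewrite lee_fin sqr_ge0.
  apply: ge0_le_integral_nomeas => w; first by rewrite lee_fin sqr_ge0.
  rewrite lee_fin /sqnorm (bigD1 k)//= !mxE summxE.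
  rewrite -[leLHS]addr0 lerD ?sumr_ge0//; last by move=> i _; exact: sqr_ge0.
  rewrite le_eqVlt; apply/orP; left; apply/eqP; congr (_ ^+ 2); congr (_ - _).
  by apply: eq_bigr => i _; rewrite !mxE max_l.
rewrite integral_sqnorm//.
apply: (@le_trans _ _ (\sum_k (4 * gauss2 R * prim (fun s => sigma (Num.max s 0) k 0 ^+ 2) t)%:E)%E).
  by apply: lee_sum => k _; exact: bd.
rewrite sumEFin lee_fin -big_distrr/= le_eqVlt; apply/orP; left; apply/eqP; congr (_ * _).
have : forall (s : seq 'I_n), \sum_(k <- s) prim (fun s => sigma (Num.max s 0) k 0 ^+ 2) t =
    prim (fun s' => \sum_(k <- s) sigma (Num.max s' 0) k 0 ^+ 2) t.
  have c2 k : continuous (fun s : R => sigma (Num.max s 0) k 0 ^+ 2).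
    by move=> s; exact: (cvgM (cs k 0 s) (cs k 0 s)).
  elim=> [|k s IH].
    by rewrite big_nil; under eq_fun do rewrite big_nil; rewrite prim_cst// mul0r.
  rewrite big_cons IH -primD//; last exact: continuous_bigsum.
  by congr prim; apply/funext => s'; rewrite big_cons.
exact.
Qed.

Lemma wiener_vec_exists d (T : measurableType d) (R : realType)
    (P : probability T R) (n : nat) (W : R -> T -> R) (sigma : R -> 'cV[R]_n) :
  brownian_motion P W -> mx_cont (fun s => sigma (Num.max s 0)) ->
  exists J : R -> T -> 'cV[R]_n, cont_proc J /\
    forall t, 0 <= t -> is_wiener_integral P W sigma t (J t).
Proof.
move=> bm cs.
have mW s : 0 <= s -> measurable_fun setT (W s) by case: bm => h _ _ _ _; exact: h.
have tk0 t m k : 0 <= t -> 0 <= t * k%:R / m%:R by move=> t0; rewrite !mulr_ge0// invr_ge0.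
have /choice[J hJ] : forall k : 'I_n, exists J : R -> T -> R, [/\ forall w, continuous (fun t => J t w),
    forall t, measurable_fun setT (J t) &
    forall t, 0 <= t -> (fun m : nat => \int[P]_w ((J t w - \sum_(i < m)
      (W (t * i.+1%:R / m%:R) w - W (t * i%:R / m%:R) w) * sigma (Num.max (t * i%:R / m%:R) 0) k 0) ^+ 2)%:E)%E
      @ \oo --> 0%E].
  by move=> k; exact: (@wiener_process_exists _ _ _ P W (fun s => sigma (Num.max s 0) k 0)).
exists (fun t w => \col_k J k t w); split; first split.
- move=> w i j; have [c _ _] := hJ i.
  by rewrite (_ : (fun s => _) = J i ^~ w)//; apply/funext => s; rewrite mxE.
- move=> t k _; have [_ m _] := hJ k.
  by rewrite (_ : (fun w => _) = J k t)//; apply/funext => w; rewrite mxE.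
move=> t t0; rewrite /is_wiener_integral /=.
pose u k (m : nat) := (\int[P]_w ((J k t w - \sum_(i < m)
      (W (t * i.+1%:R / m%:R) w - W (t * i%:R / m%:R) w) * sigma (Num.max (t * i%:R / m%:R) 0) k 0) ^+ 2)%:E)%E.
have -> : (fun m : nat => (\int[P]_w (sqnorm ((\col_k J k t w) - \sum_(i < m)
    (W (t * i.+1%:R / m%:R) w - W (t * i%:R / m%:R) w) *: sigma (t * i%:R / m%:R)))%:E)%E) =
    (fun m => (\sum_k u k m)%E).
  apply/funext => m; rewrite integral_sqnorm; last first.
    move=> k; have [_ mm _] := hJ k.
    under eq_fun do rewrite !mxE summxE.
    apply: measurable_funB => //; apply: measurable_sum => i.
    under eq_fun do rewrite mxE.
    by apply: measurable_funM => //; apply: measurable_funB; apply: mW; exact: tk0.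
  apply: eq_bigr => k _; apply: eq_integral => w _; congr (_ ^+ 2)%:E.
  rewrite !mxE summxE; congr (_ - _); apply: eq_bigr => i _; rewrite !mxE max_l//.
  exact: tk0.
have c0 : (fun m => (\sum_k u k m)%E) @ \oo --> (\sum_(k : 'I_n) 0%E)%E.
  apply: cvg_nnesum => k _; last by have [_ _ h] := hJ k; exact: h.
  by apply: nearW => m; apply: integral_ge0 => w _; rewrite lee_fin sqr_ge0.
by rewrite big1 in c0.
Qed.

(** * Closed-loop systems *)

Lemma wnorm_le_mul (R : realType) (m n : nat) (rho K : R) (f : R -> 'cV[R]_m) (g : R -> 'cV[R]_n) :
  mx_cont g -> 0 <= K ->
  (forall t, 0 <= t -> sqnorm (f t) <= K * sqnorm (g t)) -> (wnorm rho f <= K%:E * wnorm rho g)%E.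
Proof.
move=> cg K0 h; rewrite /wnorm.
have mg : measurable_fun (`[0, +oo[%classic : set R) (fun t => (wsq rho g t)%:E).
  by apply/measurable_EFinP; apply: measurable_funTS; apply: continuous_measurable_fun; exact: continuous_wsq.
rewrite -ge0_integralZl//; last by move=> t _; rewrite lee_fin wsq_ge0.
rewrite [leLHS]integral_mkcond [leRHS]integral_mkcond; apply: ge0_le_integral_nomeas => t.
  by rewrite /patch; case: ifPn => // _; rewrite lee_fin wsq_ge0.
rewrite /patch; case: ifPn => // tD; rewrite -EFinM lee_fin /wsq mulrCA ler_wpM2l ?expR_ge0// h//.
by move: tD; rewrite inE/= in_itv/= andbT.
Qed.

Lemma eq_wnorm (R : realType) (n : nat) (rho : R) (f g : R -> 'cV[R]_n) :
  (forall t, 0 <= t -> f t = g t) -> wnorm rho f = wnorm rho g.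
Proof.
move=> h; apply: eq_integral => t; rewrite inE/= in_itv/= andbT => t0.
by rewrite /wsq h.
Qed.

Lemma wnormMl_le (R : realType) (m n : nat) (rho : R) (M : 'M[R]_(m, n)) (g : R -> 'cV[R]_n) :
  mx_cont g -> (wnorm rho (fun t => M *m g t) <= (mxsq M)%:E * wnorm rho g)%E.
Proof.
by move=> cg; apply: wnorm_le_mul => //; [exact: mxsq_ge0|move=> t _; exact: sqnorm_mulmx].
Qed.

Lemma wnormD_le (R : realType) (n : nat) (rho : R) (f g : R -> 'cV[R]_n) :
  mx_cont f -> mx_cont g ->
  (wnorm rho (fun t => (f t + g t)%R) <= 2%:E * wnorm rho f + 2%:E * wnorm rho g)%E.
Proof.
move=> cf cg.
have mw (h : R -> 'cV[R]_n) : mx_cont h -> measurable_fun (`[0, +oo[%classic : set R) (fun t => (wsq rho h t)%:E).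
  by move=> ch; apply/measurable_EFinP; apply: measurable_funTS; apply: continuous_measurable_fun; exact: continuous_wsq.
have w0 (h : R -> 'cV[R]_n) t : (0 <= (wsq rho h t)%:E)%E by rewrite lee_fin wsq_ge0.
rewrite /wnorm -!ge0_integralZl//; try by [exact: mw|move=> t _; exact: w0].
rewrite -ge0_integralD//; try by [move=> t _; rewrite mule_ge0|apply: measurable_funeM; exact: mw].
rewrite [leLHS]integral_mkcond [leRHS]integral_mkcond; apply: ge0_le_integral_nomeas => t.
  by rewrite /patch; case: ifPn.
rewrite /patch; case: ifPn => // _; rewrite -!EFinM -EFinD lee_fin /wsq.
rewrite mulrCA [X in _ <= _ + X]mulrCA -mulrDr ler_wpM2l ?expR_ge0//.
exact: sqnormD_le.
Qed.

Lemma wnormMl_fin (R : realType) (m n : nat) (rho : R) (M : 'M[R]_(m, n)) (g : R -> 'cV[R]_n) :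
  mx_cont g -> (wnorm rho g < +oo)%E -> (wnorm rho (fun t => M *m g t) < +oo)%E.
Proof.
move=> cg fg; apply: le_lt_trans (wnormMl_le rho M cg) _.
by apply: lte_mul_pinfty => //; rewrite ?lee_fin ?mxsq_ge0.
Qed.

Lemma wnormD_fin (R : realType) (n : nat) (rho : R) (f g : R -> 'cV[R]_n) :
  mx_cont f -> mx_cont g -> (wnorm rho f < +oo)%E -> (wnorm rho g < +oo)%E ->
  (wnorm rho (fun t => f t + g t)%R < +oo)%E.
Proof.
move=> cf cg ff fg; apply: le_lt_trans (wnormD_le rho cf cg) _.
by apply: lte_add_pinfty; apply: lte_mul_pinfty.
Qed.

Lemma wnormN (R : realType) (n : nat) (rho : R) (f : R -> 'cV[R]_n) :
  wnorm rho (fun t => - f t) = wnorm rho f.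
Proof. by apply: eq_integral => t _; rewrite /wsq sqnormN. Qed.

Lemma wnorm_cst_fin (R : realType) (n : nat) (rho : R) (v : 'cV[R]_n) : 0 < rho ->
  (wnorm rho (fun=> v) < +oo)%E.
Proof.
move=> rho0; apply: le_lt_trans (_ : (rho^-1 * sqnorm v)%:E < +oo)%E; last exact: ltry.
have ce := @continuous_expw R rho.
apply: wnorm_le_prim => [|t t0]; first exact: mx_cont_cst.
have cw : continuous (wsq rho (fun=> v)) by apply: continuous_wsq; exact: mx_cont_cst.
pose F s := prim (wsq rho (fun=> v)) s + rho^-1 * sqnorm v * (expR (- (rho * s)) - 1).
have : F t = 0.
  apply: deriv0_zero => //.
  - move=> s; apply: cvgD; first exact: continuous_prim.
    by apply: cvgM; [exact: cvg_cst|apply: cvgB; [exact: ce|exact: cvg_cst]].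
  - by rewrite /F prim0 mulr0 oppr0 expR0 subrr mulr0 addr0.
  - move=> s s0.
    have d3 := is_deriveB (is_derive_expw rho s) (is_derive_cst (1 : R) s (1 : R)).
    have d4 := is_deriveMr (is_derive_cst (rho^-1 * sqnorm v) s (1 : R)) d3.
    have d5 := is_deriveD (is_derive_prim cw s0) d4.
    apply: is_derive_eq d5 _; rewrite /= /cst /wsq.
    by field; rewrite gt_eqF.
rewrite /F => Ft.
have : 0 <= rho^-1 * sqnorm v * expR (- (rho * t)).
  by rewrite !mulr_ge0 ?invr_ge0 ?(ltW rho0) ?expR_ge0 ?sqnorm_ge0.
lra.
Qed.

Lemma hurwitz_trmx (R : realType) (n : nat) (M : 'M[R]_n) : hurwitz M -> hurwitz M^T.
Proof.
by move=> hM z; rewrite /complex_eigenvalue -map_trmx eigenvalue_trmx; exact: hM.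
Qed.

Lemma posmax_C_half (R : realType) (n : nat) (rho : R) (g : R -> 'cV[R]_n) :
  C_half rho g -> mx_cont (fun t => g (Num.max t 0)) /\
  (wnorm rho (fun t => g (Num.max t 0)%R) < +oo)%E.
Proof.
move=> [cg fg]; split; first exact: posmax_mx_cont.
by rewrite (@eq_wnorm _ _ _ _ g)// => t t0; rewrite max_l.
Qed.

Lemma mx_cont_C_half (R : realType) (n : nat) (rho : R) (g : R -> 'cV[R]_n) :
  mx_cont g -> (wnorm rho g < +oo)%E -> C_half rho g.
Proof.
by move=> cg fg; split => //; apply: continuous_subspaceT; exact: mx_cont_continuous.
Qed.

(** The two equations decouple: [s] does not involve [xbar] and is obtained from infinity by
    [backward_solution], after which [xbar] solves a stable forward equation driven by [s]. *)
Lemma feedback_exists (R : realType) (n r : nat) (rho : R) (A G Gamma Q : 'M[R]_n)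
    (B : 'M[R]_(n, r)) (Rc : 'M[R]_r) (eta xbar0 : 'cV[R]_n) (f : R -> 'cV[R]_n) (Pi : 'M[R]_n) :
  0 < rho -> C_half rho f ->
  hurwitz (A + G - B *m invmx Rc *m B^T *m Pi - (rho / 2)%:M) ->
  exists s xbar : R -> 'cV[R]_n,
    [/\ C_half rho s, s_equation rho A G Gamma Q B Rc eta f Pi s,
        C_half rho xbar & xbar_equation A G B Rc f Pi s xbar xbar0].
Proof.
move=> rho0 hf; set M := A + G - _ => hM.
have [cf ff] := posmax_C_half hf.
set fm := fun t => f (Num.max t 0) in cf ff.
pose g t := (Q *m eta - Gamma^T *m Q *m eta) - Pi *m fm t.
have cPf : mx_cont (fun t => Pi *m fm t) by exact: (@mx_contMl _ _ _ _ Pi _ cf).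
have cg : mx_cont g by apply: (@mx_contB _ _ _ _ _ _ cPf); exact: mx_cont_cst.
have fg : (wnorm rho g < +oo)%E.
  apply: wnormD_fin; [exact: mx_cont_cst|exact: mx_contN|exact: wnorm_cst_fin|].
  by rewrite wnormN; exact: wnormMl_fin.
(* Solved for its derivative, the equation for [s] has the matrix [rho%:M - M^T]; its reflection at
   [rho / 2] is the transpose of the stable shifted matrix. *)
have hN : hurwitz ((rho / 2)%:M - (rho%:M - M^T)).
  have -> : (rho / 2)%:M - (rho%:M - M^T) = (M - (rho / 2)%:M)^T.
    have -> : rho%:M = (rho / 2)%:M + (rho / 2)%:M :> 'M[R]_n by rewrite -raddfD/= -splitr.
    have -> : (M - (rho / 2)%:M)^T = M^T - (rho / 2)%:M by rewrite linearB/= tr_scalar_mx.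
    move: (_%:M) (M^T) => a b.
    by apply/matrixP => i j; rewrite !mxE; ring.
  exact: hurwitz_trmx.
have [s [cs ds fs]] := backward_solution hN cg fg.
pose S := B *m invmx Rc *m B^T.
have cSs : mx_cont (fun t => S *m s t) by exact: (@mx_contMl _ _ _ _ S _ cs).
pose h t := fm t - S *m s t.
have ch : mx_cont h by exact: mx_contB.
have fh : (wnorm rho h < +oo)%E.
  apply: wnormD_fin => //; first exact: mx_contN.
  by rewrite wnormN; exact: wnormMl_fin.
pose xb := ode_sol M h xbar0.
have cxb : mx_cont xb by exact: mx_cont_ode_sol.
exists s, xb; split.
- exact: mx_cont_C_half.
- move=> t t0; have [d1 d2] := mx_deriv_derivable (ds t t0).
  split => //; rewrite d2 /g /fm max_l ?ltW//.
  rewrite mulmxBl mul_scalar_mx.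
  move: (rho *: s t) (M^T *m s t) (Pi *m f t) (Q *m eta) (Gamma^T *m Q *m eta) => a b c e1 e2.
  by apply/matrixP => i j; rewrite !mxE; ring.
- apply: mx_cont_C_half => //; have [C C0 hC] := lyapunov_wnorm hM.
  have hd t : 0 < t -> mx_deriv xb t (M *m xb t + h t) by exact: mx_deriv_ode_sol.
  apply: le_lt_trans (hC xb h cxb ch hd) _.
  by apply: lte_mul_pinfty => //; apply: lte_add_pinfty => //; exact: ltry.
- split; first exact: ode_sol0.
  move=> t t0; have hd : mx_deriv xb t (M *m xb t + h t) by exact: mx_deriv_ode_sol.
  have [d1 d2] := mx_deriv_derivable hd; split => //.
  rewrite d2 /M /h /fm max_l ?ltW// mulmxBl mulmxDr /S !mulmxA.
  move: ((A + G) *m xb t) (f t) (B *m invmx Rc *m B^T *m Pi *m xb t) (B *m invmx Rc *m B^T *m s t) => a b c e.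
  by apply/matrixP => i j; rewrite !mxE; ring.
Qed.

Lemma stabilizable_of_hurwitz (R : realType) (n r : nat) (rho : R) (A : 'M[R]_n)
    (B : 'M[R]_(n, r)) (Rc : 'M[R]_r) (X : 'M[R]_n) :
  hurwitz (A - B *m invmx Rc *m B^T *m X - (rho / 2)%:M) ->
  stabilizable (A - (rho / 2)%:M) B.
Proof.
move=> h; exists (- (invmx Rc *m B^T *m X)).
by rewrite mulmxN !mulmxA addrAC.
Qed.

Lemma tracking_weight_sym (R : realType) (n : nat) (Gamma Q : 'M[R]_n) : Q^T = Q ->
  ((1%:M - Gamma)^T *m Q *m (1%:M - Gamma))^T = (1%:M - Gamma)^T *m Q *m (1%:M - Gamma).
Proof. by move=> hQ; rewrite !trmx_mul trmxK hQ mulmxA. Qed.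

(** The preimages along [proj] form a sigma-algebra containing the generators. Independence on an
    extension is thereby reduced to events of the original space. *)
Lemma sigma_of_comp (K T T' : Type) (R : realType) (D : set K) (Y : K -> T -> R)
    (proj : T' -> T) (E : set T') :
  sigma_of D (fun k w => Y k (proj w)) E ->
  exists2 E0, sigma_of D Y E0 & E = proj @^-1` E0.
Proof.
have sa : sigma_algebra setT [set proj @^-1` E0 | E0 in sigma_of D Y].
  have [h0 hC hU] := smallest_sigma_algebra setT (\bigcup_(k in D) preimage_set_system setT (Y k) measurable).
  split.
  - by exists set0 => //; rewrite preimage_set0.
  - move=> _ [E0 hE0 <-]; exists (~` E0); first by rewrite -setTD; exact: hC.
    by rewrite setTD preimage_setC.
  - move=> F hF; have /choice[F0 hF0] : forall n, exists E0, sigma_of D Y E0 /\ proj @^-1` E0 = F n.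
      by move=> n; have [E0 h1 h2] := hF n; exists E0.
    exists (\bigcup_n F0 n); first by apply: hU => n; have [] := hF0 n.
    by rewrite preimage_bigcup; apply: eq_bigcupr => n _; have [] := hF0 n.
move=> hE; suff : [set proj @^-1` E0 | E0 in sigma_of D Y] E.
  by move=> [E0 h1 h2]; exists E0.
apply: hE; split; first exact: sa.
move=> _ [k Dk [B mB <-]]; exists (Y k @^-1` B); last by rewrite !setTI.
by apply: sub_gen_smallest; exists k => //; exists B => //; rewrite setTI.
Qed.

Lemma sigma_of_measurable d (T : measurableType d) (R : realType) (K : Type) (D : set K)
    (Y : K -> T -> R) (E : set T) : (forall k, D k -> measurable_fun setT (Y k)) ->
  sigma_of D Y E -> measurable E.
Proof.
move=> mY; apply: smallest_sub; first exact: sigma_algebra_measurable.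
by move=> _ [k Dk [B mB <-]]; exact: mY.
Qed.

Lemma extension_brownian d d' (T : measurableType d) (T' : measurableType d') (R : realType)
    (P : probability T R) (P' : probability T' R) (proj : T' -> T) (W : R -> T -> R) :
  extension P P' proj -> brownian_motion P W -> brownian_motion P' (fun t w => W t (proj w)).
Proof.
move=> [mp hp] [mW W0 ind law cW].
have ae (p : T -> Prop) : {ae P, forall w, p w} -> {ae P', forall w, p (proj w)}.
  move=> [A [mA A0 hA]]; exists (proj @^-1` A); split.
  - by rewrite -[X in measurable X]setTI; exact: mp.
  - by rewrite -[RHS]A0; apply: hp.
  - by move=> w hw; apply: hA.
have mE s (D := `[0, s]%classic : set R) E : sigma_of D W E -> measurable E.
  by apply: sigma_of_measurable => k; rewrite /D/= in_itv/= => /andP[k0 _]; exact: mW.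
split.
- by move=> t t0; apply: measurableT_comp => //; exact: mW.
- exact: (ae (fun w => W 0 w = 0)).
- move=> s t s0 st E1 E2 /sigma_of_comp[F1 h1 ->].
  move=> /(@sigma_of_comp _ _ _ _ _ (fun _ w => W t w - W s w))[F2 h2 ->].
  have m2 : measurable F2.
    apply: sigma_of_measurable h2 => _ _; apply: measurable_funB; apply: mW => //.
    by apply: le_trans s0 _; exact: ltW.
  have m1 := mE _ _ h1.
  rewrite -preimage_setI !hp//; last exact: measurableI.
  exact: (ind _ _ s0 st).
- move=> s t s0 st E mE'; rewrite -(law _ _ s0 st E mE') /pushforward -[RHS]hp//.
  rewrite -[X in measurable X]setTI; apply: measurable_funB => //; apply: mW => //.
  by apply: le_trans s0 _; exact: ltW.
- exact: (ae (fun w => {within `[0, +oo[, continuous (fun t => W t w)})).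
Qed.

(** * Stability of continuous and finite-cost processes under linear operations and equations *)

Lemma cont_procD d (T : measurableType d) (R : realType) (n : nat) (F G : R -> T -> 'cV[R]_n) :
  cont_proc F -> cont_proc G -> cont_proc (fun t w => F t w + G t w).
Proof.
move=> [c1 m1] [c2 m2]; split; first by move=> w; apply: mx_contD; [exact: c1|exact: c2].
move=> t k t0; rewrite (_ : (fun w => _) = fun w => F t w k 0 + G t w k 0).
  by apply: measurable_funD; [exact: m1|exact: m2].
by apply/funext => w; rewrite mxE.
Qed.

Lemma measurable_mulmx d (T : measurableType d) (R : realType) (m n : nat) (M : 'M[R]_(m, n))
    (G : T -> 'cV[R]_n) : (forall k, measurable_fun setT (fun w => G w k 0)) ->
  forall k, measurable_fun setT (fun w => (M *m G w) k 0).
Proof.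
move=> mG k; rewrite (_ : (fun w => _) = fun w => \sum_j M k j * G w j 0).
  by apply: measurable_sum => j; apply: measurable_funM.
by apply/funext => w; rewrite mxE.
Qed.

Lemma cont_procMl d (T : measurableType d) (R : realType) (m n : nat) (M : 'M[R]_(m, n))
    (G : R -> T -> 'cV[R]_n) : cont_proc G -> cont_proc (fun t w => M *m G t w).
Proof.
move=> [c1 m1]; split; first by move=> w; apply: (@mx_contMl _ _ _ _ M); exact: c1.
by move=> t k t0; apply: measurable_mulmx => j; exact: m1.
Qed.

Lemma cont_proc_det d (T : measurableType d) (R : realType) (n : nat) (g : R -> 'cV[R]_n) :
  mx_cont g -> cont_proc (fun t (_ : T) => g t).
Proof. by move=> cg; split => // t k _; exact: measurable_cst. Qed.

Lemma cont_proc_sum d (T : measurableType d) (R : realType) (n : nat) (I : Type) (r : seq I)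
    (G : I -> R -> T -> 'cV[R]_n) :
  (forall i, cont_proc (G i)) -> cont_proc (fun t w => \sum_(i <- r) G i t w).
Proof.
move=> hG; elim: r => [|i r IH].
  rewrite (_ : (fun t w => _) = fun t (_ : T) => 0); last first.
    by apply/funext => t; apply/funext => w; rewrite big_nil.
  by apply: cont_proc_det; exact: mx_cont_cst.
rewrite (_ : (fun t w => _) = fun t w => G i t w + \sum_(j <- r) G j t w).
  exact: cont_procD.
by apply/funext => t; apply/funext => w; rewrite big_cons.
Qed.

Lemma cont_proc_prim d (T : measurableType d) (R : realType) (n : nat)
    (G : R -> T -> 'cV[R]_n) : cont_proc G ->
  cont_proc (fun t w => mx_prim (fun s => G s w) t).
Proof.
move=> [c m]; split; first by move=> w; apply: mx_cont_prim; exact: c.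
move=> t k t0; rewrite (_ : (fun w => _) = fun w => prim (fun s => G s w k 0) t).
  by apply: (@measurable_prim _ _ _ (fun s w => G s w k 0)) => // [w|s s0]; [exact: c|exact: m].
by apply/funext => w; rewrite mxE.
Qed.

Lemma cont_proc_ode_sol d (T : measurableType d) (R : realType) (n : nat) (M : 'M[R]_n)
    (G : R -> T -> 'cV[R]_n) (z0 : T -> 'cV[R]_n) : cont_proc G ->
  (forall k, measurable_fun setT (fun w => z0 w k 0)) ->
  cont_proc (fun t w => ode_sol M (fun s => G s w) (z0 w) t).
Proof.
move=> cG mz; split; first by move=> w; apply: mx_cont_ode_sol; exact: cG.1.
move=> t k t0; rewrite /ode_sol; apply: measurable_mulmx => {}k.
have cF : cont_proc (fun s w => mx_exp M (- s) *m G s w).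
  split; first by move=> w; apply: mx_contM; [exact: mx_cont_expN|exact: cG.1].
  by move=> s i s0; apply: measurable_mulmx => j; exact: cG.2.
rewrite (_ : (fun w => _) = fun w => z0 w k 0 + mx_prim (fun s => mx_exp M (- s) *m G s w) t k 0).
  by apply: measurable_funD => //; exact: (cont_proc_prim cF).2.
by apply/funext => w; rewrite mxE.
Qed.

Definition fin_proc d (T : measurableType d) (R : realType) (P : probability T R) (n : nat)
    (rho : R) (G : R -> T -> 'cV[R]_n) :=
  cont_proc G /\ (\int[P]_w wnorm rho (fun t => G t w) < +oo)%E.

Lemma fin_procMl d (T : measurableType d) (R : realType) (P : probability T R) (m n : nat)
    (rho : R) (M : 'M[R]_(m, n)) (G : R -> T -> 'cV[R]_n) :
  fin_proc P rho G -> fin_proc P rho (fun t w => M *m G t w).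
Proof.
move=> [cG fG]; split; first exact: cont_procMl.
apply: (@le_lt_trans _ _ (\int[P]_w ((mxsq M)%:E * wnorm rho (fun t => G t w)))%E).
  apply: ge0_le_integral_nomeas => w; first exact: wnorm_ge0.
  by apply: wnormMl_le; exact: cG.1.
rewrite ge0_integralZl//; last 3 first.
- exact: measurable_wnorm.
- by move=> w _; exact: wnorm_ge0.
- by rewrite lee_fin mxsq_ge0.
by apply: lte_mul_pinfty => //; rewrite lee_fin mxsq_ge0.
Qed.

Lemma fin_procD d (T : measurableType d) (R : realType) (P : probability T R) (n : nat)
    (rho : R) (F G : R -> T -> 'cV[R]_n) :
  fin_proc P rho F -> fin_proc P rho G -> fin_proc P rho (fun t w => F t w + G t w).
Proof.
move=> [cF fF] [cG fG]; split; first exact: cont_procD.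
apply: (@le_lt_trans _ _ (\int[P]_w (2%:E * wnorm rho (fun t => F t w) + 2%:E * wnorm rho (fun t => G t w)))%E).
  apply: ge0_le_integral_nomeas => w; first exact: wnorm_ge0.
  by apply: wnormD_le; [exact: cF.1|exact: cG.1].
have mw (H : R -> T -> 'cV[R]_n) : cont_proc H -> measurable_fun setT (fun w => wnorm rho (fun t => H t w)).
  exact: measurable_wnorm.
have w0 (H : R -> T -> 'cV[R]_n) w : (0 <= wnorm rho (fun t => H t w))%E by exact: wnorm_ge0.
rewrite ge0_integralD//; last 4 first.
- by move=> w _; exact: mule_ge0.
- by apply: measurable_funeM; exact: mw.
- by move=> w _; exact: mule_ge0.
- by apply: measurable_funeM; exact: mw.
rewrite !ge0_integralZl//; try exact: mw.
have h2 : (0 <= 2%:E :> \bar R)%E by rewrite lee_fin.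
exact: (lte_add_pinfty (lte_mul_pinfty h2 isT fF) (lte_mul_pinfty h2 isT fG)).
Qed.

Lemma fin_proc_det d (T : measurableType d) (R : realType) (P : probability T R) (n : nat)
    (rho : R) (g : R -> 'cV[R]_n) : mx_cont g -> (wnorm rho g < +oo)%E ->
  fin_proc P rho (fun t _ => g t).
Proof.
move=> cg fg; split; first exact: cont_proc_det.
have f0 : wnorm rho g \is a fin_num by rewrite ge0_fin_numE ?wnorm_ge0.
by rewrite -(fineK f0) integral_cst//= [X in (_ * X)%E]probability_setT mule1 ltry.
Qed.

Lemma fin_proc_sum d (T : measurableType d) (R : realType) (P : probability T R) (n : nat)
    (rho : R) (I : Type) (r : seq I) (G : I -> R -> T -> 'cV[R]_n) : 0 < rho ->
  (forall i, fin_proc P rho (G i)) -> fin_proc P rho (fun t w => \sum_(i <- r) G i t w).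
Proof.
move=> rho0 hG; elim: r => [|i r IH].
  rewrite (_ : (fun t w => _) = fun t (_ : T) => 0); last first.
    by apply/funext => t; apply/funext => w; rewrite big_nil.
  by apply: fin_proc_det; [exact: mx_cont_cst|exact: wnorm_cst_fin].
rewrite (_ : (fun t w => _) = fun t w => G i t w + \sum_(j <- r) G j t w).
  exact: (fin_procD (hG i) IH).
by apply/funext => t; apply/funext => w; rewrite big_cons.
Qed.

(** The pathwise Lyapunov estimate has a constant common to all outcomes, so it can be integrated
    against [P]. *)
Lemma fin_proc_ode d (T : measurableType d) (R : realType) (P : probability T R) (n : nat)
    (rho : R) (M : 'M[R]_n) (z g : R -> T -> 'cV[R]_n) :
  hurwitz (M - (rho / 2)%:M) -> cont_proc z -> fin_proc P rho g ->
  (forall w t, 0 < t -> mx_deriv (fun t => z t w) t (M *m z t w + g t w)) ->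
  (\int[P]_w (sqnorm (z 0 w))%:E < +oo)%E -> fin_proc P rho z.
Proof.
move=> hM cz [cg fg] dz z0; split; first exact: cz.
have [C C0 hC] := lyapunov_wnorm hM.
apply: (@le_lt_trans _ _ (\int[P]_w (C%:E * ((sqnorm (z 0 w))%:E + wnorm rho (fun t => g t w))))%E).
  apply: ge0_le_integral_nomeas => w; first exact: wnorm_ge0.
  by apply: hC; [exact: cz.1|exact: cg.1|exact: dz].
have ms : measurable_fun setT (fun w => (sqnorm (z 0 w))%:E).
  by apply/measurable_EFinP; apply: measurable_sqnorm => k; exact: cz.2.
have mw := measurable_wnorm rho cg.
have s0 w : (0 <= (sqnorm (z 0 w))%:E)%E by rewrite lee_fin sqnorm_ge0.
have w0 w : (0 <= wnorm rho (fun t => g t w))%E by exact: wnorm_ge0.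
rewrite ge0_integralZl//; last 2 first.
- exact: emeasurable_funD.
- by move=> w _; exact: adde_ge0.
rewrite ge0_integralD//.
apply: lte_mul_pinfty => //; exact: lte_add_pinfty.
Qed.

Lemma mx_deriv_sum (R : realType) (m n : nat) (I : Type) (r : seq I) (F : I -> R -> 'M[R]_(m, n))
    (D : I -> 'M[R]_(m, n)) (t : R) : (forall i, mx_deriv (F i) t (D i)) ->
  mx_deriv (fun s => \sum_(i <- r) F i s) t (\sum_(i <- r) D i).
Proof.
move=> h a b; rewrite summxE (_ : (fun s => _) = fun s => \sum_(i <- r) F i s a b).
  by apply: is_derive_bigsum => i; exact: h.
by apply/funext => s; rewrite summxE.
Qed.

Lemma sqnorm_sum_le (R : realType) (n N : nat) (v : 'I_N -> 'cV[R]_n) :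
  sqnorm (\sum_j v j) <= N%:R * \sum_j sqnorm (v j).
Proof.
rewrite /sqnorm exchange_big/= big_distrr/=; apply: ler_sum => k _; rewrite summxE.
have -> : \sum_j v j k 0 = \sum_j 1 * v j k 0 by apply: eq_bigr => j _; rewrite mul1r.
apply: le_trans (sqr_sum_mul_le (fun _ : 'I_N => 1) (fun j => v j k 0)) _.
by rewrite expr1n sumr_const card_ord.
Qed.

Lemma control_lawE (R : realType) (n r : nat) (B : 'M[R]_(n, r)) (Rc : 'M[R]_r)
    (A X Pi : 'M[R]_n) (s xbar : R -> 'cV[R]_n) (t : R) (x : 'cV[R]_n) :
  A *m x + B *m control_law B Rc X Pi s xbar t x =
  (A - B *m invmx Rc *m B^T *m X) *m x -
    B *m invmx Rc *m B^T *m ((Pi - X) *m xbar t + s t).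
Proof.
rewrite /control_law -[X *m x + _ + _]addrA; move: (_ *m xbar t + s t) => y.
by rewrite mulmxN !mulmxA mulmxDr mulmxBl !mulmxA opprD addrA.
Qed.

Lemma mean_scalar (R : realType) (n N : nat) (v : 'I_N -> 'cV[R]_n) :
  empirical_mean v = (N%:R^-1)%:M *m \sum_j v j.
Proof. by rewrite mul_scalar_mx. Qed.

Lemma empirical_meanD (R : realType) (n N : nat) (u v : 'I_N -> 'cV[R]_n) :
  empirical_mean (fun j => u j + v j) = empirical_mean u + empirical_mean v.
Proof. by rewrite /empirical_mean big_split/= scalerDr. Qed.

Lemma empirical_mean_cst (R : realType) (n N : nat) (v : 'cV[R]_n) : (0 < N)%N ->
  empirical_mean (fun _ : 'I_N => v) = v.
Proof.
move=> N0; rewrite /empirical_mean sumr_const card_ord -(scaler_nat N v) scalerA mulVf ?scale1r//.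
by rewrite pnatr_eq0 -lt0n.
Qed.

Lemma empirical_meanMl (R : realType) (n N : nat) (M : 'M[R]_n) (v : 'I_N -> 'cV[R]_n) :
  empirical_mean (fun j => M *m v j) = M *m empirical_mean v.
Proof. by rewrite /empirical_mean -mulmx_sumr scalemxAr. Qed.

Lemma closed_loop_cost_fin d (T : measurableType d) (R : realType) (P : probability T R)
    (n r N : nat) (rho : R) (A G : 'M[R]_n) (B : 'M[R]_(n, r)) (Rc : 'M[R]_r)
    (f sigma : R -> 'cV[R]_n) (X Pi : 'M[R]_n) (s xbar : R -> 'cV[R]_n)
    (W : 'I_N -> R -> T -> R) (x0 : 'I_N -> T -> 'cV[R]_n) (x : 'I_N -> R -> T -> 'cV[R]_n) :
  let Abar := A - B *m invmx Rc *m B^T *m X in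
  (0 < N)%N -> 0 < rho ->
  hurwitz (Abar - (rho / 2)%:M) -> hurwitz (Abar + G - (rho / 2)%:M) ->
  C_half rho f -> C_half rho sigma -> C_half rho s -> C_half rho xbar ->
  (forall i, brownian_motion P (W i)) ->
  (forall i k, measurable_fun setT (fun w => x0 i w k 0)) ->
  (forall i, \int[P]_w (sqnorm (x0 i w))%:E < +oo)%E ->
  closed_loop P A G B f sigma W (control_law B Rc X Pi s xbar) x0 x ->
  (total_cost P rho (control_law B Rc X Pi s xbar) x < +oo)%E.
Proof.
move=> Abar N0 rho0 hA hAG hf hsigma hs hxb bm mx0 fx0 [mx cx wx].
have [cf ff] := posmax_C_half hf; have [cs fs] := posmax_C_half hs.
have [cb fb] := posmax_C_half hxb; have [csg fsg] := posmax_C_half hsigma.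
set fm := fun t => f (Num.max t 0) in cf ff.
set sm := fun t => s (Num.max t 0) in cs fs.
set bm' := fun t => xbar (Num.max t 0) in cb fb.
set sgm := fun t => sigma (Num.max t 0) in csg fsg.
pose S := B *m invmx Rc *m B^T.
pose Y i t w := x i (Num.max t 0) w.
have cY i : cont_proc (Y i).
  split; first by move=> w; exact: (@posmax_mx_cont _ _ (fun t => x i t w) (cx i w)).
  by move=> t k t0; rewrite /Y max_l//; exact: mx.
pose q t := (Pi - X) *m bm' t + sm t.
have cq : mx_cont q by apply: mx_contD => //; exact: (@mx_contMl _ _ _ _ (Pi - X) _ cb).
have fq : (wnorm rho q < +oo)%E.
  by apply: wnormD_fin => //; [exact: (@mx_contMl _ _ _ _ (Pi - X) _ cb)|exact: wnormMl_fin].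
pose b t := fm t - S *m q t.
have cSq : mx_cont (fun t => S *m q t) by exact: (@mx_contMl _ _ _ _ S _ cq).
have cbb : mx_cont b by exact: mx_contB.
have fbb : (wnorm rho b < +oo)%E.
  apply: wnormD_fin => //; first exact: mx_contN.
  by rewrite wnormN; exact: wnormMl_fin.
pose Mn : 'M[R]_n := (N%:R^-1)%:M.
pose mean (F : 'I_N -> R -> T -> 'cV[R]_n) t w := Mn *m \sum_j F j t w.
have meanE F t w : mean F t w = empirical_mean (fun j => F j t w) by rewrite mean_scalar.
pose dr i t w := Abar *m Y i t w + G *m mean Y t w + b t.
have cmean (F : 'I_N -> R -> T -> 'cV[R]_n) : (forall j, cont_proc (F j)) -> cont_proc (mean F).
  by move=> hF; apply: cont_procMl; exact: cont_proc_sum.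
have fmean (F : 'I_N -> R -> T -> 'cV[R]_n) : (forall j, fin_proc P rho (F j)) -> fin_proc P rho (mean F).
  by move=> hF; apply: fin_procMl; exact: fin_proc_sum.
have cdr i : cont_proc (dr i).
  apply: cont_procD; last exact: cont_proc_det.
  by apply: cont_procD; apply: cont_procMl => //; exact: cmean.
have drE i t w : 0 <= t -> dr i t w = A *m x i t w + B *m control_law B Rc X Pi s xbar t (x i t w)
    + G *m empirical_mean (fun j => x j t w) + f t.
  move=> t0; rewrite control_lawE /dr meanE /b /q /Y /fm /sm /bm' !(max_l t0) -/Abar -/S.
  move: (Abar *m _) (G *m _) (S *m _) => a1 a2 a3.
  by apply/matrixP => i' j'; rewrite !mxE; ring.
pose z i t w := x0 i w + mx_prim (fun t => dr i t w) t.
have cz i : cont_proc (z i).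
  have [c m] := cont_proc_prim (cdr i); split.
    by move=> w; apply: (@mx_contD _ _ _ (fun=> x0 i w)); [exact: mx_cont_cst|exact: c].
  move=> t k t0; rewrite (_ : (fun w => _) = fun w => x0 i w k 0 + mx_prim (fun t => dr i t w) t k 0).
    by apply: measurable_funD; [exact: mx0|exact: m].
  by apply/funext => w; rewrite mxE.
(* The noise is defined from the given process rather than constructed: it inherits continuity and
   measurability from the states, and the last clause of [closed_loop] says exactly that it is a
   version of the Wiener integral. *)
pose J i t w := Y i t w - z i t w.
have cJ i : cont_proc (J i).
  have := cont_procD (cY i) (cont_procMl (-1)%:M (cz i)).
  congr cont_proc; apply/funext => t; apply/funext => w.
  by rewrite mul_scalar_mx scaleN1r.
have wJ i t : 0 <= t -> is_wiener_integral P (W i) sigma t (J i t).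
  move=> t0; have := wx i t t0; congr is_wiener_integral; apply/funext => w.
  rewrite /J /z /Y (max_l t0) opprD addrA; congr (_ - _).
  apply/matrixP => k j; rewrite !mxE ord1 primE//; last first.
    by have := (cdr i).1 w k 0.
  apply: eq_Rintegral => tau; rewrite inE/= in_itv/= => /andP[tau0 _].
  by rewrite drE.
have csq : continuous (fun t => sqnorm (sgm t)) by exact: continuous_sqnorm.
have fJ i : fin_proc P rho (J i).
  split; first exact: cJ.
  apply: (@noise_wnorm_fin _ _ _ P n rho (4 * gauss2 R) (fun t => sqnorm (sgm t))) => //.
  - by rewrite mulr_ge0// gauss2_ge0.
  - by move=> t; exact: sqnorm_ge0.
  - by move=> t t0; exact: (wiener_vec_bound (bm i) csg t0 (fun k => (cJ i).2 t k t0) (wJ i t t0)).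
have YE i t w : Y i t w = z i t w + J i t w by rewrite /J addrC subrK.
have dz i w t : 0 < t -> mx_deriv (fun t => z i t w) t (dr i t w).
  move=> t0; apply: (@mx_deriv_eq _ _ _ _ _ (0 + dr i t w)); last by rewrite add0r.
  apply: mx_derivD; first exact: mx_deriv_cst.
  by apply: mx_deriv_prim => //; exact: (cdr i).1.
have z0 i w : z i 0 w = x0 i w by rewrite /z mx_prim0 addr0.
have meanY t w : mean Y t w = mean z t w + mean J t w.
  by rewrite -mulmxDr -big_split/=; congr (_ *m _); apply: eq_bigr => j _; exact: YE.
have mean_dr t w : Mn *m \sum_j dr j t w = (Abar + G) *m mean Y t w + b t.
  rewrite -mean_scalar /dr empirical_meanD empirical_meanD empirical_meanMl.
  by rewrite !(empirical_mean_cst _ N0) -meanE (mulmxDl Abar G).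
(* Averaging closes the coupled system, since the mean obeys an equation in which single agents do
   not occur. Once it is controlled, it acts on each agent as a forcing of finite norm. *)
have fzm : fin_proc P rho (mean z).
  apply: (@fin_proc_ode _ _ _ _ _ _ (Abar + G) _ (fun t w => (Abar + G) *m mean J t w + b t)) => //.
  - exact: cmean.
  - apply: fin_procD; last exact: fin_proc_det.
    by apply: fin_procMl; exact: fmean.
  - move=> w t t0; apply: (@mx_deriv_eq _ _ _ _ _ (Mn *m \sum_j dr j t w)).
      by apply: mx_derivMl; apply: mx_deriv_sum => j; exact: dz.
    by rewrite mean_dr meanY (mulmxDr (Abar + G) (mean z t w)) -addrA.
  - apply: (@le_lt_trans _ _ (\int[P]_w ((mxsq Mn * N%:R)%:E * \sum_j (sqnorm (x0 j w))%:E))%E).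
      apply: ge0_le_integral_nomeas => w; first by rewrite lee_fin sqnorm_ge0.
      rewrite sumEFin -EFinM lee_fin -mulrA; apply: le_trans (sqnorm_mulmx _ _) _.
      rewrite ler_wpM2l ?mxsq_ge0//; under eq_bigr do rewrite z0.
      exact: sqnorm_sum_le.
    have ms j : measurable_fun setT (fun w => (sqnorm (x0 j w))%:E).
      by apply/measurable_EFinP; apply: measurable_sqnorm => k; exact: mx0.
    rewrite ge0_integralZl//; last 3 first.
    + by apply: emeasurable_sum => j; exact: ms.
    + by move=> w _; apply: sume_ge0 => j _; rewrite lee_fin sqnorm_ge0.
    + by rewrite lee_fin mulr_ge0// mxsq_ge0.
    rewrite ge0_integral_sum//; last by move=> j w _; rewrite lee_fin sqnorm_ge0.
    apply: lte_mul_pinfty => //; first by rewrite lee_fin mulr_ge0// mxsq_ge0.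
    by apply: lte_sum_pinfty => j _; exact: fx0.
have fz i : fin_proc P rho (z i).
  pose gi t w := Abar *m J i t w + G *m (mean z t w + mean J t w) + b t.
  have h1 : fin_proc P rho (fun t w => Abar *m J i t w) := fin_procMl _ (fJ i).
  have h2 : fin_proc P rho (fun t w => G *m (mean z t w + mean J t w)).
    exact: (fin_procMl G (fin_procD fzm (fmean _ fJ))).
  have h3 : fin_proc P rho gi := fin_procD (fin_procD h1 h2) (fin_proc_det P cbb fbb).
  have h4 w t : 0 < t -> mx_deriv (fun t => z i t w) t (Abar *m z i t w + gi t w).
    move=> t0; apply: (mx_deriv_eq (dz i w t t0)).
    by rewrite /dr YE meanY (mulmxDr Abar (z i t w)) -!(addrA (Abar *m z i t w)).
  have h5 : (\int[P]_w (sqnorm (z i 0 w))%:E < +oo)%E.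
    rewrite (_ : (fun w => _) = (fun w => (sqnorm (x0 i w))%:E)); first exact: fx0.
    by apply/funext => w; rewrite z0.
  exact: (fin_proc_ode hA (cz i) h3 h4 h5).
have fY i : fin_proc P rho (Y i).
  have := fin_procD (fz i) (fJ i); congr fin_proc.
  by apply/funext => t; apply/funext => w; rewrite YE.
pose U i t w := - (invmx Rc *m B^T) *m (X *m Y i t w + q t).
have fU i : fin_proc P rho (U i).
  by apply: fin_procMl; apply: fin_procD; [exact: (fin_procMl _ (fY i))|exact: fin_proc_det].
rewrite /total_cost; apply: lte_sum_pinfty => i _.
apply: (@le_lt_trans _ _ (\int[P]_w (wnorm rho (fun t => Y i t w) + wnorm rho (fun t => U i t w)))%E).
  apply: ge0_le_integral_nomeas => w.
    by apply: integral_ge0 => t _; rewrite lee_fin mulr_ge0 ?expR_ge0// addr_ge0 ?sqnorm_ge0.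
  have mw m (h : R -> 'cV[R]_m) : mx_cont h -> measurable_fun (`[0, +oo[%classic : set R) (fun t => (wsq rho h t)%:E).
    by move=> ch; apply/measurable_EFinP; apply: measurable_funTS; apply: continuous_measurable_fun; exact: continuous_wsq.
  rewrite /wnorm -ge0_integralD//; last 4 first.
  + by move=> t _; rewrite lee_fin wsq_ge0.
  + by apply: mw; exact: (cY i).1.
  + by move=> t _; rewrite lee_fin wsq_ge0.
  + by apply: mw; exact: (fU i).1.1.
  rewrite le_eqVlt; apply/orP; left; apply/eqP; apply: eq_integral => t.
  rewrite inE/= in_itv/= andbT => t0.
  have e1 : Y i t w = x i t w by rewrite /Y max_l.
  have e2 : U i t w = control_law B Rc X Pi s xbar t (x i t w).
    by rewrite /U e1 /control_law /q /sm /bm' !(max_l t0) mulNmx addrA.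
  by rewrite /wsq e1 e2 -EFinD mulrDr.
rewrite ge0_integralD//; last 4 first.
- by move=> w _; exact: wnorm_ge0.
- exact: measurable_wnorm (cY i).
- by move=> w _; exact: wnorm_ge0.
- exact: measurable_wnorm (fU i).1.
exact: (lte_add_pinfty (fY i).2 (fU i).2).
Qed.

(** * Constructing a closed loop and perturbing it by a coin *)

Lemma coin_extension_exists d (T : measurableType d) (R : realType) (P : probability T R) :
  exists P1 : probability (T * bool)%type R,
    [/\ extension P P1 fst,
     forall (A : set T) (B : set bool), measurable A ->
       P1 (fst @^-1` A `&` snd @^-1` B) = (P1 (fst @^-1` A) * P1 (snd @^-1` B))%E &
     forall f : T * bool -> \bar R, measurable_fun setT f -> (forall p, 0 <= f p)%E ->
       (\int[P1]_p f p = \int[P]_w ((2^-1)%:E * f (w, true) + (2^-1)%:E * f (w, false)))%E].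
Proof.
pose Q : probability bool R := bernoulli_prob (2^-1 : R).
have m1 : (P \x Q)%E setT = 1%E.
  by rewrite -setXTT product_measure1E//= !probability_setT mule1.
pose P1 : probability (T * bool)%type R := HB.pack (P \x Q)%E (Measure_isProbability.Build _ _ _ (P \x Q)%E m1).
have P1E (A : set T) (B : set bool) : measurable A -> P1 (A `*` B) = (P A * Q B)%E.
  by move=> mA; rewrite /P1/= product_measure1E.
have preE (A : set T) (B : set bool) : fst @^-1` A `&` snd @^-1` B = A `*` B :> set (T * bool).
  by apply/seteqP; split => -[a b].
have fE (A : set T) : measurable A -> P1 (fst @^-1` A) = P A.
  by move=> mA; rewrite -[X in P1 X]setIT -[X in _ `&` X](preimage_setT (@snd T bool)) preE P1E// probability_setT mule1.
have sE (B : set bool) : P1 (snd @^-1` B) = Q B.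
  by rewrite -[X in P1 X]setTI -[X in X `&` _](preimage_setT (@fst T bool)) preE P1E// probability_setT mul1e.
exists P1; split.
- by split => //; exact: measurable_fst.
- by move=> A B mA; rewrite fE// sE preE P1E.
- move=> f mf f0; rewrite /P1/= fubini_tonelli1//; apply: eq_integral => w _.
  have half : (1 - 2^-1 : R) = 2^-1 by lra.
  rewrite /fubini_F integral_bernoulli_prob//.
    by congr (_ + _%:E * _)%E; exact: half.
  by rewrite invr_ge0 invf_le1// ler0n ler1n.
Qed.

Lemma empirical_mean_affine (R : realType) (n N : nat) (A G : 'M[R]_n)
    (z J : 'I_N -> 'cV[R]_n) (m k b : 'cV[R]_n) : (0 < N)%N ->
  empirical_mean (fun j => A *m z j + (G *m m + (A *m J j + G *m k + b))) =
  A *m empirical_mean z + (G *m m + (A *m empirical_mean J + G *m k + b)).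
Proof.
move=> N0; rewrite empirical_meanD empirical_meanMl; congr (_ + _).
rewrite empirical_meanD (empirical_mean_cst _ N0); congr (_ + _).
rewrite empirical_meanD (empirical_mean_cst _ N0); congr (_ + _).
by rewrite empirical_meanD (empirical_mean_cst _ N0) empirical_meanMl.
Qed.

(* The mean [m] is solved first; the agents driven by [m] have empirical mean [m] by uniqueness. *)
Lemma closed_loop_of_noise d (T : measurableType d) (R : realType) (P : probability T R)
    (n r N : nat) (A G : 'M[R]_n) (B : 'M[R]_(n, r)) (Rc : 'M[R]_r)
    (f sigma : R -> 'cV[R]_n) (X Pi : 'M[R]_n) (s xbar : R -> 'cV[R]_n)
    (W : 'I_N -> R -> T -> R) (x0 : 'I_N -> T -> 'cV[R]_n) (J : 'I_N -> R -> T -> 'cV[R]_n) :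
  let Abar := A - B *m invmx Rc *m B^T *m X in
  (0 < N)%N ->
  mx_cont (fun t => f (Num.max t 0)) -> mx_cont (fun t => s (Num.max t 0)) ->
  mx_cont (fun t => xbar (Num.max t 0)) ->
  (forall i k, measurable_fun setT (fun w => x0 i w k 0)) ->
  (forall i, cont_proc (J i)) ->
  (forall i t, 0 <= t -> is_wiener_integral P (W i) sigma t (J i t)) ->
  exists (x : 'I_N -> R -> T -> 'cV[R]_n) (b : R -> 'cV[R]_n),
  [/\ closed_loop P A G B f sigma W (control_law B Rc X Pi s xbar) x0 x,
      forall i, cont_proc (x i), forall i w, x i 0 w = x0 i w + J i 0 w &
      forall i w t, 0 < t -> mx_deriv (fun t => x i t w - J i t w) t
        (Abar *m x i t w + G *m empirical_mean (fun j => x j t w) + b t)].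
Proof.
move=> Abar N0 cf cs cb mx0 cJ wJ.
set fm := fun t => f (Num.max t 0) in cf.
set sm := fun t => s (Num.max t 0) in cs.
set bm' := fun t => xbar (Num.max t 0) in cb.
pose S := B *m invmx Rc *m B^T.
pose q t := (Pi - X) *m bm' t + sm t.
have cq : mx_cont q by apply: mx_contD => //; exact: (@mx_contMl _ _ _ _ (Pi - X) _ cb).
have cSq : mx_cont (fun t => S *m q t) by exact: (@mx_contMl _ _ _ _ S _ cq).
pose b t := fm t - S *m q t.
have cbb : mx_cont b by exact: mx_contB.
pose Mn : 'M[R]_n := (N%:R^-1)%:M.
pose mean (F : 'I_N -> R -> T -> 'cV[R]_n) t w := Mn *m \sum_j F j t w.
have meanE F t w : mean F t w = empirical_mean (fun j => F j t w) by rewrite mean_scalar.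
have cmean (F : 'I_N -> R -> T -> 'cV[R]_n) : (forall j, cont_proc (F j)) -> cont_proc (mean F).
  by move=> hF; apply: cont_procMl; exact: cont_proc_sum.
have cdb : cont_proc (fun t (_ : T) => b t) := cont_proc_det T cbb.
pose gm t w := (Abar + G) *m mean J t w + b t.
have cgm : cont_proc gm := cont_procD (cont_procMl (Abar + G) (cmean _ cJ)) cdb.
pose m0 w := Mn *m \sum_j x0 j w.
have mm0 k : measurable_fun setT (fun w => m0 w k 0).
  apply: measurable_mulmx => {}k; rewrite (_ : (fun w => _) = fun w => \sum_j x0 j w k 0).
    by apply: measurable_sum => j; exact: mx0.
  by apply/funext => w; rewrite summxE.
pose m t w := ode_sol (Abar + G) (fun t => gm t w) (m0 w) t.
have cm : cont_proc m := cont_proc_ode_sol (Abar + G) cgm mm0.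
pose gz i t w := G *m m t w + (Abar *m J i t w + G *m mean J t w + b t).
have cgz i : cont_proc (gz i).
  apply: (cont_procD (cont_procMl G cm)); apply: (fun h => cont_procD h cdb).
  exact: (cont_procD (cont_procMl Abar (cJ i)) (cont_procMl G (cmean _ cJ))).
pose z i t w := ode_sol Abar (fun t => gz i t w) (x0 i w) t.
have cz i : cont_proc (z i) := cont_proc_ode_sol Abar (cgz i) (mx0 i).
have dz i w t : 0 < t -> mx_deriv (fun t => z i t w) t (Abar *m z i t w + gz i t w).
  by move=> t0; apply: mx_deriv_ode_sol => //; exact: (cgz i).1.
have dm w t : 0 < t -> mx_deriv (fun t => m t w) t ((Abar + G) *m m t w + gm t w).
  by move=> t0; apply: mx_deriv_ode_sol => //; exact: cgm.1.
have zm t w : 0 <= t -> mean z t w = m t w.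
  move=> t0; apply/eqP; rewrite -subr_eq0; apply/eqP.
  apply: (ode_unique0 (M := Abar) (z := fun t => mean z t w - m t w)) => //.
  - by apply: mx_contB; [exact: (cmean _ cz).1|exact: cm.1].
  - rewrite /m ode_sol0 /m0 /mean (eq_bigr (fun j => x0 j w)) ?subrr// => j _.
    exact: ode_sol0.
  - move=> u u0; apply: (@mx_deriv_eq _ _ _ _ _ (Mn *m \sum_j (Abar *m z j u w + gz j u w) -
        ((Abar + G) *m m u w + gm u w))).
      by apply: mx_derivB; [apply: mx_derivMl; apply: mx_deriv_sum => j; exact: dz|exact: dm].
    rewrite -mean_scalar /gz (empirical_mean_affine Abar G (z ^~ u ^~ w) (J ^~ u ^~ w) _ _ _ N0).
    rewrite -!meanE /gm (mulmxBr Abar (mean z u w)) !(mulmxDl Abar G).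
    move: (Abar *m mean z u w) (Abar *m m u w) (G *m m u w) (Abar *m mean J u w) (G *m mean J u w) (b u) => a1 a2 a3 a4 a5 a6.
    by apply/matrixP => i' j'; rewrite !mxE; ring.
(* The hypotheses do not make [J] vanish at time 0 for every outcome, so the state starts at
   [x0 i w + J i 0 w]. The extra term does not depend on the coin and will cancel in differences. *)
pose x i t w := z i t w + J i t w.
have cx i : cont_proc (x i) := cont_procD (cz i) (cJ i).
have meanx t w : 0 <= t -> mean x t w = m t w + mean J t w.
  by move=> t0; rewrite -zm// /mean -mulmxDr -big_split.
pose dr i t w := Abar *m x i t w + G *m mean x t w + b t.
have cdr i : cont_proc (dr i).
  apply: (fun h => cont_procD h cdb).
  exact: (cont_procD (cont_procMl Abar (cx i)) (cont_procMl G (cmean _ cx))).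
have drz i t w : 0 <= t -> Abar *m z i t w + gz i t w = dr i t w.
  move=> t0; rewrite /dr meanx// /x /gz (mulmxDr Abar) (mulmxDr G).
  move: (Abar *m z i t w) (G *m m t w) (Abar *m J i t w) (G *m mean J t w) (b t) => a1 a2 a3 a4 a5.
  by apply/matrixP => i' j'; rewrite !mxE; ring.
have dzr i w t : 0 < t -> mx_deriv (fun t => z i t w) t (dr i t w).
  by move=> t0; apply: (mx_deriv_eq (dz i w t t0)); apply: drz; exact: ltW.
have zE i t w : 0 <= t -> z i t w = x0 i w + mx_prim (fun t => dr i t w) t.
  move=> t0; apply/eqP; rewrite -subr_eq0; apply/eqP.
  pose h t := z i t w - (x0 i w + mx_prim (fun t => dr i t w) t).
  have ch : mx_cont h.
    apply: mx_contB; first exact: (cz i).1.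
    by apply: (@mx_contD _ _ _ (fun=> x0 i w)); [exact: mx_cont_cst|apply: mx_cont_prim; exact: (cdr i).1].
  have dh u : 0 < u -> mx_deriv h u 0.
    move=> u0; apply: (@mx_deriv_eq _ _ _ _ _ (dr i u w - (0 + dr i u w))); last by rewrite add0r subrr.
    apply: mx_derivB; first exact: dzr.
    apply: (@mx_derivD _ _ _ (fun=> x0 i w)); first exact: mx_deriv_cst.
    by apply: mx_deriv_prim => //; exact: (cdr i).1.
  rewrite -[LHS]/(h t) (mx_deriv0_constant t0 ch dh) /h mx_prim0 addr0 /z ode_sol0.
  exact: subrr.
have drE i t w : 0 <= t -> dr i t w = A *m x i t w + B *m control_law B Rc X Pi s xbar t (x i t w)
    + G *m empirical_mean (fun j => x j t w) + f t.
  move=> t0; rewrite control_lawE /dr meanE /b /q /fm /sm /bm' !(max_l t0) -/Abar -/S.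
  move: (Abar *m _) (G *m _) (S *m _) => a1 a2 a3.
  by apply/matrixP => i' j'; rewrite !mxE; ring.
exists x, b; split => //.
- split.
  + by move=> i t k t0; exact: (cx i).2.
  + by move=> i w; apply: continuous_subspaceT; apply: mx_cont_continuous; exact: (cx i).1.
  + move=> i t t0; have := wJ i t t0; congr is_wiener_integral; apply/funext => w.
    rewrite /x zE// -!addrA [X in _ = X]addrC -!addrA.
    rewrite (_ : (\col_k _) = mx_prim (fun t => dr i t w) t).
      by move: (x0 i w) (mx_prim _ t) (J i t w) => a1 a2 a3; apply/matrixP => i' j'; rewrite !mxE; ring.
    apply/matrixP => k j; rewrite !mxE ord1 primE//; last first.
      by have := (cdr i).1 w k 0.
    apply: eq_Rintegral => tau; rewrite inE/= in_itv/= => /andP[tau0 _].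
    by rewrite drE.
- by move=> i w; rewrite /x /z ode_sol0.
- move=> i w t t0; rewrite (_ : (fun t => _) = fun t => z i t w).
    by rewrite -meanE; exact: dzr.
  by apply/funext => u; rewrite /x addrK.
Qed.

(** Applies to agents whose initial state is deterministic: preimages under a constant are empty or
    everything, and such events form a sigma-algebra. *)
Lemma sigma_of_cst (K T : Type) (R : realType) (D : set K) (Y : K -> T -> R) (E : set T) :
  (forall k w w', Y k w = Y k w') -> sigma_of D Y E -> E = set0 \/ E = setT.
Proof.
move=> hY hE; suff : [set E : set T | E = set0 \/ E = setT] E by [].
apply: hE; split; last first.
  move=> _ [k Dk [B mB <-]] /=; rewrite setTI.
  have [[w hw]|h] := pselect (exists w, B (Y k w)); [right|left].
    by apply/seteqP; split => // w' _ /=; rewrite (hY k w' w).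
  by apply/seteqP; split => // w' hw; apply: h; exists w'.
split.
- by left.
- by move=> F [->|->]; [right|left]; rewrite ?setD0 ?setDT.
- move=> F hF; have [[i Fi]|h] := pselect (exists i, F i = setT); [right|left].
    by apply/seteqP; split => // w _; exists i => //; rewrite Fi.
  rewrite bigcup0// => i _; have [//|Fi] := hF i.
  by exfalso; apply: h; exists i.
Qed.

(** With at most one nontrivial family, each intersection is empty, the whole space, or an event of
    that family. This is the case when a single agent is randomized. *)
Lemma mutually_indep_trivial d (T : measurableType d) (R : realType) (P : probability T R)
    (I : finType) (F : I -> set (set T)) (i0 : I) :
  (forall i E, i != i0 -> F i E -> E = set0 \/ E = setT) -> mutually_indep P F.
Proof.
move=> hF J E hE.
have [[i [iJ Ei]]|h] := pselect (exists i, i \in J /\ E i = set0).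
  have -> : \bigcap_(i in [set` J]) E i = set0.
    by apply/seteqP; split => // w /(_ i iJ); rewrite Ei.
  by rewrite (bigD1 i)//= Ei measure0 mul0e.
have hT i : i \in J -> i != i0 -> E i = setT.
  move=> iJ ii0; have [Ei|//] := hF i _ ii0 (hE i iJ).
  by exfalso; apply: h; exists i.
have [i0J|i0J] := boolP (i0 \in J).
  rewrite (bigD1 i0)//= big1 ?mule1; last first.
    by move=> i /andP[iJ ii0]; rewrite hT// probability_setT.
  congr (P _); apply/seteqP; split => [w /(_ i0 i0J)//|w Ew i /= iJ].
  by have [->//|ii0] := eqVneq i i0; rewrite hT.
rewrite big1; last first.
  move=> i iJ; rewrite hT ?probability_setT//.
  by apply: contraNneq i0J => <-.
rewrite -(probability_setT P); congr (P _); apply/seteqP; split => // w _ i /= iJ.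
by rewrite hT//; apply: contraNneq i0J => <-.
Qed.

Lemma extension_wiener d d' (T : measurableType d) (T' : measurableType d') (R : realType)
    (P : probability T R) (P' : probability T' R) (proj : T' -> T) (n : nat) (W : R -> T -> R)
    (sigma : R -> 'cV[R]_n) (t : R) (J : T -> 'cV[R]_n) :
  extension P P' proj -> (forall s, 0 <= s -> measurable_fun setT (W s)) -> 0 <= t ->
  (forall k, measurable_fun setT (fun w => J w k 0)) ->
  is_wiener_integral P W sigma t J ->
  is_wiener_integral P' (fun t w => W t (proj w)) sigma t (fun w => J (proj w)).
Proof.
move=> [mp hp] mW t0 mJ; rewrite /is_wiener_integral /=.
set u := (X in X @ \oo --> _ -> _); set v := (X in _ -> X @ \oo --> _).
have -> : v = u; last by [].
apply/funext => m; rewrite /v /u.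
apply: (ge0_integral_law (f := fun w => sqnorm (J w - \sum_(k < m)
  (W (t * k.+1%:R / m%:R) w - W (t * k%:R / m%:R) w) *: sigma (t * k%:R / m%:R)))) => //.
  apply: measurable_sqnorm => k.
  rewrite (_ : (fun w => _) = fun w => J w k 0 - \sum_(i < m)
    (W (t * i.+1%:R / m%:R) w - W (t * i%:R / m%:R) w) * sigma (t * i%:R / m%:R) k 0).
    apply: measurable_funB => //; apply: measurable_sum => i.
    apply: measurable_funM => //; apply: measurable_funB; apply: mW;
      by rewrite !mulr_ge0// invr_ge0.
  apply/funext => w; rewrite !mxE summxE; congr (_ - _).
  by apply: eq_bigr => i _; rewrite !mxE.
by move=> w; exact: sqnorm_ge0.
Qed.

Lemma wnorm_le_total_cost d (T : measurableType d) (R : realType) (P : probability T R)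
    (n r N : nat) (rho : R) (u : R -> 'cV[R]_n -> 'cV[R]_r) (x : 'I_N -> R -> T -> 'cV[R]_n) :
  (forall i, cont_proc (x i)) ->
  (\int[P]_w (\sum_i wnorm rho (fun t => x i t w)) <= total_cost P rho u x)%E.
Proof.
move=> cx; rewrite ge0_integral_sum//; last 2 first.
- by move=> i; exact: measurable_wnorm.
- by move=> i w _; exact: wnorm_ge0.
apply: lee_sum => i _; apply: ge0_le_integral_nomeas => w; first exact: wnorm_ge0.
rewrite /wnorm [leLHS]integral_mkcond [leRHS]integral_mkcond; apply: ge0_le_integral_nomeas => t.
  by rewrite /patch; case: ifPn => // _; rewrite lee_fin wsq_ge0.
rewrite /patch; case: ifPn => // _; rewrite lee_fin /wsq ler_wpM2l ?expR_ge0// lerDl.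
exact: sqnorm_ge0.
Qed.

(* [D] is the difference of the two outcomes of the coin along one noise path. *)
Lemma cost_difference d (T : measurableType d) (R : realType) (P : probability T R)
    (n r N : nat) (rho : R) (A G : 'M[R]_n) (B : 'M[R]_(n, r)) (Rc : 'M[R]_r)
    (f sigma : R -> 'cV[R]_n) (X Pi : 'M[R]_n) (s xbar : R -> 'cV[R]_n) (xbar0 v : 'cV[R]_n)
    (W : 'I_N -> R -> T -> R) (i0 : 'I_N) :
  let Abar := A - B *m invmx Rc *m B^T *m X in
  C_half rho f -> C_half rho sigma -> C_half rho s -> C_half rho xbar ->
  indep_brownian_motions P W ->
  (forall (P' : probability (T * bool)%type R), extension P P' fst ->
    let W' := fun i t (w : T * bool) => W i t (fst w) in
    let u := control_law B Rc X Pi s xbar in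
    forall (C0 : R) (x0 : 'I_N -> T * bool -> 'cV[R]_n) (x : 'I_N -> R -> T * bool -> 'cV[R]_n),
    admissible_initial P' W' xbar0 C0 x0 ->
    closed_loop P' A G B f sigma W' u x0 x -> (total_cost P' rho u x < +oo)%E) ->
  exists D : 'I_N -> R -> 'cV[R]_n,
    [/\ forall i, mx_cont (D i), forall i, D i 0 = if i == i0 then v else 0,
      forall i t, 0 < t -> mx_deriv (D i) t (Abar *m D i t + G *m empirical_mean (fun j => D j t)) &
      forall i, (wnorm rho (D i) < +oo)%E].
Proof.
move=> Abar hf hsigma hs hxb [bm _] hcost.
have [P1 [ext ind coin]] := coin_extension_exists P.
have N0 : (0 < N)%N by apply: leq_ltn_trans (ltn_ord i0).
have [cf _] := posmax_C_half hf; have [cs _] := posmax_C_half hs.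
have [cb _] := posmax_C_half hxb; have [csg _] := posmax_C_half hsigma.
have /choice[J hJ] : forall i, exists J : R -> T -> 'cV[R]_n, cont_proc J /\
    forall t, 0 <= t -> is_wiener_integral P (W i) sigma t (J t).
  by move=> i; exact: wiener_vec_exists (bm i) csg.
have mW i t : 0 <= t -> measurable_fun setT (W i t) by case: (bm i) => h _ _ _ _; exact: h.
pose J' i t (p : T * bool) := J i t p.1.
have cJ' i : cont_proc (J' i).
  have [[c m] _] := hJ i; split; first by move=> p; exact: c.
  by move=> t k t0; apply: (measurableT_comp (f := fun w => J i t w k 0)) => //; exact: m.
pose W' i t (p : T * bool) := W i t p.1.
have wJ' i t : 0 <= t -> is_wiener_integral P1 (W' i) sigma t (J' i t).
  move=> t0; have [[c m] h] := hJ i.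
  exact: (extension_wiener ext (mW i) t0 (fun k => m t k t0) (h t t0)).
pose y (b : bool) : 'cV[R]_n := (if b then 1 else -1) *: (2^-1 *: v).
pose g i b := xbar0 + (if i == i0 then y b else 0).
pose x0 (i : 'I_N) (p : T * bool) := g i p.2.
have mx0 i k : measurable_fun setT (fun p : T * bool => x0 i p k 0).
  by apply: (measurableT_comp (f := fun b : bool => g i b k 0)).
have [x [b [clx cx x00 dx]]] := closed_loop_of_noise A G B Rc X Pi N0 cf cs cb mx0 cJ' wJ'.
(* Bounds the squared initial states for both outcomes of the coin; since the moment condition is
   strict, [M + 1] is the constant passed on. *)
pose M : R := 2 * sqnorm xbar0 + 2 * sqnorm (2^-1 *: v).
have bx0 i p : sqnorm (x0 i p) <= M.
  rewrite /x0 /g; apply: le_trans (sqnormD_le _ _) _; rewrite lerD2l ler_wpM2l//.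
  case: ifP => _; last by rewrite sqnorm0 sqnorm_ge0.
  by rewrite /y; case: (p.2); rewrite ?scale1r ?scaleN1r ?sqnormN.
have adm : admissible_initial P1 W' xbar0 (M + 1) x0.
  split.
  - exact: mx0.
  - apply: (@mutually_indep_trivial _ _ _ P1 _ _ i0) => i E ii0; apply: sigma_of_cst => k w w'.
    by rewrite /x0 /g (negbTE ii0).
  - move=> i k; have hxi := fun_if.
    pose c : R := if i == i0 then (2^-1 *: v) k 0 else 0.
    pose xi (p : T * bool) : R := if p.2 then 1 else -1.
    have mxi : measurable_fun setT xi.
      by apply: (measurableT_comp (f := fun b : bool => if b then 1 else -1 : R)).
    have Lxi : L1 P1 xi.
      apply: L1_le mxi (L1_cst P1 1) _ => p; rewrite /xi.
      by case: (p.2); rewrite ?normrN normr1.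
    have Exi : Ex P1 xi = 0.
      (* The integral formula for the coin covers nonnegative functions, so the sign variable is
         shifted by 1 before its mean is computed. *)
      have e : (\int[P1]_p (xi p + 1)%:E = 1)%E.
        rewrite coin; last 2 first.
        + by apply/measurable_EFinP; exact: measurable_funD.
        + by move=> p; rewrite lee_fin /xi; case: (p.2); rewrite ?addNr// addr_ge0.
        rewrite /xi/= addNr mule0 adde0 -EFinM mulVf// integral_cst//=.
        by rewrite [X in (_ * X)%E]probability_setT mule1.
      have := ExD Lxi (L1_cst P1 1); rewrite Ex_cst {1}/Ex /Rintegral e /=; lra.
    rewrite unlock /= (_ : (fun p => _) = (fun p => (xbar0 k 0 + c * xi p)%:E)); last first.
      apply/funext => p; congr EFin; rewrite /x0 /g mxE; congr (_ + _).
      rewrite /c /xi; case: ifP => _; last by rewrite mxE mul0r.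
      by rewrite /y !mxE mulrC.
    have LL := L1D (L1_cst P1 (xbar0 k 0)) (L1Z c Lxi).
    by rewrite (ExE LL) (ExD (L1_cst P1 _) (L1Z c Lxi)) (ExZ _ Lxi) Exi Ex_cst mulr0 addr0.
  - move=> i; apply: (@le_lt_trans _ _ (\int[P1]_p M%:E)%E).
      by apply: ge0_le_integral_nomeas => p; rewrite lee_fin ?sqnorm_ge0.
    rewrite integral_cst//= [X in (_ * X)%E]probability_setT mule1 lte_fin; lra.
  - move=> E1 E2 h1 h2.
    have [F1 _ ->] := sigma_of_comp (Y := fun p b => g p.1 b p.2 0) (proj := snd) h1.
    have [F2 hF2 ->] := sigma_of_comp (Y := fun p : 'I_N * R => W p.1 p.2) (proj := fst) h2.
    have mF2 : measurable F2 by apply: sigma_of_measurable hF2 => -[i t] /= t0; exact: mW.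
    by rewrite setIC ind// muleC.
have fin := hcost P1 ext (M + 1) x0 x adm clx.
have := le_lt_trans (wnorm_le_total_cost P1 rho (control_law B Rc X Pi s xbar) cx) fin.
pose F p : \bar R := (\sum_i wnorm rho (fun t => x i t p))%E.
have mF : measurable_fun setT F by apply: emeasurable_sum => i; exact: measurable_wnorm.
have F0 p : (0 <= F p)%E by apply: sume_ge0 => i _; exact: wnorm_ge0.
rewrite (coin F mF F0) => finF.
(* If each noise path had infinite cost for one of the outcomes, the average over the coin would be
   infinite everywhere. A path on which both outcomes are finite makes the difference deterministic
   and of finite norm. *)
have [w [hw1 hw2]] : exists w, (F (w, true) < +oo)%E /\ (F (w, false) < +oo)%E.
  apply: contrapT => /forallNP hn.
  suff e : (\int[P]_w ((2^-1)%:E * F (w, true) + (2^-1)%:E * F (w, false)) = +oo)%E.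
    by move: finF; rewrite e ltxx.
  rewrite (_ : (fun w => _) = cst +oo%E).
    by rewrite integral_cst//= [X in (_ * X)%E]probability_setT mule1.
  apply/funext => w /=; have h2 : (0 < (2^-1)%:E :> \bar R)%E by rewrite lte_fin invr_gt0.
  have [e1|e1] := eqVneq (F (w, true)) +oo%E.
    by rewrite e1 gt0_muley// addye// gt_eqF// (lt_le_trans (ltNyr 0))// mule_ge0// ltW.
  have [e2|e2] := eqVneq (F (w, false)) +oo%E.
    by rewrite e2 gt0_muley// addey// gt_eqF// (lt_le_trans (ltNyr 0))// mule_ge0// ltW.
  by exfalso; apply: (hn w); rewrite !ltey.
have Ffin p i : (F p < +oo)%E -> (wnorm rho (fun t => x i t p) < +oo)%E.
  apply: le_lt_trans; rewrite /F (bigD1 i)//= leeDl//.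
  by apply: sume_ge0 => j _; exact: wnorm_ge0.
exists (fun i t => x i t (w, true) - x i t (w, false)); split.
- by move=> i; apply: mx_contB; exact: (cx i).1.
- move=> i; rewrite !x00 /J' /x0 /g /=.
  case: ifP => _; last by rewrite subrr.
  rewrite /y scaleN1r scale1r; move: (J i 0 w) => a.
  apply/matrixP => k j; rewrite !mxE; lra.
- move=> i t t0; rewrite (_ : (fun t => _) = fun t => (x i t (w, true) - J' i t (w, true)) -
      (x i t (w, false) - J' i t (w, false))); last first.
    apply/funext => u; rewrite /J' /=; move: (x i u _) (x i u _) (J i u w) => a1 a2 a3.
    by apply/matrixP => k j; rewrite !mxE; ring.
  apply: (mx_deriv_eq (mx_derivB (dx i (w, true) t t0) (dx i (w, false) t t0))).
  rewrite -/Abar (mulmxBr Abar (x i t (w, true))).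
  have -> : empirical_mean (fun j => x j t (w, true) - x j t (w, false)) =
      empirical_mean (fun j => x j t (w, true)) - empirical_mean (fun j => x j t (w, false)).
    by rewrite /empirical_mean sumrB scalerBr.
  rewrite (mulmxBr G); move: (Abar *m x i t (w, true)) (Abar *m x i t (w, false)) => a1 a2.
  move: (G *m _) (G *m _) (b t) => a3 a4 a5.
  by apply/matrixP => k j; rewrite !mxE; ring.
- move=> i; apply: wnormD_fin; first exact: (cx i).1.
  + by apply: mx_contN; exact: (cx i).1.
  + exact: Ffin.
  + by rewrite wnormN; exact: Ffin.
Qed.

(** The coupling term is the same for all agents, so it cancels in the difference of two of them;
    this needs a second agent, hence [1 < N]. In the sum over all agents it adds up to [G] times
    that sum. *)
Lemma cost_hurwitz d (T : measurableType d) (R : realType) (P : probability T R)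
    (n r N : nat) (rho : R) (A G : 'M[R]_n) (B : 'M[R]_(n, r)) (Rc : 'M[R]_r)
    (f sigma : R -> 'cV[R]_n) (X Pi : 'M[R]_n) (s xbar : R -> 'cV[R]_n) (xbar0 : 'cV[R]_n)
    (W : 'I_N -> R -> T -> R) :
  let Abar := A - B *m invmx Rc *m B^T *m X in
  (1 < N)%N ->
  C_half rho f -> C_half rho sigma -> C_half rho s -> C_half rho xbar ->
  indep_brownian_motions P W ->
  (forall (P' : probability (T * bool)%type R), extension P P' fst ->
    let W' := fun i t (w : T * bool) => W i t (fst w) in
    let u := control_law B Rc X Pi s xbar in
    forall (C0 : R) (x0 : 'I_N -> T * bool -> 'cV[R]_n) (x : 'I_N -> R -> T * bool -> 'cV[R]_n),
    admissible_initial P' W' xbar0 C0 x0 ->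
    closed_loop P' A G B f sigma W' u x0 x -> (total_cost P' rho u x < +oo)%E) ->
  hurwitz (Abar - (rho / 2)%:M) /\ hurwitz (Abar + G - (rho / 2)%:M).
Proof.
move=> Abar N1 hf hsigma hs hxb hW hcost.
have N0 : (0 < N)%N by exact: ltnW.
pose i0 := Ordinal N0; pose i1 := Ordinal N1.
have hD v := cost_difference v i0 hf hsigma hs hxb hW hcost.
split; apply: hurwitz_of_wnorm => v; have [D [cD D0 dD fD]] := hD v.
- exists (fun t => D i0 t - D i1 t); split.
  + exact: mx_contB.
  + by rewrite !D0 eqxx subr0.
  + move=> t t0; apply: (mx_deriv_eq (mx_derivB (dD i0 t t0) (dD i1 t t0))).
    rewrite (mulmxBr Abar (D i0 t)) -/Abar; move: (Abar *m D i0 t) (Abar *m D i1 t) (G *m _) => a1 a2 a3.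
    by apply/matrixP => k j; rewrite !mxE; ring.
  + by apply: wnormD_fin => //; [exact: mx_contN|rewrite wnormN].
exists (fun t => \sum_j D j t); split.
- move=> k j; rewrite (_ : (fun t => _) = fun t => \sum_i D i t k j).
    by apply: continuous_bigsum => i; exact: cD.
  by apply/funext => t; rewrite summxE.
- by rewrite (bigD1 i0)//= D0 eqxx big1 ?addr0// => j ji0; rewrite D0 (negbTE ji0).
- move=> t t0; apply: (mx_deriv_eq (mx_deriv_sum (index_enum 'I_N) (fun i => dD i t t0))).
  rewrite big_split/= -mulmx_sumr (mulmxDl Abar G); congr (_ + _).
  rewrite -mulmx_sumr sumr_const card_ord /empirical_mean; congr (_ *m _).
  rewrite -scaler_nat scalerA mulfV ?scale1r// pnatr_eq0 -lt0n//.
have : forall r : seq 'I_N, mx_cont (fun t => \sum_(j <- r) D j t) /\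
    (wnorm rho (fun t => \sum_(j <- r) D j t)%R < +oo)%E; last by move=> h; exact: (h _).2.
elim=> [|j l [c IH]].
  rewrite (_ : (fun t => _) = fun t : R => 0 *m D i0 t).
    by split; [exact: (@mx_contMl _ _ _ _ 0 _ (cD i0))|exact: wnormMl_fin].
  by apply/funext => t; rewrite big_nil mul0mx.
rewrite (_ : (fun t => _) = fun t => D j t + \sum_(i <- l) D i t).
  by split; [exact: mx_contD|exact: wnormD_fin].
by apply/funext => t; rewrite big_cons.
Qed.

Theorem mainTheorem6 (R : realType) (n r N : nat) (hN : (1 < N)%N)
    (rho : R) (hrho : 0 < rho)
    (A G Gamma Q : 'M[R]_n) (B : 'M[R]_(n, r)) (Rc : 'M[R]_r)
    (eta xbar0 : 'cV[R]_n) (f sigma : R -> 'cV[R]_n)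
    (hQ : Q^T = Q) (hRsym : Rc^T = Rc) (hRpos : positive_definite Rc)
    (hf : C_half rho f) (hsigma : C_half rho sigma)
    (d : measure_display) (T : measurableType d) (Pr : probability T R)
    (W : 'I_N -> R -> T -> R) (hW : indep_brownian_motions Pr W) :
  let Qhat := (1%:M - Gamma)^T *m Q *m (1%:M - Gamma) in
  let Abar (P : 'M[R]_n) := A - B *m invmx Rc *m B^T *m P in
  no_imaginary_eigenvalue (hamiltonian rho A B Q Rc) ->
  no_imaginary_eigenvalue (hamiltonian rho (A + G) B Qhat Rc) ->
  let statement_i :=
    exists P Pi : 'M[R]_n, exists s xbar : R -> 'cV[R]_n,
    [/\ P^T = P /\ riccati rho A B Q Rc P,
        Pi^T = Pi /\ riccati rho (A + G) B Qhat Rc Pi,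
        C_half rho s /\ s_equation rho A G Gamma Q B Rc eta f Pi s,
        C_half rho xbar /\ xbar_equation A G B Rc f Pi s xbar xbar0 &
        forall (d' : measure_display) (T' : measurableType d')
               (Pr' : probability T' R) (proj : T' -> T),
        extension Pr Pr' proj ->
        let W' := fun i t w => W i t (proj w) in
        let u := control_law B Rc P Pi s xbar in
        forall (C0 : R) (x0 : 'I_N -> T' -> 'cV[R]_n)
               (x : 'I_N -> R -> T' -> 'cV[R]_n),
        admissible_initial Pr' W' xbar0 C0 x0 ->
        closed_loop Pr' A G B f sigma W' u x0 x ->
        (total_cost Pr' rho u x < +oo)%E] in
  let statement_ii :=
    exists P Pi : 'M[R]_n,
    [/\ stabilizing_solution rho A B Q Rc P,
        stabilizing_solution rho (A + G) B Qhat Rc Pi &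
        hurwitz (Abar P + G - (rho / 2)%:M)] in
  let statement_iii :=
    [/\ stabilizable (A - (rho / 2)%:M) B,
        stabilizable (A + G - (rho / 2)%:M) B &
        forall P : 'M[R]_n, stabilizing_solution rho A B Q Rc P ->
        hurwitz (Abar P + G - (rho / 2)%:M)] in
  (statement_i <-> statement_ii) /\ (statement_ii <-> statement_iii).
Proof.
move=> Qhat Abar nP nPi statement_i statement_ii statement_iii.
have hQhat : Qhat^T = Qhat := tracking_weight_sym Gamma hQ.
have N0 : (0 < N)%N by exact: ltnW.
have stabG P : hurwitz (Abar P + G - (rho / 2)%:M) -> stabilizable (A + G - (rho / 2)%:M) B.
  move=> h; apply: (@stabilizable_of_hurwitz _ _ _ _ _ _ Rc P).
  have e (S : 'M[R]_n) : A + G - S = A - S + G by rewrite addrAC.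
  by rewrite e.
split; split.
- move=> [P [Pi [s [xbar [[Ps PR] [Pis PiR] [Cs sE] [Cx xE] hcost]]]]].
  (* Of all extensions allowed in (i), only the product with a coin is used, with the first
     projection. *)
  have [h1 h2] := cost_hurwitz hN hf hsigma Cs Cx hW (fun P' => hcost _ _ P' fst).
  have [Y hY] := stabilizing_solution_exists hQhat hRsym hRpos (stabG P h2) nPi.
  exists P, Y; split; [split; [exact: Ps|exact: PR|exact: h1]|exact: hY|exact: h2].
- move=> [P [Pi [[Ps PR h1] [Pis PiR h2] h3]]].
  have [s [xbar [Cs sE Cx xE]]] := feedback_exists Gamma Q eta xbar0 hrho hf h2.
  exists P, Pi, s, xbar; split; [split; [exact: Ps|exact: PR]|split; [exact: Pis|exact: PiR]|
    split; [exact: Cs|exact: sE]|split; [exact: Cx|exact: xE]|].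
  move=> d' T' P' proj ext W' u C0 x0 x [mx0 _ _ fx0 _] cl.
  have bm i : brownian_motion P' (W' i).
    by apply: (extension_brownian ext); have [bm _] := hW; exact: bm.
  have fx i : (\int[P']_w (sqnorm (x0 i w))%:E < +oo)%E.
    exact: (lt_trans (fx0 i) (ltry _)).
  exact: (closed_loop_cost_fin N0 hrho h1 h3 hf hsigma Cs Cx bm mx0 fx cl).
- move=> [P [Pi [hP hPi h3]]]; split.
  + by have [_ _ h] := hP; exact: stabilizable_of_hurwitz h.
  + exact: stabG h3.
  + by move=> P' hP'; rewrite (stabilizing_solution_unique hRsym hP' hP).
- move=> [s1 s2 h]; have [P hP] := stabilizing_solution_exists hQ hRsym hRpos s1 nP.
  have [Pi hPi] := stabilizing_solution_exists hQhat hRsym hRpos s2 nPi.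
  exists P, Pi; split; [exact: hP|exact: hPi|exact: h].
Qed.
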